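(* Let $G_0=(V_0,E_0)$ be a finite connected undirected graph, and let $\mathcal{G}=(V,E)$ be the associated ladder with translation invariant positive edge weights $\beta=(\beta_e)_{e\in E}$, as described in the context. There exist constants $c_1,c_2>0$ depending only on $G_0$ and $\beta$ such that for any $L=(-\underline{L},\overline{L})$ with $\underline{L},\overline{L}\in\mathbb{N}$, any numbers $\pi_i\ge0$, $i\in V_L$, and any two different vertices $x,y\in V_L$ with $\pi_x,\pi_y>0$, one has, with $c_3=c_3(\pi):=\min\{\pi_x,\pi_y\}^{-1}$ and $\boldsymbol{\varepsilon}=(\varepsilon_i)_{i\in V_L}=(\epsilon\pi_i)_{i\in V_L}$ for $\epsilon>0$, $$0<\lim_{\epsilon\downarrow 0}\epsilon\,E_{\mu_L^{\boldsymbol{\varepsilon}}}[G_{xy}^{\boldsymbol{\varepsilon}}]\le c_1c_3e^{-c_2|x-y|}.$$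
   Context: Ladder: $\mathcal{G}=(V,E)$ has vertex set $V=\mathbb{Z}\times V_0$ and edge set $E$ consisting of the ''vertical'' edges $e_n:=((n,v)\sim(n,v'))$ with $n\in\mathbb{Z}$ and $e=(v\sim v')\in E_0$, and the ''horizontal'' edges $v_{n+1/2}:=((n,v)\sim(n+1,v))$ with $n\in\mathbb{Z}$, $v\in V_0$. Each $e\in E$ has a weight $\beta_e>0$, and the weights are translation invariant: $\beta_{e_n}=\beta_{e_0}$ and $\beta_{v_{n+1/2}}=\beta_{v_{1/2}}$ for all $n\in\mathbb{Z}$, $e\in E_0$, $v\in V_0$. For $\underline{L},\overline{L}\in\mathbb{N}$, $L:=(-\underline{L},\overline{L})$, $\mathcal{G}_L=(V_L,E_L)$ is the subgraph of $\mathcal{G}$ with $V_L:=\{-\underline{L},\ldots,\overline{L}\}\times V_0$ and $E_L$ the set of all edges in $E$ connecting two vertices of $V_L$. For $x=(n,v)$, $y=(m,w)$ in $V$, $|x-y|:=|n-m|$ (horizontal distance). Measure $\mu_L^{\boldsymbol{\varepsilon}}$: Given $\varepsilon_i\ge0$, $i\in V_L$, with at least one $\varepsilon_i>0$, add to $\mathcal{G}_L$ an extra vertex $\rho$ and edges $i\sim\rho$, $i\in V_L$, with weights $\beta_{i\rho}:=\varepsilon_i$; let $V_{L,\rho}=V_L\cup\{\rho\}$, $E_{L,\rho}=E_L\cup\{(i\sim\rho):i\in V_L\}$, and let $\mathcal{T}$ be the set of spanning trees (identified with their edge sets) of this extended graph. For $t,s\in\mathbb{R}^{V_L}$ put $t_\rho:=0$,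 $s_\rho:=0$, and $B_{ij}(t,s):=\cosh(t_i-t_j)+\frac12(s_i-s_j)^2e^{t_i+t_j}$ for $i,j\in V_{L,\rho}$. Then, writing $\beta_{ij}$ for the weight of $(i\sim j)$, $$\mu_L^{\boldsymbol{\varepsilon}}(dt\,ds\,dT):=\prod_{j\in V_L}\frac{dt_j\,ds_j\,e^{-t_j}}{2\pi}\,dT\prod_{(i\sim j)\in E_{L,\rho}}e^{-\beta_{ij}(B_{ij}(t,s)-1)}\prod_{(i\sim j)\in T}\beta_{ij}e^{t_i+t_j}$$ on $\mathbb{R}^{V_L}\times\mathbb{R}^{V_L}\times\mathcal{T}$, with $dt_j,ds_j$ Lebesgue measure and $dT$ counting measure (in $1/(2\pi)$, $\pi$ is the usual constant). It is known that this is a probability measure. Green's function: $A(t)\in\mathbb{R}^{V_L\times V_L}$ has entries $A(t)_{ij}=-\beta_{ij}e^{t_i+t_j}$ if $(i\sim j)\in E_L$, $A(t)_{jj}=\sum_{k\in V_L:(k\sim j)\in E_L}\beta_{kj}e^{t_k+t_j}$, and $0$ otherwise; $\hat{\boldsymbol{\varepsilon}}(t):=\operatorname{diag}(\varepsilon_ie^{t_i},\,i\in V_L)$; $G_{xy}^{\boldsymbol{\varepsilon}}:=e^{t_x+t_y}\big((A(t)+\hat{\boldsymbol{\varepsilon}}(t))^{-1}\big)_{xy}$. *)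

(* Defs.v *)
From HB Require Import structures.
From mathcomp Require Import all_boot all_order all_algebra.
From mathcomp Require Import all_classical all_reals all_analysis.
From mathcomp Require Import measurable_realfun.

Set Implicit Arguments.
Unset Strict Implicit.
Unset Printing Implicit Defensive.

Import Order.TTheory GRing.Theory Num.Theory.
Import numFieldNormedType.Exports.

Local Open Scope classical_set_scope.
Local Open Scope ring_scope.

Section lebesgue_tuple.
Context {R : realType}.
Local Open Scope ereal_scope.
Local Notation tup n := (n.-tuple (measurableTypeR R)).

Definition cons_pair n (z : measurableTypeR R * tup n) : tup n.+1 :=
  [tuple of z.1 :: z.2].

Fixpoint lebesgue_tuple n : set (tup n) -> \bar R :=
  match n return set (tup n) -> \bar R with
  | 0 => \d_([tuple] : tup 0)
  | m.+1 => pushforward (@lebesgue_measure R \x @lebesgue_tuple m)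
              (@cons_pair m)
  end.

Let uncons n (t : tup n.+1) : measurableTypeR R * tup n :=
  (thead t, [tuple of behead t]).

Let measurable_cons_pair n : measurable_fun setT (@cons_pair n).
Proof. by apply: measurable_cons. Qed.

Let measurable_uncons n : measurable_fun setT (@uncons n).
Proof.
apply: measurable_fun_pair; first exact: measurable_tnth.
exact: measurable_behead.
Qed.

Let cons_pairK n : cancel (@cons_pair n) (@uncons n).
Proof.
by case=> x t; rewrite /uncons /cons_pair theadE; congr pair; exact/val_inj.
Qed.

Let pushforward_cons_sigma_finite n (m : {sigma_finite_measure set
    (tup n) -> \bar R}) :
  sigma_finite setT (pushforward (@lebesgue_measure R \x m) (@cons_pair n)).
Proof.
have [F TF mF] : sigma_finite setT (@lebesgue_measure R \x m).
  have /sigma_finiteP[F [TF ndF mF]] := sigma_finiteT (@lebesgue_measure R).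
  have /sigma_finiteP[G [TG ndG mG]] := sigma_finiteT m.
  exists (fun k => F k `*` G k).
    rewrite -setXTT TF TG predeqE => -[x y]; split.
      move=> [/= [k _ Fkx] [l _ Gly]]; exists (maxn k l) => //; split.
      - by move: x Fkx; exact/subsetPset/ndF/leq_maxl.
      - by move: y Gly; exact/subsetPset/ndG/leq_maxr.
    by move=> [k _ []/= ? ?]; split; exists k.
  move=> k; have [? ?] := mF k; have [? ?] := mG k.
  split; first exact: measurableX.
  by rewrite product_measure1E// lte_mul_pinfty// ge0_fin_numE.
exists (fun k => @uncons n @^-1` F k).
  by rewrite -preimage_bigcup -TF preimage_setT.
move=> k; have [mFk Fkoo] := mF k; split.
  by rewrite -[X in measurable X]setTI; exact: measurable_uncons.
rewrite /pushforward -comp_preimage (_ : _ \o _ = id) ?preimage_id//.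
by apply/funext => z /=; exact: cons_pairK.
Qed.

Lemma lebesgue_tuple_exists n : exists m : {sigma_finite_measure set
    (tup n) -> \bar R}, m = @lebesgue_tuple n :> (_ -> _).
Proof.
elim: n => [|n [m mE]]; first by eexists; rewrite /=; reflexivity.
rewrite /= -mE.
set p := pushforward _ _.
have ps : sigma_finite setT p by exact: pushforward_cons_sigma_finite.
pose pm : {measure set (tup n.+1) -> \bar R} :=
  measure_function_pushforward__canonical__measure_function_Measure
    (@lebesgue_measure R \x m) (@measurable_cons_pair n).
pose psf := isSFinite.Build _ _ _ p
  (@sfinite_measure_sigma_finite _ _ _ pm ps).
pose psigma := isSigmaFinite.Build _ _ _ p ps.
pose P := HB.pack_for {sigma_finite_measure set (tup n.+1) -> \bar R}
  (Measure.sort pm) psf psigma.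
by exists P.
Qed.
Variable n : nat.

Let lebesgue_tuple0 : @lebesgue_tuple n set0 = 0.
Proof. by have [m <-] := lebesgue_tuple_exists n; exact: measure0. Qed.

Let lebesgue_tuple_ge0 A : 0 <= @lebesgue_tuple n A.
Proof. by have [m <-] := lebesgue_tuple_exists n; exact: measure_ge0. Qed.

Let lebesgue_tuple_sigma_additive : semi_sigma_additive (@lebesgue_tuple n).
Proof.
by have [m <-] := lebesgue_tuple_exists n; exact: measure_semi_sigma_additive.
Qed.

Let lebesgue_tuple_sigma_finite : sigma_finite setT (@lebesgue_tuple n).
Proof. by have [m <-] := lebesgue_tuple_exists n; exact: sigma_finiteT. Qed.

HB.instance Definition _ := isMeasure.Build _ _ _ (@lebesgue_tuple n)
  lebesgue_tuple0 lebesgue_tuple_ge0 lebesgue_tuple_sigma_additive.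

HB.instance Definition _ := Measure_isSigmaFinite.Build _ _ _
  (@lebesgue_tuple n) lebesgue_tuple_sigma_finite.

End lebesgue_tuple.

Lemma lebesgue_tuple_box (R : realType) n
    (A : 'I_n -> set (measurableTypeR R)) :
    (forall i, measurable (A i)) ->
  (@lebesgue_tuple R n [set t | forall i, A i (tnth t i)] =
  \prod_(i < n) lebesgue_measure (A i))%E.
Proof.
elim: n A => [|n ih] A mA.
  by rewrite big_ord0 /= diracE mem_set//= => -[].
rewrite big_ord_recl -ih// -product_measure1E//; last first.
  rewrite [X in measurable X](_ : _ =
    \bigcap_(i in [set: 'I_n]) ((fun t : n.-tuple (measurableTypeR R) =>
      tnth t i) @^-1` A (lift ord0 i))).
    apply: fin_bigcap_measurable => // i _.
    by rewrite -[X in measurable X]setTI; exact: measurable_tnth.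
  by apply/seteqP; split => [t At i _|t At i]; exact: At.
congr (product_measure1 _ _ _); apply/seteqP; split => -[x t] /=.
  move=> At; split; first exact: (At ord0).
  by move=> i; have := At (lift ord0 i); rewrite tnthS.
move=> [Ax At] i; case: (unliftP ord0 i) => [j ->|->//].
by rewrite tnthS.
Qed.

Section graphs.
Variable W : finType.
Implicit Types (r : rel W).

(* An undirected edge is the set of its two endpoints. *)
Definition edge_set := {set {set W}}.

Definition edges r : edge_set :=
  [set [set p.1; p.2]%SET | p : W * W & r p.1 p.2].

Definition edge_rel (T : edge_set) : rel W :=
  fun i j => ([set i; j] \in T)%SET.

Definition spanning_tree r (T : edge_set) : Prop :=
  [/\ (T \subset edges r)%SET,
      forall i j, connect (edge_rel T) i j &
      forall c : seq W, (2 < size c)%N -> ~ ucycle (edge_rel T) c].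

(* Product over the unordered pairs in E; f is meant to be symmetric, and each
   pair {i, j} is visited once, in the order given by enum_rank. *)
Definition edge_prod (R : realType) (E : edge_set) (f : W -> W -> R) : R :=
  \prod_(p : W * W | (enum_rank p.1 < enum_rank p.2)%N && edge_rel E p.1 p.2)
    f p.1 p.2.

End graphs.

HB.instance Definition _ (W : finType) := Finite.on (edge_set W).
HB.instance Definition _ (W : finType) := isPointed.Build (edge_set W) finset.set0.
HB.instance Definition _ (W : finType) :=
  @isMeasurable.Build default_measure_display (edge_set W)
    discrete_measurable discrete_measurable0
    discrete_measurableC discrete_measurableU.

Section spanning_tree_counting.
Context {R : realType} (W : finType) (r : rel W).
Local Open Scope ereal_scope.

Let measurable_spanning_trees : measurable [set T | spanning_tree r T].
Proof. by []. Qed.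

Definition spanning_tree_counting : set (edge_set W) -> \bar R :=
  mrestr (@counting _ R) measurable_spanning_trees.

HB.instance Definition _ := Measure.on spanning_tree_counting.

Let spanning_tree_counting_sigma_finite :
  sigma_finite setT spanning_tree_counting.
Proof.
exists (fun=> setT); first by rewrite bigcup_const//; exists 0%N.
move=> _; split=> //; rewrite /spanning_tree_counting /mrestr /counting.
rewrite asboolT ?ltry//; apply: (sub_finite_set (@subsetT _ _)).
exact: finite_finset.
Qed.

HB.instance Definition _ := Measure_isSigmaFinite.Build _ _ _
  spanning_tree_counting spanning_tree_counting_sigma_finite.

End spanning_tree_counting.

Section h22.
Context {R : realType} (V : finType).
(* adj, beta: a finite weighted graph; eps: the weights of the edges to the
   extra vertex rho, represented by None in option V. *)
Variables (adj : rel V) (beta : V -> V -> R) (eps : V -> R).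

Definition rho_adj : rel (option V) := fun i j =>
  match i, j with
  | Some a, Some b => adj a b
  | None, None => false
  | _, _ => true
  end.

Definition rho_weight (i j : option V) : R :=
  match i, j with
  | Some a, Some b => beta a b
  | Some a, None => eps a
  | None, Some b => eps b
  | None, None => 0
  end.

Definition config := #|V|.-tuple (measurableTypeR R).

Definition coord (t : config) (i : V) : R := tnth t (enum_rank i).

Definition rho_coord (t : config) (i : option V) : R :=
  if i is Some a then coord t a else 0.

Definition cosh (x : R) : R := (expR x + expR (- x)) / 2.

Definition Bfun (t s : config) (i j : option V) : R :=
  cosh (rho_coord t i - rho_coord t j) +
  (rho_coord s i - rho_coord s j) ^+ 2 *
    expR (rho_coord t i + rho_coord t j) / 2.

Definition h22_density (z : config * config * edge_set (option V)) : R :=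
  let: (t, s, T) := z in
  (\prod_(j : V) (expR (- coord t j) / (2 * pi))) *
  edge_prod (edges rho_adj)
    (fun i j => expR (- rho_weight i j * (Bfun t s i j - 1))) *
  edge_prod T
    (fun i j => rho_weight i j * expR (rho_coord t i + rho_coord t j)).

Definition h22_reference :
    set (config * config * edge_set (option V)) -> \bar R :=
  (@lebesgue_tuple R #|V| \x @lebesgue_tuple R #|V|
     \x spanning_tree_counting rho_adj)%E.

(* The maximum only makes h22_measure a measure for arbitrary real weights: the
   density is nonnegative as soon as beta and eps are, see h22_density_ge0. *)
Definition h22_measure :
    set (config * config * edge_set (option V)) -> \bar R :=
  fun A => (\int[h22_reference]_(z in A) (Num.max (h22_density z) 0)%:E)%E.

HB.instance Definition _ := Measure.on h22_reference.

Let measurable_coord i : measurable_fun setT (coord^~ i).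
Proof. exact: measurable_tnth. Qed.

Let measurable_rho_coord i : measurable_fun setT (rho_coord^~ i).
Proof.
by case: i => [i|]; [exact: measurable_coord|exact: measurable_cst].
Qed.

Let measurable_expR_comp d (T : measurableType d) (f : T -> R) :
  measurable_fun setT f -> measurable_fun setT (fun x => expR (f x)).
Proof. by move=> mf; apply: measurableT_comp. Qed.

Let measurable_edge_prod (E : edge_set (option V) -> edge_set (option V))
    (f : option V -> option V -> config * config * edge_set (option V) -> R) :
    (forall i j, measurable_fun setT (f i j)) ->
  measurable_fun setT (fun z => edge_prod (E z.2) (fun i j => f i j z)).
Proof.
move=> mf; rewrite /edge_prod.
under eq_fun do rewrite big_mkcond.
apply: measurable_prod => -[i j] _ /=.
apply: measurable_fun_ifT => //=.
by apply: (measurableT_comp (f := fun T => (_ < _)%N && edge_rel (E T) i j)).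
Qed.

Lemma measurable_h22_density : measurable_fun setT h22_density.
Proof.
have mt i : measurable_fun setT
    (fun z : config * config * edge_set (option V) => rho_coord z.1.1 i).
  apply: (measurableT_comp (measurable_rho_coord i)).
  exact: measurableT_comp.
have ms i : measurable_fun setT
    (fun z : config * config * edge_set (option V) => rho_coord z.1.2 i).
  apply: (measurableT_comp (measurable_rho_coord i)).
  exact: measurableT_comp.
rewrite (_ : h22_density = fun z => (\prod_(j : V)
      (expR (- rho_coord z.1.1 (Some j)) / (2 * pi))) *
    edge_prod (edges rho_adj)
      (fun i j => expR (- rho_weight i j * (Bfun z.1.1 z.1.2 i j - 1))) *
    edge_prod z.2 (fun i j => rho_weight i j *
      expR (rho_coord z.1.1 i + rho_coord z.1.1 j))); last first.
  by apply/funext => -[[t s] T].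
have mdt i j : measurable_fun setT (fun z : config * config *
    edge_set (option V) => rho_coord z.1.1 i - rho_coord z.1.1 j).
  by apply: measurable_funB; exact: mt.
have mst i j : measurable_fun setT (fun z : config * config *
    edge_set (option V) => expR (rho_coord z.1.1 i + rho_coord z.1.1 j)).
  by apply: measurable_expR_comp; apply: measurable_funD; exact: mt.
apply: measurable_funM; first apply: measurable_funM.
- apply: measurable_prod => j _; apply: measurable_funM => //.
  by apply: measurable_expR_comp; apply: measurable_funN; exact: mt.
- apply: (@measurable_edge_prod (fun=> edges rho_adj)) => i j.
  apply: measurable_expR_comp; apply: measurable_funM => //.
  apply: measurable_funB => //; apply: measurable_funD.
    apply: measurable_funM => //; apply: measurable_funD.
      by apply: measurable_expR_comp; exact: mdt.
    by apply: measurable_expR_comp; apply: measurable_funN; exact: mdt.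
  apply: measurable_funM => //; apply: measurable_funM; last exact: mst.
  by apply: measurable_funX; apply: measurable_funB; exact: ms.
- apply: (@measurable_edge_prod id) => i j.
  by apply: measurable_funM => //; exact: mst.
Qed.

Let h22_measure0 : h22_measure set0 = 0%E.
Proof. by rewrite /h22_measure integral_set0. Qed.

Let density_ge0 z : (0 <= (Num.max (h22_density z) 0)%:E)%E.
Proof. by rewrite lee_fin le_max lexx orbT. Qed.

Let h22_measure_ge0 A : (0 <= h22_measure A)%E.
Proof. by apply: integral_ge0 => z _; exact: density_ge0. Qed.

Let h22_measure_sigma_additive : semi_sigma_additive h22_measure.
Proof.
move=> /= F mF tF mUF; rewrite /h22_measure; apply: cvg_toP.
  apply: ereal_nondecreasing_is_cvgn => m n mn.
  by apply: lee_sum_nneg_natr => // k _ _; exact: h22_measure_ge0.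
rewrite ge0_integral_bigcup//.
apply/measurable_funTS; apply/measurable_EFinP; apply: measurable_maxr => //.
exact: measurable_h22_density.
Qed.

HB.instance Definition _ := isMeasure.Build _ _ _ h22_measure
  h22_measure0 h22_measure_ge0 h22_measure_sigma_additive.

Lemma h22_density_ge0 z : symmetric adj ->
    (forall i j, adj i j -> 0 <= beta i j) -> (forall i, 0 <= eps i) ->
  spanning_tree rho_adj z.2 -> 0 <= h22_density z.
Proof.
case: z => -[t s] T adjC beta0 eps0 [/= /fintype.subsetP TE _ _].
rewrite mulr_ge0 ?mulr_ge0//.
- by apply: prodr_ge0 => j _; rewrite divr_ge0 ?expR_ge0// mulr_ge0 ?pi_ge0.
- by apply: prodr_ge0 => p _; exact: expR_ge0.
have rho0 i j : rho_adj i j -> 0 <= rho_weight i j.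
  by case: i j => [i|] [j|] //=; exact: beta0.
have rhoC : symmetric rho_adj by case=> [i|] [j|] //=.
apply: prodr_ge0 => -[i j] /= /andP[_ /TE/finset.imsetP[[k l]]].
rewrite finset.inE /= => kl ijkl; rewrite mulr_ge0 ?expR_ge0//; apply: rho0.
have := finset.set21 i j; have := finset.set22 i j.
have := finset.set21 k l; have := finset.set22 k l.
rewrite -ijkl {3 4}ijkl !finset.inE.
by move=> /orP[]/eqP ? /orP[]/eqP ? /orP[]/eqP ? /orP[]/eqP ?;
  subst; rewrite 1?rhoC // 1?rhoC.
Qed.

Definition laplacian (t : config) : 'M[R]_#|V| := \matrix_(a, b)
  let i := enum_val a in let j := enum_val b in
  if i == j then \sum_(k | adj k j) beta k j * expR (coord t k + coord t j)
  else if adj i j then - (beta i j * expR (coord t i + coord t j))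
  else 0.

Definition eps_hat (t : config) : 'M[R]_#|V| :=
  diag_mx (\row_a (eps (enum_val a) * expR (coord t (enum_val a)))).

Definition green (t : config) (x y : V) : R :=
  expR (coord t x + coord t y) *
  invmx (laplacian t + eps_hat t) (enum_rank x) (enum_rank y).

End h22.

Section ladder.
Variables (V0 : finType) (e0 : rel V0).

Definition ladder_adj : rel (int * V0) := fun x y =>
  [|| (x.1 == y.1) && e0 x.2 y.2,
      (y.1 == x.1 + 1) && (x.2 == y.2) |
      (x.1 == y.1 + 1) && (x.2 == y.2)].

(* hdist x y is the horizontal distance |x - y|. *)
Definition hdist (x y : int * V0) : nat := `|x.1 - y.1|%N.

Variables (Ll Lr : nat).

(* Index type for {-Ll, ..., Lr} x V_0, embedded in Z x V_0 by box_vertex. *)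
Definition box : finType := ('I_(Ll + Lr).+1 * V0)%type.

Definition box_vertex (x : box) : int * V0 := (x.1%:Z - Ll%:Z, x.2).

Definition box_adj : rel box :=
  fun x y => ladder_adj (box_vertex x) (box_vertex y).

Definition box_weight (R : realType) (beta : int * V0 -> int * V0 -> R)
    (x y : box) : R :=
  beta (box_vertex x) (box_vertex y).

End ladder.

(* A weight is a symmetric function of the endpoints of an edge; its values on
   pairs that are not edges of the ladder play no role. *)
Record ladder_weights (R : realType) (V0 : finType) (e0 : rel V0)
    (beta : int * V0 -> int * V0 -> R) : Prop := LadderWeights {
  ladder_weight_sym : forall x y, beta x y = beta y x;
  ladder_weight_gt0 : forall x y, ladder_adj e0 x y -> 0 < beta x y;
  ladder_weight_vertical : forall (n : int) (v w : V0), e0 v w ->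
    beta (n, v) (n, w) = beta (0, v) (0, w);
  ladder_weight_horizontal : forall (n : int) (v : V0),
    beta (n, v) (n + 1, v) = beta (0, v) (1, v) }.

(* Main.v *)
From HB Require Import structures.
Require Import Defs.
From mathcomp Require Import all_boot all_order all_fingroup all_algebra.
From mathcomp Require Import all_classical all_reals all_analysis.
From mathcomp Require Import measurable_realfun ring lra zify.

Set Implicit Arguments.
Unset Strict Implicit.
Unset Printing Implicit Defensive.

Import Order.TTheory GRing.Theory Num.Theory.
Import numFieldNormedType.Exports.

(** The proof reduces the statement to integrals over the variables t alone.
    For fixed t the s-integral is Gaussian with matrix
    D = A(t) + eps_hat(t), a grounded Laplacian, and by the matrix-tree theorem
    the sum over spanning trees is det D. The t-marginal of the measure is
    therefore exp (- sum t - U(t) - pinning) sqrt (det D) / (2 pi)^(n/2), where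
    U is the sum of the weights times cosh (t_i - t_j) - 1 over the edges, and
    the expectation of G_xy is the integral of exp (t_x + t_y) (D^-1)_xy against
    it (integral_h22, integral_green).

    Existence and positivity of the limit. Replace t by t - ln epsilon. Then
    epsilon times the integrand converges pointwise, because D^-1 becomes
    dominated by its constant mode, to
    exp (t_x + t_y) S^(-1/2) exp (- S / 2) free(t), where S is the sum of the
    pi_i exp t_i and free(t) is exp (- sum t - U(t)) times the square root of
    the weighted number of spanning trees. A dominating function which decays
    exponentially in all the t_i gives the convergence of the integrals, and
    the limit integrand is positive (green_integral_cvg).

    The constant c3. Since S >= 2 min (pi_x, pi_y) exp ((t_x + t_y) / 2), the
    limit is at most c3 / 2 times the integral of
    exp ((t_x + t_y) / 2) free(t) sqrt S exp (- S / 2). The product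
    exp ((t_x + t_y) / 2) free(t) is invariant under translations of all the t_i
    by the same number, so the last two factors may be exchanged for any other
    function with a constant integral along these translations, in particular
    for a function of t_y alone (integral_exchange, limit_le). The dependence
    on pi has now disappeared.

    Exponential decay. The densities exp (t_x) free(t) and exp (t_y) free(t),
    cut off in t_y, have mass at most 1 for all nonnegative weights: after an
    exchange they are the densities of measures pinned at one vertex, whose mass
    is computed by integrating out the vertices one by one with the star-mesh
    transformation (integral_marginal_le1, integral_pinned_le1). The geometric
    mean of the two would give the bound 1. To gain, evaluate the first density
    at t + h and the second at t - h, where h vanishes at y and grows linearly
    with slope delta along the ladder up to h_x = delta N at x, with
    N = |x - y|. The geometric mean then gains exp (h_x / 2), and loses
    exp (- k C(t)), where k = cosh delta - 1 and C is the cosh energy of the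
    horizontal edges below the slope; here free is midpoint log-convex up to the loss, since a
    determinant which is a sum over forests is log-convex in the logarithms of
    the conductances. The random loss is compensated by a second estimate: the
    factor exp (k C) can be absorbed by lowering the weights of these edges by
    the factor 1 - k, at a deterministic cost of order k N, and the density with
    the lowered weights has mass at most 1 as well (free_reduced). Altogether
    the integral is at most the exponential of half of O(delta^2 N) - delta N / 2
    (free_decay), and a small delta that depends only on G_0 and beta gives the
    decay (box_decay). *)

Local Open Scope ring_scope.

(** * Determinants of grounded Laplacians as sums over forests *)

Lemma sum_option (R : nmodType) (V : finType) (F : option V -> R) :
  \sum_o F o = F None + \sum_v F (Some v).
Proof.
rewrite (bigD1 None)//=; congr (_ + _).
by rewrite (reindex_omap Some id) => [|[]//]; apply: eq_bigl => v /=; exact: eqxx.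
Qed.

(** One step of block elimination: M is a unipotent matrix times a block
    triangular one with the Schur complement of the corner. *)
Lemma det_schur1 (F : fieldType) n (M : 'M[F]_n.+1) : M 0 0 != 0 ->
  \det M = M 0 0 * \det (\matrix_(i, j)
    (M (lift 0 i) (lift 0 j) - M (lift 0 i) 0 * M 0 (lift 0 j) / M 0 0)).
Proof.
move=> m0; set S := \matrix_(i, j) _.
pose L : 'M[F]_(1 + n) := block_mx 1%:M 0 (\col_i (M (lift 0 i) 0 / M 0 0)) 1%:M.
pose U : 'M[F]_(1 + n) := block_mx (M 0 0)%:M (\row_j M 0 (lift 0 j)) 0 S.
have ME : M = (L *m U : 'M[F]_(1 + n)).
  rewrite mulmx_block !mul1mx !mul0mx !addr0 mul_mx_scalar.
  apply/(@matrixP F (1 + n) (1 + n)) => i j.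
  case: (split_ordP i) => {}i ->; case: (split_ordP j) => {}j ->.
  - rewrite block_mxEul !mxE !ord1 /= mulr1n.
    by congr (M _ _); apply: val_inj.
  - rewrite block_mxEur !mxE !ord1; congr (M _ _); apply: val_inj => //.
  - rewrite block_mxEdl !mxE !ord1 mulrCA divff// mulr1.
    by congr (M _ _); apply: val_inj.
  - rewrite block_mxEdr !mxE big_ord_recl big_ord0 !mxE addr0.
    rewrite !rshift1 mulrAC addrC subrK.
    by congr (M _ _); apply: val_inj.
have -> : \det M = \det L * \det U by rewrite {1}ME; exact: det_mulmx.
have -> : \det L = 1 by apply: etrans (det_lblock _ _ _) _; rewrite !det1 mul1r.
have -> : \det U = \det ((M 0 0)%:M : 'M[F]_1) * \det S by exact: det_ublock.
by rewrite det_scalar1 mul1r.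
Qed.

Section forests.
Variable V : finType.
Implicit Types phi : {ffun V -> option V}.

(** The arrows v -> phi v, where None is the root, form a spanning forest
    directed to the root exactly when every orbit ends there. *)
Definition forest phi :=
  [forall v, fconnect (obind phi) (Some v) None].

Lemma fconnect_NoneP (f : V -> option V) (v : option V) :
  reflect (exists k, iter k (obind f) v = None) (fconnect (obind f) v None).
Proof.
apply: (iffP idP) => [|[k <-]]; last exact: fconnect_iter.
by move=> /iter_findex <-; eexists.
Qed.

(** In the Leibniz expansion a permutation other than the identity contributes
    only if phi follows it wherever it moves a point, which makes a cycle. If
    some orbit misses the root, the indicator of the vertices with this property
    lies in the kernel. *)
Lemma det_forest (F : fieldType) n (r : 'I_n -> V) phi : bijective r ->
  \det (\matrix_(i, j) ((r i == r j)%:R - (phi (r i) == Some (r j))%:R))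
  = (forest phi)%:R :> F.
Proof.
move=> bij_r; have [r' rK r'K] := bij_r; set M := \matrix_(i, j) _.
have [acy|] := boolP (forest phi); last first.
  move=> /forallPn[v0 nv0]; apply/eqP; rewrite -det_tr.
  apply/det0P; exists (\row_i (~~ fconnect (obind phi) (Some (r i)) None)%:R).
    apply/eqP => /rowP/(_ (r' v0)); rewrite !mxE r'K nv0.
    by move/eqP; rewrite oner_eq0.
  apply/rowP => i; rewrite !mxE; under eq_bigr do rewrite !mxE mulrBr.
  rewrite sumrB (bigD1 i)//= eqxx mulr1 big1 ?addr0; last first.
    by move=> j ji; rewrite (inj_eq (bij_inj bij_r)) eq_sym (negPf ji) mulr0.
  case phi_i : (phi (r i)) => [u|]; last first.
    rewrite big1 ?subr0 => [|j _]; last by rewrite mulr0.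
    suff -> : fconnect (obind phi) (Some (r i)) None by [].
    by apply/fconnect_NoneP; exists 1%N.
  rewrite (bigD1 (r' u))//= r'K eqxx mulr1 big1 ?addr0; last first.
    move=> j ju; rewrite -[u]r'K.
    by rewrite (inj_eq (@Some_inj _)) (inj_eq (bij_inj bij_r)) eq_sym (negPf ju) mulr0.
  suff -> : fconnect (obind phi) (Some (r i)) None =
            fconnect (obind phi) (Some u) None by rewrite subrr.
  apply/fconnect_NoneP/fconnect_NoneP => -[k].
    case: k => [|k] //; rewrite iterSr /= phi_i => <-; by exists k.
  by move=> uk; exists k.+1; rewrite iterSr /= phi_i.
have loopfree v : phi v != Some v.
  apply/eqP => phivv; have /fconnect_NoneP[k] := forallP acy v.
  suff -> : iter k (obind phi) (Some v) = Some v by [].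
  by elim: k => //= k ->.
rewrite /determinant (bigD1 1%g)//= odd_perm1 expr0 mul1r.
rewrite [X in X + _]big1 => [|i _]; last first.
  by rewrite perm1 mxE eqxx (negPf (loopfree _)) subr0.
rewrite big1 ?addr0// => s s1.
have [i si] : exists i, s i != i.
  apply/existsP; apply: contraNT s1 => /existsPn si; apply/eqP/permP => i.
  by rewrite perm1; apply/eqP; have := si i; rewrite negbK.
have [/forallP all0|/forallPn[j]] := boolP [forall k, (s k == k) || (phi (r k) == Some (r (s k)))].
  have /fconnect_NoneP[k] := forallP acy (r i).
  suff [->] : iter k (obind phi) (Some (r i)) = Some (r ((s ^+ k)%g i)) /\
    s ((s ^+ k)%g i) != (s ^+ k)%g i by [].
  elim: k => [|k [IH1 IH2]]; first by rewrite expg0 perm1.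
  rewrite iterS IH1 expgSr permM /= ; split.
    by have /orP[/eqP e|/eqP //] := all0 ((s ^+ k)%g i); rewrite e eqxx in IH2.
  by rewrite (inj_eq perm_inj).
rewrite negb_or => /andP[sj phij].
rewrite (bigD1 j)//= mxE (negPf phij) (inj_eq (bij_inj bij_r)) eq_sym (negPf sj).
by rewrite subr0 mul0r mulr0.
Qed.

Definition conductance (F : Type) (a : V -> V -> F) (e : V -> F) v (o : option V) :=
  if o is Some u then a v u else e v.

End forests.

(** The Laplacian of the graph in which a root is attached by the weights e,
    with the row and the column of the root deleted. *)
Definition lap_entry (F : nzRingType) (V : finType) (a : V -> V -> F) (e : V -> F) u v :=
  (u == v)%:R * (\sum_w a u w + e u) - a u v.

Definition lap (F : nzRingType) n a e : 'M[F]_n := \matrix_(i, j) lap_entry a e i j.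

(** Row v is the sum over o of conductance a e v o times row v of 1 - P_phi for
    any phi with phi v = o, so multilinearity in the rows reduces the claim to
    det_forest. The enumeration r allows vertices in any finite type. *)
Lemma det_lap_entry_forest (F : fieldType) (V : finType) n (r : 'I_n -> V)
    (a : V -> V -> F) (e : V -> F) : bijective r ->
  \det (\matrix_(i, j) lap_entry a e (r i) (r j)) =
  \sum_(phi : {ffun V -> option V} | forest phi) \prod_v conductance a e v (phi v).
Proof.
move=> bij_r; have [r' rK r'K] := bij_r.
pose c v (o : option V) u : F := conductance a e v o * ((v == u)%:R - (o == Some u)%:R).
have entryE u v : lap_entry a e u v = \sum_o c u o v.
  rewrite sum_option /c /= subr0; under eq_bigr do rewrite mulrBr.
  rewrite sumrB -mulr_suml addrA -mulrDl addrC mulrC [e u + _]addrC addrC.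
  congr (_ - _); rewrite (bigD1 v)//= eqxx mulr1 big1 ?addr0// => w wv.
  by rewrite (inj_eq (@Some_inj _)) (negPf wv) mulr0.
transitivity (\sum_(s : 'S_n) \sum_(phi : {ffun V -> option V})
    (\prod_v conductance a e v (phi v)) * ((-1) ^+ s *
     \prod_i ((r i == r (s i))%:R - (phi (r i) == Some (r (s i)))%:R))).
  apply: eq_bigr => s _.
  have -> : \prod_i (\matrix_(i, j) lap_entry a e (r i) (r j)) i (s i) =
      \prod_v \sum_o c v o (r (s (r' v))).
    rewrite (reindex r) /=; last exact: onW_bij.
    by apply: eq_bigr => i _; rewrite mxE entryE rK.
  rewrite bigA_distr_bigA /= mulr_sumr; apply: eq_bigr => phi _.
  rewrite mulrCA; congr (_ * _).
  rewrite /c big_split /=; congr (_ * _).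
  rewrite (reindex r) /=; last exact: onW_bij.
  by apply: eq_bigr => i _; rewrite rK.
rewrite exchange_big /= [RHS]big_mkcond /=; apply: eq_bigr => phi _.
rewrite -mulr_sumr.
transitivity (\prod_v conductance a e v (phi v) * (forest phi)%:R); last first.
  by case: forest; rewrite ?mulr1 ?mulr0.
congr (_ * _); rewrite -(@det_forest V F n r phi bij_r); apply: eq_bigr => s _; congr (_ * _).
by apply: eq_bigr => i _; rewrite mxE.
Qed.

Lemma det_lap_forest (F : fieldType) n (a : 'I_n -> 'I_n -> F) e :
  \det (lap a e) =
  \sum_(phi : {ffun 'I_n -> option 'I_n} | forest phi) \prod_i conductance a e i (phi i).
Proof. by rewrite -(@det_lap_entry_forest F 'I_n n id)//; exists id. Qed.

(** * Star-mesh transformation, cofactors and log-convexity *)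

(** Eliminating vertex 0 connects its neighbours among themselves and with the
    root; the Schur complement is again a grounded Laplacian. *)
Lemma det_lap_star_mesh (F : fieldType) n (a : 'I_n.+1 -> 'I_n.+1 -> F) e :
  let c := \sum_j a 0 (lift 0 j) + e 0 in c != 0 ->
  \det (lap a e) = c *
  \det (lap (fun i j => a (lift 0 i) (lift 0 j) + a (lift 0 i) 0 * a 0 (lift 0 j) / c)
            (fun i => e (lift 0 i) + a (lift 0 i) 0 * e 0 / c)).
Proof.
move=> c c0.
have M00 : lap a e 0 0 = c.
  by rewrite mxE /lap_entry eqxx mul1r big_ord_recl /c; ring.
rewrite det_schur1 M00//; congr (_ * \det _); apply/matrixP => i j.
rewrite !mxE /lap_entry (inj_eq lift_inj) [lift 0 i == 0]eq_sym.
rewrite !(negPf (neq_lift _ _)) big_ord_recl big_split /=.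
have -> : \sum_k a (lift 0 i) 0 * a 0 (lift 0 k) / c = a (lift 0 i) 0 * (c - e 0) / c.
  by rewrite -mulr_suml -mulr_sumr /c addrK.
by case: (_ == _); field.
Qed.

Lemma det_lap_isolated (F : fieldType) n (a : 'I_n.+1 -> 'I_n.+1 -> F) e :
  (forall j, a 0 (lift 0 j) = 0) -> e 0 = 0 -> \det (lap a e) = 0.
Proof.
move=> a0 e00; rewrite (expand_det_row _ 0) big1// => j _.
rewrite mxE /lap_entry big_ord_recl (eq_bigr (fun=> 0)) => [|i _]; last exact: a0.
rewrite big1// e00; case: (unliftP 0 j) => [k ->|->].
  by rewrite a0 (negPf (neq_lift _ _)) mul0r subrr mul0r.
by rewrite eqxx mul1r !addr0 subrr mul0r.
Qed.

Section cofactors.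
Variables (F : fieldType) (n : nat) (a : 'I_n -> 'I_n -> F).
Implicit Type e : 'I_n -> F.

Lemma lap_row_sum e i : \sum_j lap a e i j = e i.
Proof.
under eq_bigr do rewrite mxE /lap_entry.
rewrite sumrB (bigD1 i)//= eqxx mul1r [X in _ + X - _]big1 ?addr0; first by rewrite addrAC subrr add0r.
by move=> j ji; rewrite eq_sym (negPf ji) mul0r.
Qed.

(** The Laplacian maps the constant vector 1 to e. *)
Lemma det_lap_cofactor e x : \det (lap a e) = \sum_i e i * cofactor (lap a e) i x.
Proof.
have /matrixP/(_ x x) := mul_adj_mx (lap a e).
rewrite !mxE eqxx mulr1n => detE.
have -> : \det (lap a e) = \sum_j (\det (lap a e) *+ (x == j)).
  by rewrite (bigD1 x)//= eqxx mulr1n big1 ?addr0// => j; rewrite eq_sym => /negPf ->.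
transitivity (\sum_j (\adj (lap a e) *m lap a e) x j).
  by apply: eq_bigr => j _; rewrite mul_adj_mx mxE.
under eq_bigr do rewrite mxE.
rewrite exchange_big /=; apply: eq_bigr => i _.
by rewrite -mulr_sumr lap_row_sum mxE mulrC.
Qed.

Lemma cofactor_lap e e' i j : (forall k, k != i -> e k = e' k) ->
  cofactor (lap a e) i j = cofactor (lap a e') i j.
Proof.
move=> ee'; rewrite /cofactor; congr (_ * \det _); apply/matrixP => k l.
by rewrite !mxE /lap_entry ee'// eq_sym neq_lift.
Qed.

Definition point z : 'I_n -> F := fun i => (i == z)%:R.

(** The weighted number of spanning trees: grounding one vertex with weight 1
    forces exactly one arrow into the root. *)
Definition kappa z := \det (lap a (point z)).

Lemma cofactor_kappal z x : cofactor (lap a (fun=> 0)) z x = kappa z.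
Proof.
rewrite /kappa (det_lap_cofactor _ x) (bigD1 z)//= /point eqxx mul1r big1 ?addr0.
  by apply: cofactor_lap => k /negPf ->.
by move=> i /negPf ->; rewrite mul0r.
Qed.

Lemma det_lap_point z (s : F) : \det (lap a (fun i => s * point z i)) = s * kappa z.
Proof.
rewrite (det_lap_cofactor _ z) (bigD1 z)//= /point eqxx mulr1 big1 ?addr0.
  rewrite -(cofactor_kappal z z); congr (_ * _); apply: cofactor_lap => k /negPf ->.
  by rewrite mulr0.
by move=> i /negPf ->; rewrite mulr0 mul0r.
Qed.

Hypothesis a_sym : forall i j, a i j = a j i.

Lemma lap_tr e : (lap a e)^T = lap a e.
Proof.
apply/matrixP => i j; rewrite !mxE /lap_entry eq_sym a_sym.
by case: eqVneq => [->//|_]; rewrite !mul0r.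
Qed.

(** All cofactors in row z of the ungrounded Laplacian are kappa z, and symmetry
    exchanges rows and columns. *)
Lemma kappa_eq z x : kappa z = kappa x.
Proof.
by rewrite -(cofactor_kappal z x) -(cofactor_kappal x z) -{1}lap_tr cofactor_tr.
Qed.

Lemma cofactor_kappa z x y : cofactor (lap a (fun=> 0)) x y = kappa z.
Proof. by rewrite cofactor_kappal; exact: kappa_eq. Qed.

End cofactors.

(** The Leibniz sum runs over some of the terms of the expanded product of the
    row sums. *)
Lemma det_le_row_sums (R : realDomainType) n (M : 'M[R]_n) :
  `|\det M| <= \prod_i \sum_j `|M i j|.
Proof.
rewrite bigA_distr_bigA /determinant /=; apply: le_trans (ler_norm_sum _ _ _) _.
under [leLHS]eq_bigr do rewrite normrM normrX normrN1 expr1n mul1r normr_prod.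
have finfunK : {in predT, injective (fun s : 'S_n => [ffun i => s i])}.
  by move=> s _ t /ffunP st; apply/permP => i; have := st i; rewrite !ffunE.
pose im := [set [ffun i => s i] | s : 'S_n]%SET.
rewrite (bigID (mem im))/= -[leLHS]addr0 lerD//; last first.
  by apply: sumr_ge0 => f _; apply: prodr_ge0.
rewrite big_imset /=; last by move=> s t _ _; exact: finfunK.
rewrite le_eqVlt; apply/orP; left; apply/eqP; apply: eq_big => // s _.
by apply: eq_bigr => i _; rewrite ffunE.
Qed.

Lemma cofactor_le_row_sums (R : realDomainType) n (M : 'M[R]_n) x y :
  `|cofactor M x y| <= \prod_(i | i != x) \sum_j `|M i j|.
Proof.
rewrite /cofactor normrM normrX normrN1 expr1n mul1r.
apply: le_trans (det_le_row_sums _) _.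
case: n M x y => [|n] M x y; first by case: x.
have -> : \prod_(i | i != x) \sum_j `|M i j| = \prod_i \sum_j `|M (lift x i) j|.
  rewrite big_mkcond (bigD1_ord x)//= eqxx mul1r; apply: eq_bigr => i _.
  by rewrite eq_sym neq_lift.
apply: ler_prod => i _; rewrite sumr_ge0//= [leRHS](bigD1_ord y)//= ler_wpDl//.
by rewrite le_eqVlt; apply/orP; left; apply/eqP; apply: eq_bigr => j _; rewrite !mxE.
Qed.

Section forest_inequalities.
Variables (R : realFieldType) (n : nat).
Implicit Types (a : 'I_n -> 'I_n -> R) (e : 'I_n -> R).

Lemma conductance_ge0 a e i o : (forall i j, 0 <= a i j) -> (forall i, 0 <= e i) ->
  0 <= conductance a e i o.
Proof. by move=> a0 e0; case: o => /=. Qed.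

Lemma det_lap_ge0 a e : (forall i j, 0 <= a i j) -> (forall i, 0 <= e i) ->
  0 <= \det (lap a e).
Proof.
move=> a0 e0; rewrite det_lap_forest; apply: sumr_ge0 => phi _.
by apply: prodr_ge0 => i _; exact: conductance_ge0.
Qed.

(** The Cauchy-Schwarz inequality, in a form without square roots. *)
Lemma sum_geometric_mean (I : finType) (P : pred I) (A B C : I -> R) :
  (forall i, P i -> 0 <= A i) -> (forall i, P i -> 0 <= B i) ->
  (forall i, P i -> 0 <= C i) -> (forall i, P i -> A i * B i = C i ^+ 2) ->
  (\sum_(i | P i) C i) ^+ 2 <= (\sum_(i | P i) A i) * (\sum_(i | P i) B i).
Proof.
move=> A0 B0 C0 ABC; rewrite expr2 !mulr_suml.
have sym2 (G : I -> I -> R) : \sum_(i | P i) \sum_(j | P j) G i j =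
    (\sum_(i | P i) \sum_(j | P j) (G i j + G j i)) / 2.
  have E : \sum_(i | P i) \sum_(j | P j) G j i = \sum_(i | P i) \sum_(j | P j) G i j.
    by rewrite exchange_big.
  under [X in _ = X / 2]eq_bigr do rewrite big_split.
  by rewrite big_split /= E; lra.
under eq_bigr do rewrite mulr_sumr.
under [leRHS]eq_bigr do rewrite mulr_sumr.
rewrite sym2 [leRHS]sym2 ler_pM2r ?invr_gt0//.
apply: ler_sum => i Pi; apply: ler_sum => j Pj.
have := ABC i Pi; have := ABC j Pj; have := C0 i Pi; have := C0 j Pj.
have := mulr_ge0 (A0 i Pi) (B0 j Pj); have := mulr_ge0 (A0 j Pj) (B0 i Pi).
set x := A j * B i; set y := A i * B j => x0 y0 Cj Ci Ej Ei.
have xy : x * y = (C i * C j) ^+ 2.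
  by rewrite exprMn -Ei -Ej /x /y; ring.
have z0 := mulr_ge0 Ci Cj.
rewrite [C j * _]mulrC -ler_sqr ?nnegrE ?addr_ge0// sqrrD [(y + x)^+2]sqrrD.
have := sqr_ge0 (x - y); rewrite [y * x]mulrC xy sqrrB xy; nra.
Qed.

(** Every term of the forest expansion is a monomial in the conductances. *)
Lemma det_lap_log_convex a a1 a2 e e1 e2 :
  (forall i j, 0 <= a i j) -> (forall i, 0 <= e i) ->
  (forall i j, 0 <= a1 i j) -> (forall i, 0 <= e1 i) ->
  (forall i j, 0 <= a2 i j) -> (forall i, 0 <= e2 i) ->
  (forall i j, a1 i j * a2 i j = a i j ^+ 2) ->
  (forall i, e1 i * e2 i = e i ^+ 2) ->
  \det (lap a e) ^+ 2 <= \det (lap a1 e1) * \det (lap a2 e2).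
Proof.
move=> a0 e0 a10 e10 a20 e20 aE eE; rewrite !det_lap_forest.
apply: sum_geometric_mean => phi _;
  try by apply: prodr_ge0 => i _; exact: conductance_ge0.
rewrite -big_split -prodrXl /=; apply: eq_bigr => i _.
by case: (phi i) => [j|] /=.
Qed.

(** A forest has one arrow out of each vertex, so it uses each active pair at
    most once. *)
Lemma det_lap_scale a e (act : rel 'I_n) (r : R) :
  (forall i j, 0 <= a i j) -> (forall i, 0 <= e i) -> 0 < r -> r <= 1 ->
  r ^+ #|[set p : 'I_n * 'I_n | act p.1 p.2]%SET| * \det (lap a e) <=
  \det (lap (fun i j => if act i j then r * a i j else a i j) e).
Proof.
move=> a0 e0 r0 r1; rewrite !det_lap_forest mulr_sumr; apply: ler_sum => phi _.
pose b i := if phi i is Some j then act i j else false.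
have -> : \prod_i conductance (fun i j => if act i j then r * a i j else a i j) e i (phi i)
  = r ^+ (\sum_i b i) * \prod_i conductance a e i (phi i).
  rewrite -prodrXr -big_split /=; apply: eq_bigr => i _.
  rewrite /b; case: (phi i) => [j|] /=; last by rewrite expr0 mul1r.
  by case: (act i j); rewrite ?expr1 ?expr0 ?mul1r.
apply: ler_wpM2r; first by apply: prodr_ge0 => i _; exact: conductance_ge0.
rewrite ler_wiXn2l//; first exact: ltW.
rewrite -sum1dep_card [leqRHS]big_mkcond /=.
rewrite -(pair_bigA _ (fun i j => if act i j then 1 else 0)%N) /=.
apply: leq_sum => i _; rewrite /b; case: (phi i) => [j|//].
by rewrite (bigD1 j)//=; case: (act i j).
Qed.

End forest_inequalities.

(** * Positivity of grounded Laplacians *)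

Section grounded_laplacian.
Variables (R : realFieldType) (n : nat).
Variables (a : 'I_n -> 'I_n -> R) (e : 'I_n -> R).
Hypotheses (a_sym : forall i j, a i j = a j i) (a0 : forall i j, 0 <= a i j).
Hypothesis (e0 : forall i, 0 <= e i).

Lemma lap_mulE (v : 'cV[R]_n) i :
  (lap a e *m v) i 0 = \sum_j a i j * (v i 0 - v j 0) + e i * v i 0.
Proof.
rewrite mxE; under eq_bigr do rewrite mxE /lap_entry mulrBl.
rewrite sumrB (bigD1 i)//= eqxx mul1r [X in _ + X - _]big1 ?addr0; last first.
  by move=> j ji; rewrite eq_sym (negPf ji) !mul0r.
under [in RHS]eq_bigr do rewrite mulrBr.
by rewrite sumrB -mulr_suml mulrDl addrAC.
Qed.

(** Summation by parts. *)
Lemma lap_form (u v : 'cV[R]_n) :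
  \sum_i u i 0 * (lap a e *m v) i 0 =
  (\sum_i \sum_j a i j * ((u i 0 - u j 0) * (v i 0 - v j 0))) / 2 +
  \sum_i e i * (u i 0 * v i 0).
Proof.
under eq_bigr do rewrite lap_mulE mulrDr mulr_sumr.
rewrite big_split /=; congr (_ + _); last by apply: eq_bigr => i _; ring.
set S := LHS.
have SE : S = \sum_i \sum_j - (a i j * (u j 0 * (v i 0 - v j 0))).
  rewrite /S exchange_big /=; apply: eq_bigr => i _; apply: eq_bigr => j _.
  by rewrite a_sym; ring.
suff -> : \sum_i \sum_j a i j * ((u i 0 - u j 0) * (v i 0 - v j 0)) = S + S by lra.
rewrite {1}/S SE -big_split; apply: eq_bigr => i _ /=.
by rewrite -big_split; apply: eq_bigr => j _ /=; ring.
Qed.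

Definition energy (v : 'cV[R]_n) : R :=
  (\sum_i \sum_j a i j * (v i 0 - v j 0) ^+ 2) / 2 + \sum_i e i * v i 0 ^+ 2.

Hypothesis a_conn : forall i j, connect (fun i j => 0 < a i j) i j.
Variable x : 'I_n.
Hypothesis e_x : 0 < e x.

(** A function of zero energy is constant along the edges and vanishes at x. *)
Lemma energy_eq0 v : energy v <= 0 -> v = 0.
Proof.
move=> v0.
have A0 : 0 <= \sum_i \sum_j a i j * (v i 0 - v j 0) ^+ 2.
  by apply: sumr_ge0 => i _; apply: sumr_ge0 => j _; rewrite mulr_ge0 ?sqr_ge0.
have E0 : 0 <= \sum_i e i * v i 0 ^+ 2.
  by apply: sumr_ge0 => i _; rewrite mulr_ge0 ?sqr_ge0.
have /eqP : \sum_i \sum_j a i j * (v i 0 - v j 0) ^+ 2 = 0.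
  by move: v0; rewrite /energy; lra.
rewrite psumr_eq0 => [/allP Ai|i _]; last first.
  by apply: sumr_ge0 => j _; rewrite mulr_ge0 ?sqr_ge0.
have Aij i j : a i j * (v i 0 - v j 0) ^+ 2 = 0.
  have /= := Ai i (mem_index_enum _).
  rewrite psumr_eq0 => [/allP/(_ j (mem_index_enum _))/eqP//|k _].
  by rewrite mulr_ge0 ?sqr_ge0.
have /eqP : \sum_i e i * v i 0 ^+ 2 = 0 by move: v0; rewrite /energy; lra.
rewrite psumr_eq0 => [/allP/(_ x (mem_index_enum _)) /=|i _]; last first.
  by rewrite mulr_ge0 ?sqr_ge0.
rewrite mulf_eq0 (gt_eqF e_x) sqrf_eq0 /= => /eqP vx0.
apply/colP => i; rewrite mxE -vx0.
have /connectP[p + ->] := a_conn i x.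
elim: p i => //= j p IH i /andP[aij pth]; rewrite -(IH _ pth).
have /eqP := Aij i j; rewrite mulf_eq0 (gt_eqF aij) sqrf_eq0 /= subr_eq0.
by move/eqP.
Qed.

Lemma lap_posdef (v : 'cV[R]_n) : v != 0 -> 0 < \sum_i v i 0 * (lap a e *m v) i 0.
Proof.
move=> v0; rewrite lap_form.
under eq_bigr do under eq_bigr do rewrite -expr2.
under [X in _ + X]eq_bigr do rewrite -expr2.
by rewrite ltNge; apply: contra_neqN v0 => /energy_eq0.
Qed.

Lemma lap_unit : lap a e \in unitmx.
Proof.
rewrite unitmxE unitfE -det_tr; apply/negP => /eqP det0.
have /eqP/det0P[v v0 vM] := det0.
have : 0 < \sum_i v^T i 0 * (lap a e *m v^T) i 0.
  by apply: lap_posdef; rewrite trmx_eq0.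
rewrite big1 ?ltxx// => i _.
by rewrite -[lap a e]trmxK -trmx_mul vM !mxE mulr0.
Qed.

Lemma det_lap_gt0 : 0 < \det (lap a e).
Proof.
by rewrite lt_neqAle eq_sym -unitfE -unitmxE lap_unit det_lap_ge0.
Qed.

(** The minimum principle: a column g of the inverse, tested against its
    negative part u, satisfies <u, D g> >= 0 and <u, D g> <= - energy u. *)
Lemma invmx_lap_ge0 i j : 0 <= invmx (lap a e) i j.
Proof.
pose g := col j (invmx (lap a e)).
have Dg : lap a e *m g = delta_mx j 0.
  by rewrite /g colE mulmxA mulmxV ?lap_unit// mul1mx.
pose u : 'cV[R]_n := \col_i Num.max (- g i 0) 0.
suff u0 : u = 0.
  have /colP/(_ i) := u0; rewrite !mxE => /eqP.
  by rewrite maxEle; case: ifP; rewrite ?oppr_eq0 ?oppr_le0 ?mxE// => ? /eqP ->.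
apply: energy_eq0.
have ud : 0 <= \sum_i u i 0 * (lap a e *m g) i 0.
  apply: sumr_ge0 => k _; rewrite Dg !mxE mulr_ge0// ?ler0n// le_max lexx orbT//.
suff : \sum_i u i 0 * (lap a e *m g) i 0 <= - energy u by lra.
rewrite lap_form /energy opprD; apply: lerD; last first.
  rewrite -sumrN; apply: ler_sum => k _; rewrite -mulrN ler_wpM2l// mxE.
  by case: (leP (- g k 0) 0) => ?; nra.
rewrite -mulNr ler_pM2r ?invr_gt0// -sumrN; apply: ler_sum => k _.
rewrite -sumrN; apply: ler_sum => l _; rewrite -mulrN ler_wpM2l// !mxE.
by case: (leP (- invmx _ k j) 0) => ?; case: (leP (- invmx _ l j) 0) => ?; nra.
Qed.

Lemma invmx_lap_row_sum i : \sum_j invmx (lap a e) i j * e j = 1.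
Proof.
have /matrixP/(_ i 0) : invmx (lap a e) *m (lap a e *m const_mx 1) = const_mx 1 :> 'cV_n.
  by rewrite mulKmx ?lap_unit.
rewrite !mxE => <-; apply: eq_bigr => j _; congr (_ * _).
rewrite -(lap_row_sum a e j) [RHS]mxE; apply: eq_bigr => k _.
by rewrite [const_mx _ _ _]mxE mulr1.
Qed.

(** The rows of the inverse, weighted by e, are probability vectors. *)
Lemma invmx_lap_le i j : invmx (lap a e) i j * e j <= 1.
Proof.
rewrite -(invmx_lap_row_sum i) (bigD1 j)//= lerDl; apply: sumr_ge0 => k _.
by rewrite mulr_ge0// invmx_lap_ge0.
Qed.

End grounded_laplacian.

Local Open Scope classical_set_scope.
Local Open Scope ring_scope.

(** * The matrix-tree theorem *)

Section matrix_tree.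
Context {R : realType} (V : finType).
Variable adj : rel V.
Hypotheses (adj_sym : symmetric adj) (adj_irr : irreflexive adj).
Implicit Types phi : {ffun V -> option V}.

Lemma rho_adj_sym : symmetric (rho_adj adj).
Proof. by case=> [i|] [j|] //=; exact: adj_sym. Qed.

Lemma rho_adj_irr : irreflexive (rho_adj adj).
Proof. by case=> [i|] //=; exact: adj_irr. Qed.

Lemma set2_eq (W : finType) (a b c d : W) :
  [set a; b]%SET = [set c; d]%SET -> (a = c /\ b = d) \/ (a = d /\ b = c).
Proof.
move=> e; have := finset.set21 a b; have := finset.set22 a b.
have := finset.set21 c d; have := finset.set22 c d.
rewrite -e {3 4}e !finset.inE.
by move=> /orP[]/eqP ? /orP[]/eqP ? /orP[]/eqP ? /orP[]/eqP ?; subst; auto.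
Qed.

Lemma edge_relC (W : finType) (T : edge_set W) : symmetric (edge_rel T).
Proof. by move=> i j; rewrite /edge_rel finset.setUC. Qed.

Lemma edge_rel_edges (W : finType) (r : rel W) : symmetric r ->
  edge_rel (edges r) =2 r.
Proof.
move=> rC i j; apply/idP/idP => [/finset.imsetP[[k l]]|rij].
  by rewrite finset.inE /= => kl /set2_eq[[-> ->]|[-> ->]] //; rewrite rC.
by apply/finset.imsetP; exists (i, j); rewrite ?finset.inE.
Qed.

Definition tree_of phi : edge_set (option V) :=
  [set [set Some v; phi v] | v : V]%SET.

Lemma tree_ofP phi i j : reflect
  (exists v, (i = Some v /\ j = phi v) \/ (j = Some v /\ i = phi v))
  (edge_rel (tree_of phi) i j).
Proof.
apply: (iffP finset.imsetP) => [[v _ /set2_eq[[-> ->]|[-> ->]]]|].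
- by exists v; left.
- by exists v; right.
by move=> [v [[-> ->]|[-> ->]]]; exists v => //; rewrite finset.setUC.
Qed.

(** The orbit of v ends at the root, so an invariant property of v passes to
    the root. *)
Lemma forest_escape phi (P : pred (option V)) v : forest phi ->
  (forall u, P (Some u) -> P (phi u)) -> P (Some v) -> P None.
Proof.
move=> /forallP/(_ v) /iter_findex <- PS Pv.
elim: (findex _ _ _) => //= n.
by case: (iter n _ _) => //= u; exact: PS.
Qed.

Lemma forest_no2cycle phi u v : forest phi -> phi u = Some v ->
  phi v = Some u -> False.
Proof.
move=> F uv vu.
suff : (None : option V) \in [:: Some u; Some v] by [].
apply: (forest_escape (P := fun o => o \in [:: Some u; Some v]) (v := u) F).
  move=> w; rewrite !inE => /orP[]/eqP[->]; rewrite ?uv ?vu eqxx//.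
  by rewrite orbT.
by rewrite inE eqxx.
Qed.

Lemma tree_of_connect phi i j : forest phi ->
  connect (edge_rel (tree_of phi)) i j.
Proof.
move=> F.
have toN k : connect (edge_rel (tree_of phi)) k None.
  case: k => [v|]; last exact: connect0.
  move/forallP: F => /(_ v); apply: connect_sub => {}i {}j /eqP <-.
  case: i => [u|] /=; last exact: connect0.
  by apply: connect1; apply/tree_ofP; exists u; left.
apply: (connect_trans (toN i)).
by rewrite (sym_connect_sym (@edge_relC _ _)).
Qed.

(** Both neighbours on a cycle of a vertex of maximal depth would be its image. *)
Lemma tree_of_acyclic phi (c : seq (option V)) : forest phi ->
  (2 < size c)%N -> ~ ucycle (edge_rel (tree_of phi)) c.
Proof.
move=> F c2 /andP[].
pose d o := findex (obind phi) o None.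
have dS v : d (Some v) = (d (phi v)).+1.
  by apply: fconnect_findex => //; move/forallP: F; exact.
have [i ic imax] : exists2 i, i \in c & forall j, j \in c -> (d j <= d i)%N.
  case: c c2 => [//|a c' _].
  case: (@arg_maxnP _ a [pred o | o \in a :: c'] d) => [|i ic im].
    by rewrite /= inE eqxx.
  by exists i.
have up j : j \in c -> edge_rel (tree_of phi) i j -> obind phi i = j.
  move=> jc /tree_ofP[v [[-> ->]//|[jE iE]]].
  by have := imax _ jc; rewrite jE dS -iE ltnn.
case: (rot_to ic) => k s cE.
rewrite -(rot_cycle k) -(rot_uniq k) cE.
have sc : {subset s <= c}.
  by move=> j js; rewrite -(mem_rot k) cE inE js orbT.
have : (2 < size (i :: s))%N by rewrite -cE size_rot.
case: s sc {cE} => [//|a [//|b s]] sc _ /= /andP[ia].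
rewrite rcons_path => /andP[_ /andP[_ li]] /and3P[_ /negP abs _]; apply: abs.
have -> : a = last b s.
  rewrite -(up a) ?sc ?inE ?eqxx// (up (last b s))//.
    by apply: sc; rewrite inE mem_last orbT.
  by rewrite edge_relC.
exact: mem_last.
Qed.

Definition edge_forest phi := forest phi && [forall v, rho_adj adj (Some v) (phi v)].

Lemma tree_of_spanning phi : edge_forest phi -> spanning_tree (rho_adj adj) (tree_of phi).
Proof.
move=> /andP[F /forallP A]; split.
- apply/fintype.subsetP => _ /finset.imsetP[v _ ->].
  apply/finset.imsetP; exists (Some v, phi v) => //.
  by rewrite finset.inE; exact: A.
- by move=> i j; exact: tree_of_connect.
- by move=> c; exact: tree_of_acyclic.
Qed.

(** Induction on the distance to the root along phi': an edge of phi' that phi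
    uses in the opposite direction would lead to a cycle of length two. *)
Lemma tree_of_inj : {in edge_forest &, injective tree_of}.
Proof.
move=> phi phi' /andP[F _] /andP[F' _] e.
suff H n v : iter n (obind phi') (Some v) = None -> phi v = phi' v.
  apply/ffunP => v; move/forallP: (F') => /(_ v) /iter_findex; exact: H.
elim: n v => [//|n IH] v; rewrite iterSr /= => it.
have /tree_ofP[w [[[<-] ->]//|[vw [wE]]]] :
    edge_rel (tree_of phi) (Some v) (phi' v).
  by rewrite e; apply/tree_ofP; exists v; left.
move: it; rewrite vw => /IH; rewrite -wE => /esym w'.
by case: (forest_no2cycle F' vw w').
Qed.

(** Direct every vertex to a neighbour that is closer to the root. An edge of T
    outside this forest would close a cycle with the path that joins its ends in
    the forest. *)
Lemma tree_of_surj (T : edge_set (option V)) : spanning_tree (rho_adj adj) T ->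
  exists2 phi, edge_forest phi & T = tree_of phi.
Proof.
move=> [TE Tc Ta].
have Tr i j : edge_rel T i j -> rho_adj adj i j.
  move=> ij; rewrite -(edge_rel_edges rho_adj_sym).
  exact: (fintype.subsetP TE).
have reach i : exists n, `[< exists p, [/\ path (edge_rel T) i p,
    last i p = None & size p = n] >].
  by case/connectP: (Tc i None) => p pp lp; exists (size p); apply/asboolP; exists p.
pose d i := ex_minn (reach i).
have step v : exists u, edge_rel T (Some v) u && (d u < d (Some v))%N.
  rewrite /d; case: (ex_minnP (reach (Some v))) => n /asboolP[[|u p] [//= /andP[vu up] lp sp]] _.
  exists u; rewrite vu /=; case: ex_minnP => m _ /(_ (size p)).
  by rewrite -sp ltnS; apply; apply/asboolP; exists p.
pose phi := [ffun v => xchoose (step v)].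
have phiP v : edge_rel T (Some v) (phi v) && (d (phi v) < d (Some v))%N.
  by rewrite ffunE; exact: (xchooseP (step v)).
have F : forest phi.
  apply/forallP => v; apply/fconnect_NoneP.
  have [n] := ubnP (d (Some v)); elim: n v => // n IH v; rewrite ltnS => dn.
  have /andP[_ dv] := phiP v.
  case E : (phi v) => [u|]; last by exists 1%N; rewrite /= E.
  have [k it] : exists k, iter k (obind phi) (Some u) = None.
    by apply: IH; rewrite -E; exact: leq_trans dv dn.
  by exists k.+1; rewrite iterSr /= E.
exists phi.
  by rewrite /edge_forest F; apply/forallP => v; apply: Tr; case/andP: (phiP v).
have sub i j : edge_rel (tree_of phi) i j -> edge_rel T i j.
  move=> /tree_ofP[v [[-> ->]|[-> ->]]]; last rewrite edge_relC.
    by case/andP: (phiP v).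
  by case/andP: (phiP v).
apply/eqP; rewrite finset.eqEsubset; apply/andP; split; last first.
  apply/fintype.subsetP => _ /finset.imsetP[v _ ->].
  by case/andP: (phiP v).
apply/fintype.subsetP => E ET.
have /finset.imsetP[[i j] _ /= Eij] := fintype.subsetP TE _ ET.
rewrite Eij; apply: contrapT => nij.
have /connectP[p pp jl] := tree_of_connect i j F.
case: (shortenP pp) jl => q qp qu _ jl.
have ij : edge_rel T i j by rewrite /edge_rel -Eij.
apply: (Ta (i :: q)).
  case: q qp qu jl => [|a [|b q]] //= qp qu jl.
    by move: (Tr _ _ ij); rewrite jl rho_adj_irr.
  by case: nij; rewrite jl; case/andP: qp.
rewrite /ucycle /ucycleb qu andbT /= rcons_path -jl edge_relC ij andbT.
by apply: sub_path qp; exact: sub.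
Qed.

(** The map v -> {v, phi v} is injective, because a forest has no cycle of
    length two. *)
Lemma edge_prod_tree_of phi (f : option V -> option V -> R) :
    edge_forest phi -> (forall i j, f i j = f j i) ->
  edge_prod (tree_of phi) f = \prod_v f (Some v) (phi v).
Proof.
move=> /andP[F A] f_sym.
pose lo (i j : option V) : bool := (enum_rank i < enum_rank j)%N.
(* The edge of v in the order in which edge_prod visits it. *)
pose g v := if lo (Some v) (phi v) then (Some v, phi v) else (phi v, Some v).
have gE v : [set (g v).1; (g v).2]%SET = [set Some v; phi v]%SET.
  by rewrite /g; case: ifP => // _ /=; rewrite finset.setUC.
have neq v : Some v != phi v.
  apply/eqP => e; move/forallP: A => /(_ v).
  by rewrite -e rho_adj_irr.
have gL v : lo (g v).1 (g v).2.
  rewrite /g; case: ifP => //= /negbT; rewrite /lo -leqNgt leq_eqVlt => /orP[|//].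
  by move=> /eqP/val_inj/enum_rank_inj/esym/eqP; rewrite (negbTE (neq v)).
transitivity (\prod_v f (g v).1 (g v).2); last first.
  by apply: eq_bigr => v _; rewrite /g; case: ifP.
have ginj : {in [pred v : V | true] &, injective g}.
  move=> u v _ _ e.
  have /set2_eq[[[//]]|[/esym h1 h2]] : [set Some u; phi u]%SET = [set Some v; phi v]%SET.
    by rewrite -!gE e.
  by case: (forest_no2cycle F h2 h1).
rewrite -(big_imset (fun p => f p.1 p.2) ginj) /edge_prod; apply: eq_bigl => -[i j] /=.
apply/andP/finset.imsetP => [[ij /finset.imsetP[v _ e]]|[v _ e]]; last first.
  have := gL v; have := gE v; rewrite /lo -e /= => sE lij; split=> //.
  by rewrite /edge_rel sE; apply/finset.imsetP; exists v.
exists v => //; move: (gE v) (gL v); rewrite -e.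
case: (g v) => a b /= /set2_eq[[-> ->]//|[-> ->]]; rewrite /lo => ji.
by move: (ltn_trans ij ji); rewrite ltnn.
Qed.

(** Directing the edges to the root identifies spanning trees with forests of
    arrows along edges; other forests have conductance zero. *)
Lemma sum_spanning_trees (f : option V -> option V -> R) :
    (forall i j, f i j = f j i) ->
  \sum_(T : edge_set (option V) | `[< spanning_tree (rho_adj adj) T >]) edge_prod T f =
  \sum_(phi : {ffun V -> option V} | forest phi)
    \prod_v conductance (fun u v => if adj u v then f (Some u) (Some v) else 0)
      (fun v => f (Some v) None) v (phi v).
Proof.
move=> f_sym.
rewrite [RHS](bigID edge_forest) /= [X in _ = _ + X]big1 ?addr0; last first.
  move=> phi /andP[F]; rewrite negb_and F /= => /forallPn[v nv].
  by rewrite (bigD1 v)//=; case: (phi v) nv => [u|]//= /negbTE ->; rewrite mul0r.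
transitivity (\sum_(T in tree_of @: edge_forest) edge_prod T f).
  apply: eq_bigl => T; apply/asboolP/finset.imsetP => [/tree_of_surj[phi] g ->|].
    by exists phi.
  by move=> [phi g ->]; exact: tree_of_spanning.
rewrite (big_imset (fun T => edge_prod T f) tree_of_inj).
apply: eq_big => [phi|phi gphi].
  by rewrite unfold_in /edge_forest andbA andbb.
rewrite edge_prod_tree_of//; apply: eq_bigr => v _.
case/andP: gphi => _ /forallP/(_ v).
by case: (phi v) => [u|] //= ->.
Qed.

End matrix_tree.

(** * Integration over tuples of reals *)

Section lebesgue_invariance.
Context {R : realType}.
Local Notation mu := (@lebesgue_measure R).

Lemma ge0_integral_shift (f : R -> \bar R) a :
  measurable_fun setT f -> (forall x, (0 <= f x)%E) ->
  (\int[mu]_x f (x + a)%R = \int[mu]_x f x)%E.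
Proof.
move=> mf f0.
have mphi : measurable_fun setT (fun x : measurableTypeR R => (x + a : measurableTypeR R)).
  by apply: measurable_funD => //; exact: measurable_cst.
transitivity (\int[pushforward mu (fun x => x + a : measurableTypeR R)%R]_x f x)%E.
  by rewrite (ge0_integral_pushforward mphi).
apply: eq_measure_integral => A mA _; apply/esym.
pose pm : {measure set (measurableTypeR R) -> \bar R} :=
  measure_function_pushforward__canonical__measure_function_Measure mu mphi.
apply: (@lebesgue_measure_unique _ pm) => // _ [[c d]] _ <-.
rewrite /pm /= /pushforward.
rewrite (_ : _ @^-1` _ = `](c - a)%R, (d - a)%R]%classic).
  rewrite !lebesgue_measure_itv/= !lte_fin ltrD2r.
  by case: ifP => // _; rewrite -!EFinB opprB addrA subrK.
by apply/seteqP; split=> x /=; rewrite !in_itv/=; lra.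
Qed.

Lemma ge0_integral_opp (f : R -> \bar R) :
  measurable_fun setT f -> (forall x, (0 <= f x)%E) ->
  (\int[mu]_x f (- x)%R = \int[mu]_x f x)%E.
Proof.
move=> mf f0.
have mphi : measurable_fun setT (-%R : measurableTypeR R -> measurableTypeR R).
  exact: oppr_measurable.
transitivity (\int[pushforward mu (-%R : measurableTypeR R -> measurableTypeR R)]_x f x)%E.
  by rewrite (ge0_integral_pushforward mphi).
by apply: eq_measure_integral => A mA _; apply: lebesgue_measureN.
Qed.

End lebesgue_invariance.

Section lebesgue_tuple_integral.
Context {R : realType}.
Local Notation mu := (@lebesgue_measure R).
Local Notation tup n := (n.-tuple (measurableTypeR R)).
Local Notation lebT n := (@lebesgue_tuple R n).
Local Open Scope ereal_scope.

Lemma measurable_cons_pair n : measurable_fun setT (@cons_pair R n).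
Proof. by apply: measurable_cons. Qed.

Lemma integral_lebesgue_tuple_prod n (f : tup n.+1 -> \bar R) :
  measurable_fun setT f -> (forall t, 0 <= f t) ->
  \int[lebT n.+1]_t f t = \int[mu \x lebT n]_z f (cons_pair z).
Proof.
move=> mf f0.
have /= -> // := @ge0_integral_pushforward _ _ _ _ R _ (@measurable_cons_pair n)
  (mu \x lebT n) setT f measurableT mf (fun=> fun _ => f0 _).
Qed.

Lemma integral_lebesgue_tuple_head n (f : tup n.+1 -> \bar R) :
  measurable_fun setT f -> (forall t, 0 <= f t) ->
  \int[lebT n.+1]_t f t = \int[mu]_x \int[lebT n]_t f (cons_pair (x, t)).
Proof.
move=> mf f0; rewrite integral_lebesgue_tuple_prod// fubini_tonelli1//.
exact: measurableT_comp (@measurable_cons_pair n).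
Qed.

Lemma integral_lebesgue_tuple_tail n (f : tup n.+1 -> \bar R) :
  measurable_fun setT f -> (forall t, 0 <= f t) ->
  \int[lebT n.+1]_t f t = \int[lebT n]_t \int[mu]_x f (cons_pair (x, t)).
Proof.
move=> mf f0; rewrite integral_lebesgue_tuple_prod// fubini_tonelli2//.
exact: measurableT_comp (@measurable_cons_pair n).
Qed.

Lemma integral_lebesgue_tuple0 (f : tup 0 -> \bar R) :
  (forall t, 0 <= f t) -> \int[lebT 0]_t f t = f [tuple].
Proof.
move=> f0; rewrite [LHS]integral_dirac//; first by rewrite diracT mul1e.
have -> : f = cst (f [tuple]) by apply/funext => t; rewrite (tuple0 t).
exact: measurable_cst.
Qed.

Definition tshift n (h : 'I_n -> R) (t : tup n) : tup n :=
  [tuple (tnth t i + h i)%R | i < n].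

Lemma measurable_tshift n (h : 'I_n -> R) : measurable_fun setT (tshift h).
Proof.
apply/measurable_fun_tnthP => i; rewrite (_ : _ \o _ = fun t : tup n => (tnth t i + h i)%R).
  by apply: measurable_funD => //; exact: measurable_tnth.
by apply/funext => t; rewrite /= tnth_mktuple.
Qed.

Lemma tshift_cons n (h : 'I_n.+1 -> R) x (t : tup n) :
  tshift h (cons_pair (x, t)) =
  cons_pair ((x + h ord0)%R, tshift (fun i => h (lift ord0 i)) t).
Proof.
apply: eq_from_tnth => i; rewrite tnth_mktuple.
case: (unliftP ord0 i) => [j ->|->] /=; rewrite /cons_pair.
  by rewrite !tnthS tnth_mktuple.
by rewrite !tnth0.
Qed.

Lemma integral_tshift n (h : 'I_n -> R) (f : tup n -> \bar R) :
  measurable_fun setT f -> (forall t, 0 <= f t) ->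
  \int[lebT n]_t f (tshift h t) = \int[lebT n]_t f t.
Proof.
elim: n h f => [|n IH] h f mf f0.
  by rewrite !integral_lebesgue_tuple0//; congr f; apply: val_inj; rewrite !tuple0.
have mfc : measurable_fun setT (fun z => f (@cons_pair R n z)).
  exact: measurableT_comp (@measurable_cons_pair n).
have mfx x : measurable_fun setT (fun t => f (@cons_pair R n (x, t))).
  by apply: (measurableT_comp mfc); exact: pair1_measurable.
rewrite integral_lebesgue_tuple_head//; last first.
  exact: measurableT_comp (measurable_tshift h).
under eq_integral do under eq_integral do rewrite tshift_cons.
under eq_integral => x _ do
  rewrite (IH _ (fun t => f (cons_pair ((x + h ord0)%R, t))))//.
rewrite (ge0_integral_shift (h ord0)
  (f := fun x => \int[lebT n]_t f (cons_pair (x, t)))); last 2 first.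
- exact: (measurable_fun_fubini_tonelli_F (fun z => f (@cons_pair R n z))).
- by move=> x; apply: integral_ge0.
by rewrite integral_lebesgue_tuple_head.
Qed.

Lemma integral_tshiftZ n (h : 'I_n -> R) (c : R) (f : tup n -> \bar R) :
  measurable_fun setT f -> (forall t, 0 <= f t) -> (0 <= c)%R ->
  \int[lebT n]_t (c%:E * f (tshift h t)) = c%:E * \int[lebT n]_t f t.
Proof.
move=> mf f0 c0; rewrite ge0_integralZl ?lee_fin//.
  by rewrite integral_tshift.
exact: measurableT_comp (measurable_tshift h).
Qed.

Lemma integral_lebesgue_tuple_prodr n (g : R -> R) :
  measurable_fun setT g -> (forall x, 0 <= g x)%R ->
  \int[lebT n]_t (\prod_(i < n) g (tnth t i))%:E =
  \prod_(i < n) \int[mu]_x (g x)%:E.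
Proof.
move=> mg g0.
have mprod m : measurable_fun setT
    (fun t : tup m => (\prod_(i < m) g (tnth t i))%:E).
  apply/measurable_EFinP; apply: measurable_prod => i _.
  by apply: measurableT_comp => //; exact: measurable_tnth.
elim: n => [|n IH].
  rewrite integral_lebesgue_tuple0 ?big_ord0// => t.
  by rewrite lee_fin; apply: prodr_ge0 => i _.
rewrite integral_lebesgue_tuple_head//; last first.
  by move=> t; rewrite lee_fin; apply: prodr_ge0 => i _.
rewrite big_ord_recl -IH -ge0_integralZr//; last 3 first.
- exact/measurable_EFinP.
- by move=> x _; rewrite lee_fin.
- by apply: integral_ge0 => t _; rewrite lee_fin; apply: prodr_ge0 => i _.
apply: eq_integral => x _; rewrite -ge0_integralZl//; last 3 first.
- exact: mprod.
- by move=> t _; rewrite lee_fin; apply: prodr_ge0 => i _.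
- by rewrite lee_fin.
apply: eq_integral => t _; rewrite -EFinM big_ord_recl tnth0.
by under eq_bigr do rewrite tnthS.
Qed.

End lebesgue_tuple_integral.

(** * Densities, finite counting measures and iterated integrals *)

Section density.
Local Open Scope ereal_scope.
Context d (T : measurableType d) (R : realType).
Import HBNNSimple.

(** Both sides are limits of the integrals of the same simple functions. *)
Lemma ge0_integral_density (mu nu : {measure set T -> \bar R}) (g : T -> R)
    (f : T -> \bar R) :
    measurable_fun setT g -> (forall x, (0 <= g x)%R) ->
    (forall A, measurable A -> nu A = \int[mu]_(x in A) (g x)%:E) ->
    measurable_fun setT f -> (forall x, 0 <= f x) ->
  \int[nu]_x f x = \int[mu]_x (f x * (g x)%:E).
Proof.
move=> mg g0 nuE mf f0; pose f_ := nnsfun_approx measurableT mf.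
have mgE : measurable_fun setT (EFin \o g) by exact/measurable_EFinP.
transitivity (limn (fun n => \int[nu]_x (f_ n x)%:E)).
  rewrite -monotone_convergence//.
  - by apply: eq_integral => y _; apply/esym/cvg_lim => //; exact: cvg_nnsfun_approx.
  - by move=> n; exact/measurable_EFinP/measurable_funP.
  - by move=> n y _; rewrite lee_fin.
  - by move=> y _ m n mn; rewrite lee_fin; exact/lefP/nd_nnsfun_approx.
transitivity (limn (fun n => \int[mu]_x ((f_ n x)%:E * (g x)%:E))); last first.
  rewrite -monotone_convergence//.
  - apply: eq_integral => y _; apply/cvg_lim => //.
    by apply: cvgeZr => //; exact: cvg_nnsfun_approx.
  - by move=> n; apply: emeasurable_funM => //; exact/measurable_EFinP/measurable_funP.
  - by move=> n y _; rewrite mule_ge0 ?lee_fin.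
  - move=> y _ m n mn; apply: lee_wpmul2r; first by rewrite lee_fin.
    by rewrite lee_fin; exact/lefP/nd_nnsfun_approx.
congr (limn _); apply/funext => n.
have mA r : measurable (f_ n @^-1` [set r]) by [].
have posg r x : 0 <= ((r * \1_(f_ n @^-1` [set r]) x)%:E * (g x)%:E).
  by apply: mule_ge0; [exact: nnfun_muleindic_ge0|rewrite lee_fin].
transitivity (\sum_(r \in range (f_ n)) (r%:E * nu (f_ n @^-1` [set r]))).
  under eq_integral do rewrite fimfunE -fsumEFin//.
  rewrite ge0_integral_fsum//; last 2 first.
  - by move=> y; exact/measurable_EFinP/measurable_funM.
  - by move=> y x _; rewrite nnfun_muleindic_ge0.
  by apply: eq_fsbigr => r _; rewrite integralZl_indic_nnsfun// integral_indic// setIT.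
transitivity (\int[mu]_x \sum_(r \in range (f_ n))
    ((r * \1_(f_ n @^-1` [set r]) x)%:E * (g x)%:E)); last first.
  apply: eq_integral => x _; rewrite fimfunE -fsumEFin// ge0_mule_fsuml// => r.
  exact: nnfun_muleindic_ge0.
rewrite ge0_integral_fsum//; last first.
  by move=> r; apply: emeasurable_funM => //; exact/measurable_EFinP/measurable_funM.
apply: eq_fsbigr => r /[!inE] -[x0 _ rE].
rewrite nuE// -ge0_integralZl//; last 3 first.
- exact: measurable_funTS.
- by move=> x _; rewrite lee_fin.
- by rewrite lee_fin -rE.
rewrite integral_mkcond; apply: eq_integral => x _.
by rewrite patchE indicE; case: ifP => _; rewrite ?mulr1// mulr0 mul0e.
Qed.

End density.
Section finite_integral.
Context {R : realType} (W : finType).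
Local Open Scope ereal_scope.

Lemma integral_edge_set (mu : {measure set (edge_set W) -> \bar R})
    (F : edge_set W -> \bar R) : (forall T, 0 <= F T) ->
  \int[mu]_T F T = \sum_(T : edge_set W) F T * mu [set T].
Proof.
move=> F0.
transitivity (\int[mu]_T \sum_(S : edge_set W) (F S * (\1_[set S] T)%:E)).
  apply: eq_integral => T _; rewrite (bigD1 T)//= indicE mem_set// mule1.
  rewrite big1 ?adde0// => S /eqP ST; rewrite indicE memNset ?mule0//.
  by move=> /= TS; apply: ST; rewrite TS.
rewrite ge0_integral_sum//.
  apply: eq_bigr => S _; rewrite ge0_integralZl//.
  by rewrite integral_indic// setIT.
by move=> S T _; rewrite mule_ge0// lee_fin.
Qed.

Lemma integral_spanning_trees (r : rel W) (F : edge_set W -> R) :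
    (forall T, 0 <= F T)%R ->
  \int[spanning_tree_counting r]_T (F T)%:E =
  (\sum_(T : edge_set W | `[< spanning_tree r T >]) F T)%:E.
Proof.
move=> F0; rewrite integral_edge_set => [|T]; last by rewrite lee_fin.
rewrite [in RHS]big_mkcond/= -sumEFin; apply: eq_bigr => T _.
rewrite /spanning_tree_counting /mrestr.
case: ifPn => /asboolP sT.
  rewrite (_ : _ `&` _ = [set T]).
    have fT := finite_set1 T.
    by rewrite /counting asboolT// fset_set1 finmap.cardfs1 mule1.
  by apply/seteqP; split=> [S []//|S /= ->].
rewrite (_ : _ `&` _ = set0) ?measure0 ?mule0//.
by apply/seteqP; split=> [S [/= ->]|].
Qed.
End finite_integral.

Section product_sigma_finite.
Local Open Scope ereal_scope.
Context d1 d2 (T1 : measurableType d1) (T2 : measurableType d2) (R : realType).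
Variables (m1 : {sigma_finite_measure set T1 -> \bar R})
  (m2 : {sigma_finite_measure set T2 -> \bar R}).

Lemma product_measure1_sigma_finite : sigma_finite setT (m1 \x m2).
Proof.
have /sigma_finiteP[F [TF ndF mF]] := sigma_finiteT m1.
have /sigma_finiteP[G [TG ndG mG]] := sigma_finiteT m2.
exists (fun k => F k `*` G k).
  rewrite -setXTT TF TG predeqE => -[x y]; split.
    move=> [/= [k _ Fkx] [l _ Gly]]; exists (maxn k l) => //; split.
    - by move: x Fkx; exact/subsetPset/ndF/leq_maxl.
    - by move: y Gly; exact/subsetPset/ndG/leq_maxr.
  by move=> [k _ []/= ? ?]; split; exists k.
move=> k; have [? ?] := mF k; have [? ?] := mG k.
split; first exact: measurableX.
by rewrite product_measure1E// lte_mul_pinfty// ge0_fin_numE.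
Qed.

(** The product measure under a name of its own, which carries its structure of
    sigma-finite measure for the next application of Tonelli's theorem. *)
Definition sigma_product : set (T1 * T2) -> \bar R := m1 \x m2.

HB.instance Definition _ := Measure.on sigma_product.

HB.instance Definition _ := Measure_isSigmaFinite.Build _ _ _ sigma_product
  product_measure1_sigma_finite.

Context d3 (T3 : measurableType d3) (m3 : {sigma_finite_measure set T3 -> \bar R}).

Lemma integral_product3 (G : T1 * T2 * T3 -> \bar R) :
  measurable_fun setT G -> (forall z, 0 <= G z) ->
  \int[(m1 \x m2) \x m3]_z G z = \int[m1]_x \int[m2]_y \int[m3]_z G (x, y, z).
Proof.
move=> mG G0; transitivity (\int[sigma_product \x m3]_z G z).
  by apply: eq_measure_integral => A _ _.
rewrite (fubini_tonelli1 G mG G0).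
transitivity (\int[m1 \x m2]_z fubini_F m3 G z).
  by apply: eq_measure_integral => A _ _.
rewrite fubini_tonelli1//.
- exact: measurable_fun_fubini_tonelli_F.
- by move=> z; apply: integral_ge0.
Qed.

End product_sigma_finite.

(** * One-dimensional integrals *)

Section arsinh.
Context {R : realType}.
Implicit Types x y : R.

Definition arsinh y : R := ln (y + Num.sqrt (1 + y ^+ 2)).

Lemma hypot_gt0 y : 0 < 1 + y ^+ 2.
Proof. by rewrite ltr_wpDr ?sqr_ge0. Qed.

Lemma arsinh_arg_gt0 y : 0 < y + Num.sqrt (1 + y ^+ 2).
Proof.
have : `|y| < Num.sqrt (1 + y ^+ 2) by rewrite -sqrtr_sqr ltr_sqrt ?hypot_gt0// ltrDr.
have := ler_norm (- y); rewrite normrN; lra.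
Qed.

Lemma expR_arsinh y : expR (arsinh y) = y + Num.sqrt (1 + y ^+ 2).
Proof. by rewrite lnK// posrE arsinh_arg_gt0. Qed.

Lemma expRN_arsinh y : expR (- arsinh y) = Num.sqrt (1 + y ^+ 2) - y.
Proof.
rewrite expRN expR_arsinh; have := arsinh_arg_gt0 y => p0.
have := sqr_sqrtr (ltW (hypot_gt0 y)); set s := Num.sqrt _ in p0 *.
by move=> s2; apply: (mulIf (lt0r_neq0 p0)); rewrite mulVf ?gt_eqF//; nra.
Qed.

Lemma is_derive_arsinh y : is_derive y 1 arsinh (Num.sqrt (1 + y ^+ 2))^-1.
Proof.
have s0 : 0 < Num.sqrt (1 + y ^+ 2) by rewrite sqrtr_gt0 hypot_gt0.
have d1 : is_derive y 1 (fun y => 1 + y ^+ 2 : R) (2 * y).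
  by apply: is_derive_eq; rewrite add0r /GRing.scale /= mulr1 mul1r mulr_natl mulr2n.
have d2 : is_derive y 1 (fun y => Num.sqrt (1 + y ^+ 2)) (y / Num.sqrt (1 + y ^+ 2)).
  have d := @is_derive1_comp R Num.sqrt (fun y => 1 + y ^+ 2) y _ _
    (is_derive1_sqrt (hypot_gt0 y)) d1.
  apply: (is_derive_eq d).
  by rewrite invfM; field; rewrite gt_eqF.
have d3 : is_derive y 1 (fun y => y + Num.sqrt (1 + y ^+ 2)) (1 + y / Num.sqrt (1 + y ^+ 2)).
  exact: is_deriveD.
have d := @is_derive1_comp R (@ln R) (fun y => y + Num.sqrt (1 + y ^+ 2)) y _ _
  (is_derive1_ln (arsinh_arg_gt0 y)) d3.
apply: (is_derive_eq d).
by field; rewrite gt_eqF//= gt_eqF// arsinh_arg_gt0.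
Qed.

Lemma arsinhN y : arsinh (- y) = - arsinh y.
Proof. by apply: expR_inj; rewrite expRN_arsinh expR_arsinh sqrrN addrC. Qed.

Lemma arsinh_lt : {homo arsinh : x y / x < y}.
Proof.
move=> x y; apply: contraTT; rewrite -!leNgt => h.
have : expR (arsinh y) <= expR (arsinh x) by rewrite ler_expR.
have : expR (- arsinh x) <= expR (- arsinh y) by rewrite ler_expR lerN2.
rewrite !expRN_arsinh !expR_arsinh; lra.
Qed.

Lemma hypot_ge y : y <= Num.sqrt (1 + y ^+ 2).
Proof.
rewrite (le_trans (ler_norm y))// -sqrtr_sqr//.
by apply: ler_wsqrtr; rewrite lerDr.
Qed.

Lemma cvgy_arsinh : arsinh y @[y --> +oo%R] --> +oo%R.
Proof.
apply/cvgryPge => A; near=> y.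
rewrite -ler_expR expR_arsinh.
have : expR A <= y by near: y; apply: nbhs_pinfty_ge; rewrite num_real.
by have := sqrtr_ge0 (1 + y ^+ 2); lra.
Unshelve. all: by end_near. Qed.

Lemma cvgNy_arsinh : arsinh y @[y --> -oo%R] --> -oo%R.
Proof.
apply/cvgNy_compNP; rewrite (_ : _ \o _ = fun y => - arsinh y).
  by apply/cvgNrNy; exact: cvgy_arsinh.
by apply/funext => y; rewrite /= arsinhN.
Qed.

Lemma cvgy_hypotV : (Num.sqrt (1 + y ^+ 2))^-1 @[y --> +oo%R] --> (0 : R).
Proof.
apply/gtr0_cvgV0; first by near=> y; rewrite sqrtr_gt0 hypot_gt0.
apply/cvgryPge => A; near=> y; apply: le_trans (hypot_ge y).
by near: y; apply: nbhs_pinfty_ge; rewrite num_real.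
Unshelve. all: by end_near. Qed.

Lemma cvgNy_hypotV : (Num.sqrt (1 + y ^+ 2))^-1 @[y --> -oo%R] --> (0 : R).
Proof.
apply/cvgNy_compNP; rewrite (_ : _ \o _ = fun y => (Num.sqrt (1 + y ^+ 2))^-1).
  exact: cvgy_hypotV.
by apply/funext => y; rewrite /= sqrrN.
Qed.

Lemma continuous_hypotV : continuous (fun y : R => (Num.sqrt (1 + y ^+ 2))^-1).
Proof.
move=> y; apply: cvgV; first by rewrite gt_eqF// sqrtr_gt0 hypot_gt0.
apply: (continuous_comp (f := fun y => 1 + y ^+ 2)); last exact: sqrt_continuous.
apply: (@cvgD _ R^o); first exact: cvg_cst.
exact: exprn_continuous.
Qed.

(** With x = 2 arsinh y one has cosh x - 1 = 2 y ^ 2, which makes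
    exp (- m (cosh x - 1)) Gaussian in y. *)
Lemma integral_double_arsinh (G : R -> R) : continuous G -> (forall x, 0 <= G x) ->
  (\int[lebesgue_measure]_x (G x)%:E =
   \int[lebesgue_measure]_y (G (2 * arsinh y) * (2 / Num.sqrt (1 + y ^+ 2)))%:E)%E.
Proof.
move=> cG G0; pose F y := 2 * arsinh y.
have dF y : is_derive y 1 F (2 / Num.sqrt (1 + y ^+ 2)).
  by have d := is_derive_arsinh y; apply: is_derive_eq.
have F'E : F^`()%classic = fun y => 2 / Num.sqrt (1 + y ^+ 2).
  by apply/funext => y; rewrite derive1E; have [_ ->] := dF y.
rewrite (@increasing_ge0_integration_by_substitutionT _ F)//.
- by apply: eq_integral => y _; rewrite F'E.
- by move=> x y xy; rewrite /F ltr_pM2l// arsinh_lt.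
- by rewrite F'E => y; apply: cvgMr; exact: continuous_hypotV.
- by rewrite F'E; apply/cvg_ex; exists (2 * 0); apply: cvgMr; exact: cvgNy_hypotV.
- by rewrite F'E; apply/cvg_ex; exists (2 * 0); apply: cvgMr; exact: cvgy_hypotV.
- by apply/gt0_cvgMrNy => //; exact: cvgNy_arsinh.
- by apply/gt0_cvgMry => //; exact: cvgy_arsinh.
Qed.

End arsinh.

Section continuous_real_functions.
Context {R : realType}.
Implicit Types f g : R -> R.

(** An alias of continuous that gives the tactic below a head symbol to match. *)
Definition cts f := continuous f.

Lemma cts_cst (c : R) : cts (fun _ : R => c).
Proof. by move=> x; exact: cvg_cst. Qed.

Lemma cts_id : cts (fun x : R => x).
Proof. by move=> x; exact: cvg_id. Qed.

Lemma cts_expR f : cts f -> cts (fun x => expR (f x)).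
Proof. by move=> cf x; apply: continuous_comp; [exact: cf|exact: continuous_expR]. Qed.

Lemma cts_add f g : cts f -> cts g -> cts (fun x => f x + g x).
Proof. by move=> cf cg x; apply: (@cvgD _ R^o); [exact: cf|exact: cg]. Qed.

Lemma cts_mul f g : cts f -> cts g -> cts (fun x => f x * g x).
Proof. by move=> cf cg x; apply: cvgM; [exact: cf|exact: cg]. Qed.

Lemma cts_opp f : cts f -> cts (fun x => - f x).
Proof. by move=> cf x; apply: (@cvgN _ R^o); exact: cf. Qed.

Lemma cts_sqr f : cts f -> cts (fun x => f x ^+ 2).
Proof. by move=> cf; apply: cts_mul. Qed.

End continuous_real_functions.

Ltac cts_step := lazymatch goal with
  | |- cts (fun x => x) => exact: cts_id
  | |- cts (@expR _) => exact: (cts_expR cts_id)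
  | |- cts -%R => exact: (cts_opp cts_id)
  | |- cts (fun x => expR _) => apply: cts_expR
  | |- cts (fun x => _ + _) => apply: cts_add
  | |- cts (fun x => - _) => apply: cts_opp
  | |- cts (fun x => _ ^+ 2) => apply: cts_sqr
  | |- cts (fun x => _ * _) => apply: cts_mul
  | |- cts _ => exact: cts_cst
  end.
Ltac continuity := repeat cts_step.

Section one_dimensional.
Context {R : realType}.
Local Notation mu := (@lebesgue_measure R).

Lemma integral_gauss1 (c m : R) : 0 < c ->
  (\int[mu]_x (expR (- (c * (x - m) ^+ 2 / 2)))%:E = (Num.sqrt (2 * pi) / Num.sqrt c)%:E)%E.
Proof.
move=> c0; pose s := (Num.sqrt c)^-1.
have s0 : 0 < s by rewrite invr_gt0 sqrtr_gt0.
have ss : s ^+ 2 = c^-1 by rewrite exprVn sqr_sqrtr// ltW.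
have peakE : normal_peak s = Num.sqrt c / Num.sqrt (2 * pi).
  rewrite /normal_peak -mulr_natl ss mulrCA sqrtrM ?invr_ge0 ?ltW//.
  by rewrite invfM sqrtrV ?invrK// ltW.
have := @integral_normal_pdf R m s.
rewrite normal_pdfE ?gt_eqF//.
under eq_integral do rewrite EFinM.
rewrite ge0_integralZl//; last 3 first.
- by apply/measurable_EFinP; exact: measurable_normal_fun.
- by move=> x _; rewrite lee_fin normal_fun_ge0.
- by rewrite lee_fin normal_peak_ge0.
have -> : (\int[mu]_x (normal_fun m s x)%:E =
    \int[mu]_x (expR (- (c * (x - m) ^+ 2 / 2)))%:E)%E.
  apply: eq_integral => x _; rewrite /normal_fun; congr (expR _)%:E.
  by rewrite ss -mulr_natl invfM invrK; lra.
set I := (\int[mu]_x _)%E => I1.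
have p0 : 0 < normal_peak s by rewrite normal_peak_gt0// gt_eqF.
have -> : I = ((normal_peak s)^-1%:E * ((normal_peak s)%:E * I))%E.
  by rewrite muleA -EFinM mulVf ?mul1e// gt_eqF.
by rewrite I1 mule1 peakE invf_div.
Qed.

(** The density of u when exp u follows the reciprocal inverse Gaussian law with
    parameter m. *)
Definition site_density (m u : R) : R :=
  expR (u / 2 + m - (expR u + m ^+ 2 * expR (- u)) / 2) / Num.sqrt (2 * pi).

Lemma site_density_ge0 m u : 0 <= site_density m u.
Proof. by rewrite divr_ge0 ?expR_ge0 ?sqrtr_ge0. Qed.

Lemma continuous_site_density m : continuous (site_density m).
Proof.
rewrite -/(cts _) /site_density; continuity.
Qed.

Lemma sqrt2pi_gt0 : 0 < Num.sqrt (2 * pi) :> R.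
Proof. by rewrite sqrtr_gt0 mulr_gt0// pi_gt0. Qed.

(** After centring at ln m the density is exp (x / 2) times an even function.
    Symmetrization turns exp (x / 2) into cosh (x / 2), the factor which the
    substitution x = 2 arsinh y removes; a Gaussian integral is left. *)
Lemma integral_site_density m : 0 < m -> (\int[mu]_u (site_density m u)%:E = 1)%E.
Proof.
move=> m0; pose b := ln m / 2.
have mb : m = expR (2 * b) by rewrite /b mulrC divfK// lnK.
have meas h : cts h -> measurable_fun setT (EFin \o h : R -> \bar R).
  by move=> ch; apply/measurable_EFinP; exact: continuous_measurable_fun.
pose G x : R := expR (- (m * ((expR x + expR (- x)) / 2 - 1))).
pose K x := expR (x / 2) * G x.
have cG : cts G by rewrite /G; continuity.
have cK : cts K by rewrite /K /G; continuity.
have G0 x : 0 <= G x by exact: expR_ge0.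
have K0 x : 0 <= K x by rewrite mulr_ge0// expR_ge0.
have GN x : G (- x) = G x by rewrite /G opprK [expR (- x) + _]addrC.
pose C x := (expR (x / 2) + expR (- x / 2)) * G x.
have cC : cts C by rewrite /C /G; continuity.
have CE : (\int[mu]_x (C x)%:E = (2 * Num.sqrt (2 * pi) * expR (- b))%:E)%E.
  rewrite integral_double_arsinh//; last first.
    by move=> x; rewrite mulr_ge0// addr_ge0// expR_ge0.
  transitivity (\int[mu]_y (4%:E * (expR (- (4 * m * (y - 0) ^+ 2 / 2)))%:E))%E.
    apply: eq_integral => y _; rewrite -EFinM; congr EFin; rewrite /C.
    have s0 : 0 < Num.sqrt (1 + y ^+ 2) by rewrite sqrtr_gt0 hypot_gt0.
    have ss := sqr_sqrtr (ltW (hypot_gt0 y)).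
    have -> : 2 * arsinh y / 2 = arsinh y by rewrite mulrC mulKf.
    have -> : - (2 * arsinh y) / 2 = - arsinh y by rewrite mulNr mulrC mulKf.
    rewrite expR_arsinh expRN_arsinh /G.
    have e2 (z : R) : expR (2 * z) = expR z ^+ 2 by rewrite mulr_natl mulr2n expRD expr2.
    rewrite -[- (2 * arsinh y)]mulrN !e2 expR_arsinh expRN_arsinh.
    set s := Num.sqrt _ in s0 ss *.
    have -> : ((y + s) ^+ 2 + (s - y) ^+ 2) / 2 - 1 = 2 * y ^+ 2.
      by rewrite !sqrrD ss; lra.
    rewrite (_ : - (m * _) = - (4 * m * (y - 0) ^+ 2 / 2)); last by rewrite subr0; lra.
    by field; rewrite gt_eqF.
  rewrite ge0_integralZl//; last first.
    by apply: (meas (fun y => expR (- (4 * m * (y - 0) ^+ 2 / 2)))); continuity.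
  rewrite integral_gauss1 ?mulr_gt0// -EFinM; congr EFin.
  have -> : Num.sqrt (4 * m) = 2 * expR b.
    rewrite (_ : 4 * m = (2 * expR b) ^+ 2); first by rewrite sqrtr_sqr ger0_norm// mulr_ge0 ?expR_ge0.
    by rewrite exprMn mb [2 * b]mulr_natl mulr2n expRD -expr2; lra.
  by rewrite expRN; field; rewrite gt_eqF// expR_gt0.
have KE : (\int[mu]_x (K x)%:E = (Num.sqrt (2 * pi) * expR (- b))%:E)%E.
  have : (\int[mu]_x (K x)%:E + \int[mu]_x (K x)%:E = \int[mu]_x (C x)%:E)%E.
    rewrite -{2}(ge0_integral_opp (f := fun x => (K x)%:E)); last 2 first.
    - exact: (meas K cK).
    - by move=> x; rewrite lee_fin.
    rewrite -ge0_integralD//; last 4 first.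
    - by move=> x _; rewrite lee_fin.
    - exact: (meas K cK).
    - by move=> x _; rewrite lee_fin.
    - by apply: (meas (fun x => K (- x))); rewrite /K /G; continuity.
    by apply: eq_integral => x _; rewrite -EFinD /K GN -mulrDl.
  rewrite CE; set I := (\int[mu]_x _)%E => I2.
  have I0 : (0 <= I)%E by apply: integral_ge0 => x _; rewrite lee_fin.
  move: I I0 I2 => [r| |] //= _; rewrite -EFinD => -[] r2.
  by congr EFin; lra.
rewrite -(ge0_integral_shift (2 * b) (f := fun x => (site_density m x)%:E)); last 2 first.
- exact: (meas (site_density m) (@continuous_site_density m)).
- by move=> x; rewrite lee_fin site_density_ge0.
transitivity (\int[mu]_x ((expR b / Num.sqrt (2 * pi))%:E * (K x)%:E))%E.
  apply: eq_integral => x _; rewrite -EFinM; congr EFin.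
  rewrite /site_density /K /G [RHS]mulrAC; congr (_ / _).
  rewrite -!expRD; congr expR.
  rewrite expRD opprD expRD (_ : expR (2 * b) = m)// (_ : m ^+ 2 * _ = m * expR (- x)).
    by lra.
  by rewrite (expRN (2 * b)) -mb; field; rewrite gt_eqF.
rewrite ge0_integralZl//; last 2 first.
- exact: (meas K cK).
- by move=> x _; rewrite lee_fin.
rewrite KE -EFinM; congr EFin; rewrite expRN.
by field; rewrite !gt_eqF ?expR_gt0 ?sqrt2pi_gt0.
Qed.

Lemma integral_expR_abs (c : R) : 0 < c ->
  (\int[mu]_x (expR (- (c * `|x|)))%:E <= (2 / c)%:E)%E.
Proof.
move=> c0; pose p : R -> R := exponential_pdf c.
have mp : measurable_fun setT (fun x : R => (p x)%:E).
  by apply/measurable_EFinP; exact: measurable_exponential_pdf.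
have mpN : measurable_fun setT (fun x : R => (p (- x))%:E).
  by apply: (measurableT_comp mp); exact: oppr_measurable.
have p0 x : 0 <= p x by apply: exponential_pdf_ge0; exact: ltW.
have mpp : measurable_fun setT (fun x : R => ((p x)%:E + (p (- x))%:E)%E).
  exact: emeasurable_funD.
apply: (@le_trans _ _ (\int[mu]_x ((c^-1)%:E * ((p x)%:E + (p (- x))%:E)))%E).
  apply: ge0_le_integral => //.
  - apply/measurable_EFinP; apply: measurableT_comp => //.
    by apply: measurableT_comp => //; apply: measurable_funM => //; exact: measurableT_comp.
  - by apply: emeasurable_funM => //; exact: measurable_cst.
  move=> x _; rewrite -EFinD -EFinM lee_fin [leRHS]mulrC ler_pdivlMr//.
  have [x0|x0] := leP 0 x.
    rewrite ger0_norm// /p (exponential_pdfE _ x0) [leLHS]mulrC -mulNr.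
    by rewrite lerDl p0.
  have -> : p (- x) = c * expR (- c * - x) by rewrite /p exponential_pdfE// oppr_ge0 ltW.
  by rewrite ltr0_norm// [leLHS]mulrC -mulNr lerDr p0.
rewrite ge0_integralZl//; last 2 first.
- by move=> x _; rewrite -EFinD lee_fin addr_ge0.
- by rewrite lee_fin invr_ge0 ltW.
rewrite ge0_integralD//; last 2 first.
- by move=> x _; rewrite lee_fin.
- by move=> x _; rewrite lee_fin.
rewrite (ge0_integral_opp (f := fun x => (p x)%:E))//.
by rewrite integral_exponential_pdf// -EFinD -EFinM lee_fin; lra.
Qed.

End one_dimensional.

(** * Measurability and Gaussian integrals *)

Section measurability.
Context {R : realType} d (T : measurableType d).
Implicit Types f g : T -> R.

Lemma measurable_expR_comp f :
  measurable_fun setT f -> measurable_fun setT (fun x => expR (f x)).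
Proof. by move=> mf; apply: measurableT_comp. Qed.

Lemma measurable_sqrt_comp f :
  measurable_fun setT f -> measurable_fun setT (fun x => Num.sqrt (f x)).
Proof.
move=> mf; apply: (measurableT_comp (f := @Num.sqrt R)) => //.
apply: continuous_measurable_fun; exact: sqrt_continuous.
Qed.

Lemma measurable_oppr_comp f :
  measurable_fun setT f -> measurable_fun setT (fun x => - f x).
Proof. exact: measurable_funN. Qed.

Lemma measurable_normr_comp f :
  measurable_fun setT f -> measurable_fun setT (fun x => `|f x|).
Proof. by apply: measurableT_comp; exact: normr_measurable. Qed.

Lemma measurable_inv_comp f :
  measurable_fun setT f -> measurable_fun setT (fun x => (f x)^-1).
Proof.
move=> mf; apply: (eq_measurable_fun (fun x => f x * (f x ^+ 2) `^ (-1))).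
  move=> x _ /=; rewrite powR_inv1 ?sqr_ge0//.
  have [->|f0] := eqVneq (f x) 0; first by rewrite mul0r invr0.
  by field.
apply: measurable_funM => //; apply: (measurableT_comp (f := fun x => x `^ (-1))).
  exact: measurable_powR.
exact: measurable_funX.
Qed.

Lemma measurable_det n (M : T -> 'M[R]_n) :
  (forall i j, measurable_fun setT (fun x => M x i j)) ->
  measurable_fun setT (fun x => \det (M x)).
Proof.
move=> mM; rewrite /determinant; apply: measurable_sum => s.
apply: measurable_funM; first exact: measurable_cst.
by apply: measurable_prod => i _.
Qed.

Lemma measurable_cosh_comp f :
  measurable_fun setT f -> measurable_fun setT (fun x => cosh (f x)).
Proof.
move=> mf; apply: measurable_funM; last exact: measurable_cst.
apply: measurable_funD; first exact: measurable_expR_comp.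
exact/measurable_expR_comp/measurable_oppr_comp.
Qed.

End measurability.

Ltac meas_step := match goal with
  | |- measurable_fun _ (fun x => tnth x _) => exact: measurable_tnth
  | |- measurable_fun _ (fun x => expR _) => apply: measurable_expR_comp
  | |- measurable_fun _ (@cosh _) => apply: (measurable_cosh_comp (f := fun x => x)); exact: measurable_id
  | |- measurable_fun _ (@expR _) => apply: (measurable_expR_comp (f := fun x => x)); exact: measurable_id
  | |- measurable_fun _ -%R => apply: (measurable_oppr_comp (f := fun x => x)); exact: measurable_id
  | |- measurable_fun _ (fun x => cosh _) => apply: measurable_cosh_comp
  | |- measurable_fun _ (fun x => Num.sqrt _) => apply: measurable_sqrt_comp
  | |- measurable_fun _ (fun x => \det _) => apply: measurable_det => ? ?
  | |- measurable_fun _ (fun x => bigop _ _ (fun j => BigBody _ +%R _ _)) =>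
      apply: measurable_sum => ?
  | |- measurable_fun _ (fun x => _ + _) => apply: measurable_funD
  | |- measurable_fun _ (fun x => - _) => apply: measurable_oppr_comp
  | |- measurable_fun _ (fun x => _ ^+ _) => apply: measurable_funX
  | |- measurable_fun _ (fun x => _ * _) => apply: measurable_funM
  | |- measurable_fun _ (fun x => `|_|) => apply: measurable_normr_comp
  | |- measurable_fun _ (fun x => x) => exact: measurable_id
  | |- measurable_fun _ (fun _ => ?c) => exact: measurable_cst
  end.
(** Descends through the structure of the integrand and leaves its atoms as
    goals. *)
Ltac meas := repeat meas_step.

Section gaussian.
Context {R : realType}.
Local Notation tup n := (n.-tuple (measurableTypeR R)).
Local Notation lebT n := (@lebesgue_tuple R n).

Definition qform n (M : 'M[R]_n) (v : 'I_n -> R) : R :=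
  \sum_i v i * \sum_j M i j * v j.

Definition schur1 n (M : 'M[R]_n.+1) : 'M[R]_n :=
  \matrix_(i, j) (M (lift 0 i) (lift 0 j) - M (lift 0 i) 0 * M 0 (lift 0 j) / M 0 0).

Lemma qform_schur1 n (M : 'M[R]_n.+1) (v : 'I_n.+1 -> R) :
  M^T = M -> M 0 0 != 0 ->
  qform M v = M 0 0 * (v 0 - - ((\sum_j M 0 (lift 0 j) * v (lift 0 j)) / M 0 0)) ^+ 2 +
    qform (schur1 M) (fun i => v (lift 0 i)).
Proof.
move=> symM m0; set r := \sum_j M 0 (lift 0 j) * v (lift 0 j).
have rE : \sum_i v (lift 0 i) * M (lift 0 i) 0 = r.
  by apply: eq_bigr => i _; rewrite -[in LHS]symM mxE mulrC.
pose Q := \sum_i v (lift 0 i) * \sum_j M (lift 0 i) (lift 0 j) * v (lift 0 j).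
have -> : qform (schur1 M) (fun i => v (lift 0 i)) = Q - r * r / M 0 0.
  rewrite -{1}rE /Q mulr_suml mulr_suml -sumrB; apply: eq_bigr => i _.
  rewrite -!mulrA -mulrBr; congr (_ * _).
  rewrite /r mulr_suml mulr_sumr -sumrB; apply: eq_bigr => j _.
  by rewrite mxE; ring.
rewrite /qform big_ord_recl big_ord_recl -/r.
under eq_bigr do rewrite big_ord_recl mulrDr mulrA.
rewrite big_split /= -mulr_suml rE -/Q.
by field.
Qed.

(** Completing the square in the first coordinate splits off a one-dimensional
    Gaussian and leaves the Schur complement of M in the others. *)
Lemma integral_gaussian n (M : 'M[R]_n) : M^T = M ->
  (forall v, (exists i, v i != 0) -> 0 < qform M v) ->
  (\int[lebT n]_s (expR (- (qform M (tnth s) / 2)))%:E =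
   (Num.sqrt (2 * pi) ^+ n / Num.sqrt (\det M))%:E)%E.
Proof.
elim: n M => [|n IH] M symM posM.
  rewrite integral_lebesgue_tuple0; last by move=> t; rewrite lee_fin expR_ge0.
  by rewrite /qform big_ord0 mul0r oppr0 expR0 det_mx00 sqrtr1 expr0 divr1.
have m0 : 0 < M 0 0.
  have := posM (fun i => (i == 0)%:R); rewrite /qform.
  rewrite big_ord_recl big_ord_recl /= mul1r mulr1 big1 ?addr0; last first.
    by move=> i _; rewrite mulr0.
  rewrite big1 ?addr0; last by move=> i _; rewrite mul0r.
  by apply; exists 0; rewrite eqxx oner_neq0.
have symS : (schur1 M)^T = schur1 M.
  apply/matrixP => i j; rewrite !mxE.
  have E a b : M a b = M b a by rewrite -[in LHS]symM mxE.
  by rewrite (E (lift 0 j) (lift 0 i)) (E (lift 0 j) 0) (E 0 (lift 0 i)); ring.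
have posS v : (exists i, v i != 0) -> 0 < qform (schur1 M) v.
  move=> [i vi].
  pose u (k : 'I_n.+1) := if unlift 0 k is Some j then v j
    else - ((\sum_j M 0 (lift 0 j) * v j) / M 0 0).
  have := posM u; rewrite qform_schur1 ?gt_eqF//.
  have uE k : u (lift 0 k) = v k by rewrite /u liftK.
  under eq_bigr do rewrite uE.
  have -> : u 0 = - ((\sum_j M 0 (lift 0 j) * v j) / M 0 0) by rewrite /u unlift_none.
  rewrite subrr expr0n mulr0 add0r.
  rewrite (_ : qform _ (fun _ => u _) = qform (schur1 M) v); last first.
    by apply: eq_bigr => k _; rewrite uE; congr (_ * _); apply: eq_bigr => l _; rewrite uE.
  by apply; exists (lift 0 i); rewrite uE.
have mq m (N : 'M[R]_m) : measurable_fun setT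
    (fun s : tup m => (expR (- (qform N (tnth s) / 2)))%:E).
  by apply/measurable_EFinP; rewrite /qform; meas.
rewrite integral_lebesgue_tuple_tail//.
pose r (s : tup n) := \sum_j M 0 (lift 0 j) * tnth s j.
transitivity (\int[lebT n]_s ((Num.sqrt (2 * pi) / Num.sqrt (M 0 0))%:E *
    (expR (- (qform (schur1 M) (tnth s) / 2)))%:E))%E.
  apply: eq_integral => s _.
  rewrite -(integral_gauss1 (- (r s / M 0 0)) m0).
  rewrite -ge0_integralZr//; last by apply/measurable_EFinP; meas.
  apply: eq_integral => x _; rewrite -EFinM -expRD; congr (expR _)%:E.
  rewrite qform_schur1 ?gt_eqF// tnth0.
  under eq_bigr do rewrite tnthS.
  rewrite -/(r s) (_ : qform _ (fun _ => tnth _ _) = qform (schur1 M) (tnth s)); last first.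
    by apply: eq_bigr => k _; rewrite tnthS; congr (_ * _); apply: eq_bigr => l _; rewrite tnthS.
  by rewrite /=; lra.
rewrite ge0_integralZl//; last exact: mq.
rewrite IH// -EFinM; congr EFin; rewrite (det_schur1 (lt0r_neq0 m0)) (sqrtrM _ (ltW m0)).
by rewrite [LHS]mulrACA -exprS -invfM.
Qed.

End gaussian.

(** * The t-marginal and its mass *)

Section marginal.
Context {R : realType}.
Local Notation mu := (@lebesgue_measure R).
Local Notation tup n := (n.-tuple (measurableTypeR R)).
Local Notation lebT n := (@lebesgue_tuple R n).

Lemma cosh_ge1 (x : R) : 1 <= cosh x.
Proof.
rewrite /cosh; have := expR_gt0 x; rewrite expRN => e0.
rewrite ler_pdivlMr// mul1r.
have : (expR x + (expR x)^-1) - 2 = (expR x - 1) ^+ 2 / expR x by field; rewrite gt_eqF.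
have := divr_ge0 (sqr_ge0 (expR x - 1)) (ltW e0); lra.
Qed.

Lemma cosh0 : cosh (0 : R) = 1.
Proof. by rewrite /cosh oppr0 expR0; lra. Qed.

Lemma coshN (x : R) : cosh (- x) = cosh x.
Proof. by rewrite /cosh opprK addrC. Qed.

Section fixed_size.
Variable n : nat.
Implicit Types (w : 'I_n -> 'I_n -> R) (eta : 'I_n -> R) (t : tup n).

Definition edge_cond w t i j := w i j * expR (tnth t i + tnth t j).

Definition pin_cond eta t i := eta i * expR (tnth t i).

Definition lap_det w eta t := \det (lap (edge_cond w t) (pin_cond eta t)).

Definition edge_action w t :=
  (\sum_i \sum_j w i j * (cosh (tnth t i - tnth t j) - 1)) / 2.

Definition pin_action eta t := \sum_i eta i * (cosh (tnth t i) - 1).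

(** The density of the t-marginal of the measure, the s-integral and the sum
    over the trees having been carried out. *)
Definition marginal w eta t : R :=
  expR (- (\sum_i tnth t i) - edge_action w t - pin_action eta t) *
  Num.sqrt (lap_det w eta t) / Num.sqrt (2 * pi) ^+ n.

Lemma marginal_ge0 w eta t : 0 <= marginal w eta t.
Proof.
by rewrite divr_ge0 ?exprn_ge0 ?sqrtr_ge0// mulr_ge0 ?expR_ge0 ?sqrtr_ge0.
Qed.

End fixed_size.

Section joint_measurability.
Context d (T : measurableType d) n (w : T -> 'I_n -> 'I_n -> R) (eta : T -> 'I_n -> R)
  (t : T -> tup n).
Hypotheses (mw : forall i j, measurable_fun setT (fun x => w x i j))
  (me : forall i, measurable_fun setT (fun x => eta x i))
  (mt : forall i, measurable_fun setT (fun x => tnth (t x) i)).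

Lemma measurable_lap_det : measurable_fun setT (fun x => lap_det (w x) (eta x) (t x)).
Proof.
rewrite /lap_det; apply: measurable_det => i j.
apply: (eq_measurable_fun (fun x =>
  lap_entry (edge_cond (w x) (t x)) (pin_cond (eta x) (t x)) i j)).
  by move=> x _; rewrite mxE.
rewrite /lap_entry /edge_cond /pin_cond; meas; by [exact: mw|exact: me|exact: mt].
Qed.

Lemma measurable_marginal : measurable_fun setT (fun x => marginal (w x) (eta x) (t x)).
Proof.
have := measurable_lap_det => mL.
rewrite /marginal /edge_action /pin_action; meas; lazymatch goal with
  | |- measurable_fun _ (fun x => tnth _ _) => exact: mt
  | |- measurable_fun _ (fun x => lap_det _ _ _) => exact: mL
  | |- measurable_fun _ (fun x => w _ _ _) => exact: mw
  | |- _ => exact: me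
  end.
Qed.

End joint_measurability.

Section one_site.
Variables (n : nat) (w : 'I_n.+1 -> 'I_n.+1 -> R) (eta : 'I_n.+1 -> R).
Hypothesis w_sym : forall i j, w i j = w j i.

Definition mesh_w (u : R) (i j : 'I_n) : R :=
  w (lift 0 i) (lift 0 j) + w (lift 0 i) 0 * w 0 (lift 0 j) * expR (- u).

Definition mesh_eta (u : R) (i : 'I_n) : R :=
  eta (lift 0 i) + w (lift 0 i) 0 * eta 0 * expR (- u).

Definition site_weight (t : tup n) : R :=
  \sum_j w 0 (lift 0 j) * expR (tnth t j) + eta 0.

Lemma lap_det_star_mesh (t : tup n) (u : R) : 0 < site_weight t ->
  lap_det w eta (cons_pair (ln (site_weight t) - u, t)) =
  (site_weight t * expR (- u / 2)) ^+ 2 * lap_det (mesh_w u) (mesh_eta u) t.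
Proof.
move=> c0; have cE : \sum_j w 0 (lift 0 j) * expR (tnth t j) + eta 0 = site_weight t by [].
move: (site_weight t) c0 cE => c c0 cE.
have : expR (ln c - u) = c * expR (- u) by rewrite expRD lnK.
move: (ln c - u) => x ex.
pose a := edge_cond w (cons_pair (x, t)); pose e := pin_cond eta (cons_pair (x, t)).
have CE : \sum_j a 0 (lift 0 j) + e 0 = expR x * c.
  rewrite -cE mulrDr mulr_sumr /a /e /edge_cond /pin_cond /= tnth0.
  congr (_ + _); last by rewrite mulrC.
  by apply: eq_bigr => j _; rewrite tnthS expRD; ring.
have ex0 : 0 < expR x * c by rewrite mulr_gt0// expR_gt0.
have mE (p q : R) : p * expR x * (q * expR x) / (expR x * c) = p * q * expR (- u).
  by rewrite ex; field; rewrite gt_eqF// gt_eqF// expR_gt0.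
rewrite /lap_det det_lap_star_mesh CE ?gt_eqF//.
congr (_ * _); last congr (\det (lap _ _)).
- rewrite ex exprMn mulrAC -expr2; congr (_ * _).
  by rewrite expr2 -expRD; congr expR; lra.
- apply/funext => i; apply/funext => j; rewrite /edge_cond /mesh_w /a /edge_cond.
  rewrite !tnthS tnth0 !expRD mulrDl; congr (_ + _).
  transitivity (expR (tnth t i) * expR (tnth t j) *
    (w (lift 0 i) 0 * expR x * (w 0 (lift 0 j) * expR x) / (expR x * c))); first by ring.
  by rewrite mE; ring.
- apply/funext => i; rewrite /pin_cond /mesh_eta /a /e /edge_cond /pin_cond.
  rewrite !tnthS tnth0 !expRD mulrDl; congr (_ + _).
  transitivity (expR (tnth t i) *
    (w (lift 0 i) 0 * expR x * (eta 0 * expR x) / (expR x * c))); first by ring.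
  by rewrite mE; ring.
Qed.

Let S := \sum_j w 0 (lift 0 j).

Lemma action_star_mesh (t : tup n) (u : R) : 0 < site_weight t ->
  edge_action w (cons_pair (ln (site_weight t) - u, t)) +
  pin_action eta (cons_pair (ln (site_weight t) - u, t)) =
  edge_action (mesh_w u) t + pin_action (mesh_eta u) t +
  (expR u + (S + eta 0) ^+ 2 * expR (- u)) / 2 - (S + eta 0).
Proof.
move=> c0; have cE : \sum_j w 0 (lift 0 j) * expR (tnth t j) + eta 0 = site_weight t by [].
move: (site_weight t) c0 cE => c c0 cE.
have : expR (ln c - u) = c * expR (- u) by rewrite expRD lnK.
move: (ln c - u) => x ex.
pose B := \sum_j w 0 (lift 0 j) * expR (- tnth t j).
pose A := \sum_j w 0 (lift 0 j) * expR (tnth t j).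
pose E := \sum_i \sum_j w (lift 0 i) (lift 0 j) * (cosh (tnth t i - tnth t j) - 1).
pose P := \sum_i eta (lift 0 i) * (cosh (tnth t i) - 1).
pose X := \sum_j w 0 (lift 0 j) * (cosh (x - tnth t j) - 1).
have XE : X = (expR x * B + expR (- x) * A) / 2 - S.
  rewrite /X /B /A /S !mulr_sumr -big_split /= mulr_suml -sumrB.
  by apply: eq_bigr => j _; rewrite /cosh opprB !expRD; field.
have -> : edge_action w (cons_pair (x, t)) = E / 2 + X.
  rewrite /edge_action big_ord_recl big_ord_recl subrr cosh0 subrr mulr0 add0r.
  under eq_bigr do rewrite tnth0 tnthS.
  rewrite -/X; under [X in _ + X]eq_bigr do rewrite big_ord_recl.
  rewrite big_split /=.
  rewrite (_ : \sum_i w (lift 0 i) 0 * _ = X); last first.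
    by apply: eq_bigr => i _; rewrite tnth0 tnthS w_sym -coshN opprB.
  rewrite (_ : \sum_i \sum_j w (lift 0 i) (lift 0 j) * _ = E); first lra.
  by apply: eq_bigr => i _; apply: eq_bigr => j _; rewrite !tnthS.
have -> : pin_action eta (cons_pair (x, t)) = eta 0 * (cosh x - 1) + P.
  by rewrite /pin_action big_ord_recl tnth0; under eq_bigr do rewrite tnthS.
have -> : edge_action (mesh_w u) t = E / 2 + expR (- u) * (A * B - S ^+ 2) / 2.
  rewrite /edge_action /mesh_w -mulrDl; congr (_ / 2).
  under eq_bigr do (under eq_bigr do rewrite mulrDl; rewrite big_split /=).
  rewrite big_split /=; congr (_ + _).
  have dE (f g : 'I_n -> R) : (\sum_i w 0 (lift 0 i) * f i) * (\sum_i w 0 (lift 0 i) * g i)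
     = \sum_i \sum_j w 0 (lift 0 i) * w 0 (lift 0 j) * (f i * g j).
    rewrite mulr_suml; apply: eq_bigr => i _; rewrite mulr_sumr.
    by apply: eq_bigr => j _; ring.
  have -> : A * B - S ^+ 2 = (A * B + B * A) / 2 - S * S by lra.
  have S1 : S = \sum_j w 0 (lift 0 j) * 1 by apply: eq_bigr => j _; rewrite mulr1.
  rewrite S1 /A /B !dE -big_split mulr_suml -sumrB mulr_sumr; apply: eq_bigr => i _.
  rewrite -big_split mulr_suml -sumrB mulr_sumr; apply: eq_bigr => j _ /=.
  by rewrite (w_sym (lift 0 i)) /cosh opprB !expRD; field.
have -> : pin_action (mesh_eta u) t = P + eta 0 * expR (- u) * ((A + B) / 2 - S).
  rewrite /pin_action /mesh_eta; under eq_bigr do rewrite mulrDl.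
  rewrite big_split /=; congr (_ + _).
  rewrite /A /B /S -big_split mulr_suml -sumrB mulr_sumr; apply: eq_bigr => i _ /=.
  by rewrite w_sym /cosh; field.
rewrite XE /cosh !expRN ex -cE -/A !expRN.
have u0 := expR_gt0 u; have A0 : A + eta 0 != 0 by rewrite cE gt_eqF.
by field; rewrite A0 gt_eqF.
Qed.

(** In terms of u = ln (site_weight t) - t_0 the first vertex decouples: it
    follows site_density, and given u the others form a system of the same kind
    with star-mesh weights. *)
Lemma marginal_star_mesh (t : tup n) (u : R) : 0 < site_weight t ->
  marginal w eta (cons_pair (ln (site_weight t) - u, t)) =
  site_density (S + eta 0) u * marginal (mesh_w u) (mesh_eta u) t.
Proof.
move=> c0; rewrite /marginal lap_det_star_mesh// sqrtrM ?sqr_ge0// sqrtr_sqr.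
rewrite ger0_norm ?mulr_ge0 ?expR_ge0 ?ltW//.
rewrite -!addrA -!opprD [X in - (_ + X)]action_star_mesh// big_ord_recl tnth0.
under eq_bigr do rewrite tnthS.
set c := site_weight t in c0 *; set T := \sum_i tnth t i.
rewrite /site_density [Num.sqrt _ ^+ n.+1]exprS.
set Q := Num.sqrt (lap_det _ _ _).
set act := edge_action _ _ + pin_action _ _.
set K := (_ + _) / 2.
have z0 := @sqrt2pi_gt0 R; move: (Num.sqrt (2 * pi)) z0 => z z0.
have -> : expR (- ((ln c - u, t).1 + T + (act + K - (S + eta 0)))) * (c * expR (- u / 2) * Q) =
    expR (u / 2 + (S + eta 0) - K) * expR (- (T + act)) * Q.
  by rewrite mulrA; congr (_ * Q); rewrite -[in c * _](lnK (c0 : c \is Num.pos)) -!expRD /=;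
    congr expR; lra.
by field; rewrite expf_neq0 ?gt_eqF.
Qed.

End one_site.

(** Induction on the number of vertices by marginal_star_mesh. A vertex without
    any weight makes the determinant vanish. *)
Lemma integral_marginal_le1 n (w : 'I_n -> 'I_n -> R) eta :
  (forall i j, w i j = w j i) -> (forall i j, 0 <= w i j) -> (forall i, 0 <= eta i) ->
  (\int[lebT n]_t (marginal w eta t)%:E <= 1)%E.
Proof.
elim: n w eta => [|n IH] w eta w_sym w0 eta0.
  rewrite integral_lebesgue_tuple0; last by move=> t; rewrite lee_fin marginal_ge0.
  rewrite /marginal /edge_action /pin_action /lap_det det_mx00 !big_ord0.
  by rewrite mul0r !subr0 oppr0 expR0 sqrtr1 expr0 divr1 mul1r.
have mm : measurable_fun setT (fun t => (marginal w eta t)%:E).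
  by apply/measurable_EFinP; apply: measurable_marginal => *; meas.
have m0 : forall t, (0 <= (marginal w eta t)%:E)%E by move=> t; rewrite lee_fin marginal_ge0.
pose m := \sum_j w 0 (lift 0 j) + eta 0.
have s0 : 0 <= \sum_j w 0 (lift 0 j) by apply: sumr_ge0.
have [m00|mpos] := leP m 0.
  have e00 : eta 0 = 0 by have := eta0 0; move: m00 s0; rewrite /m; lra.
  have /eqP : \sum_j w 0 (lift 0 j) = 0 by have := eta0 0; move: m00 s0; rewrite /m; lra.
  rewrite psumr_eq0// => /allP wj.
  rewrite (eq_integral (cst 0%E)) ?integral0// => t _.
  rewrite /marginal /lap_det det_lap_isolated ?sqrtr0 ?mulr0 ?mul0r//.
    by move=> j; rewrite /edge_cond (eqP (wj j (mem_index_enum _))) mul0r.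
  by rewrite /pin_cond e00 mul0r.
have cpos t : 0 < site_weight w eta t.
  have sj0 : 0 <= \sum_j w 0 (lift 0 j) * expR (tnth t j).
    by apply: sumr_ge0 => j _; rewrite mulr_ge0 ?expR_ge0.
  rewrite /site_weight lt_neqAle addr_ge0// andbT eq_sym paddr_eq0//.
  apply/negP => /andP[/eqP + /eqP e00].
  move=> /eqP; rewrite psumr_eq0 => [/allP wj|j _]; last by rewrite mulr_ge0 ?expR_ge0.
  have : m = 0.
    rewrite /m e00 addr0 big1// => j _.
    have := wj j (mem_index_enum _).
    by rewrite mulf_eq0 [expR _ == 0]gt_eqF ?expR_gt0 ?orbF// => /eqP.
  by move/eqP; rewrite gt_eqF.
rewrite integral_lebesgue_tuple_tail//.
pose F (u : R) (t : tup n) := (site_density m u * marginal (mesh_w w u) (mesh_eta w eta u) t)%:E.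
have mF : measurable_fun setT (fun z : measurableTypeR R * tup n => F z.1 z.2).
  apply/measurable_EFinP; apply: measurable_funM.
    apply: (measurableT_comp (f := site_density m)) => //.
    apply: continuous_measurable_fun; exact: continuous_site_density.
  have m1 : measurable_fun setT (fun x : measurableTypeR R * tup n => x.1 : R).
    exact: measurable_fst.
  have m2 i : measurable_fun setT (fun x : measurableTypeR R * tup n => tnth x.2 i : R).
    apply: (measurableT_comp (f := fun t : tup n => tnth t i)) => //.
    exact: measurable_tnth.
  apply: measurable_marginal => [i j|i|i].
  - by rewrite /mesh_w; meas; exact: m1.
  - by rewrite /mesh_eta; meas; exact: m1.
  - exact: m2.
have F0 u t : (0 <= F u t)%E.
  by rewrite lee_fin mulr_ge0 ?site_density_ge0 ?marginal_ge0.
have -> : (\int[lebT n]_t \int[mu]_x (marginal w eta (cons_pair (x, t)))%:E =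
           \int[lebT n]_t \int[mu]_u F u t)%E.
  apply: eq_integral => t _.
  have mx : measurable_fun setT (fun x : R => (marginal w eta (cons_pair (x, t)))%:E).
    apply: (measurableT_comp mm).
    apply: (measurableT_comp (@measurable_cons_pair R n)).
    exact: pair2_measurable.
  rewrite -(ge0_integral_shift (ln (site_weight w eta t))
    (f := fun x => (marginal w eta (cons_pair (x, t)))%:E))//.
  rewrite -(ge0_integral_opp (f := fun x =>
    (marginal w eta (cons_pair (x + ln (site_weight w eta t), t)))%:E))//; last first.
    apply: (measurableT_comp mx) => //.
    by apply: measurable_funD => //; exact: measurable_cst.
  apply: eq_integral => u _; congr EFin.
  by rewrite addrC marginal_star_mesh.
rewrite -(@fubini_tonelli _ _ _ _ _ mu (lebT n) (fun z => F z.1 z.2))//=.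
apply: (@le_trans _ _ (\int[mu]_u (site_density m u)%:E)%E); last first.
  by rewrite integral_site_density.
apply: ge0_le_integral => //.
- by move=> u _; apply: integral_ge0.
- exact: (measurable_fun_fubini_tonelli_F (fun z => F z.1 z.2)).
- by apply/measurable_EFinP; apply: continuous_measurable_fun; exact: continuous_site_density.
move=> u _; rewrite /F; under eq_integral do rewrite EFinM.
rewrite ge0_integralZl//; last 3 first.
- by apply/measurable_EFinP; apply: measurable_marginal => *; meas.
- by move=> t _; rewrite lee_fin marginal_ge0.
- by rewrite lee_fin site_density_ge0.
rewrite -[leRHS]mule1 lee_wpmul2l ?lee_fin ?site_density_ge0//; apply: IH.
- by move=> i j; rewrite /mesh_w (w_sym (lift 0 i) (lift 0 j)) (w_sym (lift 0 i) 0) (w_sym 0 (lift 0 j)); ring.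
- by move=> i j; rewrite /mesh_w addr_ge0// !mulr_ge0// expR_ge0.
- by move=> i; rewrite /mesh_eta addr_ge0// !mulr_ge0// expR_ge0.
Qed.

End marginal.

(** * Exchange of the pinning *)

(** Homogeneity of degree n - 1; the factor s on the left avoids the predecessor
    in the exponent. *)
Lemma kappa_scale (F : fieldType) n (a : 'I_n -> 'I_n -> F) z (s : F) : s != 0 ->
  s * kappa (fun i j => s * a i j) z = s ^+ n * kappa a z.
Proof.
move=> s0; rewrite -det_lap_point -detZ; congr (\det _).
by apply/matrixP => i j; rewrite !mxE /lap_entry -mulr_sumr; ring.
Qed.

Section localization.
Context {R : realType}.
Local Notation mu := (@lebesgue_measure R).
Local Notation tup n := (n.-tuple (measurableTypeR R)).
Local Notation lebT n := (@lebesgue_tuple R n).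
Local Notation Z := (Num.sqrt (2 * pi) : R).

(** The weight of t without any pinning. The choice of the vertex z, where the
    trees are rooted, does not matter for symmetric weights, see free_root. *)
Definition free n (w : 'I_n -> 'I_n -> R) (z : 'I_n) (t : tup n) : R :=
  expR (- (\sum_i tnth t i) - edge_action w t) *
  Num.sqrt (kappa (edge_cond w t) z) / Z ^+ n.

(** The dependence on t_z of the pinning at z with weight 1, divided by exp t_z;
    see marginal_point. *)
Definition cutoff (u : R) : R := expR (- u / 2 - (cosh u - 1)).

Lemma point_ge0 n (z i : 'I_n) : 0 <= point R z i.
Proof. exact: ler0n. Qed.

Lemma edge_cond_ge0 n (w : 'I_n -> 'I_n -> R) (t : tup n) :
  (forall i j, 0 <= w i j) -> forall i j, 0 <= edge_cond w t i j.
Proof. by move=> w0 i j; rewrite mulr_ge0// expR_ge0. Qed.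

Lemma kappa_ge0 n (w : 'I_n -> 'I_n -> R) (t : tup n) z :
  (forall i j, 0 <= w i j) -> 0 <= kappa (edge_cond w t) z.
Proof.
by move=> w0; apply: det_lap_ge0; [exact: edge_cond_ge0|exact: point_ge0].
Qed.

Lemma free_ge0 n (w : 'I_n -> 'I_n -> R) z (t : tup n) : 0 <= free w z t.
Proof.
by rewrite divr_ge0 ?exprn_ge0 ?sqrtr_ge0// mulr_ge0 ?expR_ge0 ?sqrtr_ge0.
Qed.

Lemma measurable_free d (T : measurableType d) n (w : 'I_n -> 'I_n -> R) z (t : T -> tup n) :
  (forall i, measurable_fun setT (fun x => tnth (t x) i)) ->
  measurable_fun setT (fun x => free w z (t x)).
Proof.
move=> mt; rewrite /free /kappa /edge_action; meas; try exact: mt.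
apply: (eq_measurable_fun (fun x => lap_entry (edge_cond w (t x)) (point R z) _ _)).
  by move=> x _; rewrite mxE.
by rewrite /lap_entry /edge_cond; meas; exact: mt.
Qed.

Lemma measurable_cutoff : measurable_fun setT cutoff.
Proof. by rewrite /cutoff; meas. Qed.

Lemma integral_cutoff : (\int[mu]_u (cutoff u)%:E = Z%:E)%E.
Proof.
have ms : measurable_fun setT (fun u => (site_density (1 : R) u)%:E).
  by apply/measurable_EFinP; apply: continuous_measurable_fun; exact: continuous_site_density.
rewrite -(ge0_integral_opp (f := fun u => (cutoff u)%:E)); last 2 first.
- by apply/measurable_EFinP; exact: measurable_cutoff.
- by move=> u; rewrite lee_fin expR_ge0.
transitivity (\int[mu]_u (Z%:E * (site_density 1 u)%:E))%E.
  apply: eq_integral => u _; rewrite -EFinM; congr EFin.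
  rewrite /site_density mulrC divfK ?gt_eqF ?sqrt2pi_gt0//; congr expR.
  by rewrite coshN /cosh expr1n; lra.
rewrite ge0_integralZl//; last by move=> u _; rewrite lee_fin site_density_ge0.
by rewrite integral_site_density// mule1.
Qed.

Lemma free_root n (w : 'I_n -> 'I_n -> R) z z' (t : tup n) :
  (forall i j, w i j = w j i) -> free w z t = free w z' t.
Proof.
move=> ws; rewrite /free (@kappa_eq _ _ (edge_cond w t) _ z z')// => i j.
by rewrite /edge_cond ws addrC.
Qed.

Lemma marginal_point n (w : 'I_n -> 'I_n -> R) z (t : tup n) :
  marginal w (point R z) t = expR (tnth t z) * free w z t * cutoff (tnth t z).
Proof.
rewrite /marginal /lap_det.
have -> : pin_cond (point R z) t = fun i => expR (tnth t z) * point R z i.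
  apply/funext => i; rewrite /pin_cond /point.
  by case: eqVneq => [->|_]; rewrite ?mulr1 ?mul1r ?mulr0 ?mul0r.
rewrite det_lap_point sqrtrM ?expR_ge0//.
have -> : Num.sqrt (expR (tnth t z)) = expR (tnth t z / 2).
  have -> : expR (tnth t z) = expR (tnth t z / 2) ^+ 2.
    by rewrite expr2 -expRD; congr expR; lra.
  by rewrite sqrtr_sqr ger0_norm ?expR_ge0.
have -> : pin_action (point R z) t = cosh (tnth t z) - 1.
  rewrite /pin_action (bigD1 z)//= /point eqxx mul1r big1 ?addr0// => i iz.
  by rewrite (negPf iz) mul0r.
rewrite /free /cutoff; set A := _ - edge_action w t; set K := Num.sqrt (kappa _ _).
rewrite [RHS](_ : _ = expR (tnth t z) * expR A * expR (- tnth t z / 2 - (cosh (tnth t z) - 1))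
  * K / Z ^+ n); last by ring.
congr (_ / _); rewrite mulrA; congr (_ * K); rewrite -!expRD; congr expR; lra.
Qed.

Lemma tnth_tshift n (h : 'I_n -> R) (t : tup n) i : tnth (tshift h t) i = tnth t i + h i.
Proof. by rewrite tnth_mktuple. Qed.

Lemma edge_action_shift n (w : 'I_n -> 'I_n -> R) (t : tup n) u :
  edge_action w (tshift (fun=> u) t) = edge_action w t.
Proof.
congr (_ / 2); apply: eq_bigr => i _; apply: eq_bigr => j _.
by rewrite !tnth_tshift; congr (_ * (cosh _ - 1)); ring.
Qed.

Lemma free_shift n (w : 'I_n -> 'I_n -> R) z (t : tup n) u : (forall i j, 0 <= w i j) ->
  free w z (tshift (fun=> u) t) = expR (- u) * free w z t.
Proof.
move=> w0; rewrite /free edge_action_shift.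
have -> : edge_cond w (tshift (fun=> u) t) = fun i j => expR u ^+ 2 * edge_cond w t i j.
  apply/funext => i; apply/funext => j; rewrite /edge_cond !tnth_tshift mulrCA; congr (_ * _).
  by rewrite expr2 -!expRD; congr expR; ring.
have e0 : expR u != 0 by rewrite gt_eqF// expR_gt0.
have -> : kappa (fun i j => expR u ^+ 2 * edge_cond w t i j) z =
    (expR u ^+ n / expR u) ^+ 2 * kappa (edge_cond w t) z.
  apply: (@mulfI _ (expR u ^+ 2)); first by rewrite expf_neq0.
  rewrite kappa_scale ?expf_neq0// mulrA; congr (_ * _).
  by rewrite [(_ / _) ^+ 2]exprMn [_^-1 ^+ 2]exprVn mulrCA divff ?mulr1 ?expf_neq0// exprAC.
rewrite sqrtrM ?sqr_ge0// sqrtr_sqr ger0_norm; last first.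
  by rewrite divr_ge0 ?exprn_ge0 ?expR_ge0.
under eq_bigr do rewrite tnth_tshift.
rewrite big_split /= sumr_const card_ord.
set A := \sum_i _; set E := edge_action w t.
have -> : expR (- (A + u *+ n) - E) = expR (- A - E) / expR u ^+ n.
  by rewrite -expRM_natl -expRN -expRD -[u *+ n]mulr_natl; congr expR; ring.
rewrite expRN; field.
by rewrite e0 !expf_neq0// gt_eqF// sqrt2pi_gt0.
Qed.

(** Both sides are the integral over t and u of F t * th1 t * th2 (t + u), by
    the invariance of F and of Lebesgue measure under t -> t + u. *)
Lemma integral_exchange n (F th1 th2 : tup n -> R) (c1 c2 : R) :
  measurable_fun setT F -> (forall t, 0 <= F t) ->
  (forall t u, F (tshift (fun=> u) t) = F t) ->
  measurable_fun setT th1 -> (forall t, 0 <= th1 t) ->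
  measurable_fun setT th2 -> (forall t, 0 <= th2 t) ->
  (forall t, \int[mu]_u (th1 (tshift (fun=> u) t))%:E = c1%:E)%E ->
  (forall t, \int[mu]_u (th2 (tshift (fun=> u) t))%:E = c2%:E)%E ->
  0 <= c1 -> 0 <= c2 ->
  (c2%:E * \int[lebT n]_t (F t * th1 t)%:E = c1%:E * \int[lebT n]_t (F t * th2 t)%:E)%E.
Proof.
move=> mF F0 Fs m1 p1 m2 p2 I1 I2 c10 c20.
have msh (s : R) : measurable_fun setT
    (fun z : measurableTypeR R * tup n => tshift (fun=> s * z.1) z.2).
  apply/measurable_fun_tnthP => i.
  apply: (eq_measurable_fun (fun z : measurableTypeR R * tup n => (tnth z.2 i + s * z.1 : R))).
    by move=> z _ /=; rewrite tnth_mktuple.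
  apply: measurable_funD.
    by apply: (measurableT_comp (f := fun t : tup n => tnth t i)) => //; exact: measurable_tnth.
  by apply: measurable_funM; [exact: measurable_cst|exact: measurable_fst].
have shift_fst s (g : tup n -> R) : measurable_fun setT g ->
    measurable_fun setT (fun z : measurableTypeR R * tup n => g (tshift (fun=> s * z.1) z.2)).
  by move=> mg; exact: (measurableT_comp mg (msh s)).
have snd (g : tup n -> R) : measurable_fun setT g ->
    measurable_fun setT (fun z : measurableTypeR R * tup n => g z.2).
  by move=> mg; apply: (measurableT_comp mg); exact: measurable_snd.
have slice s (g : tup n -> R) t : measurable_fun setT g ->
    measurable_fun setT (fun u : measurableTypeR R => (g (tshift (fun=> s * u) t))%:E).
  move=> mg; apply/measurable_EFinP.
  apply: (measurableT_comp (shift_fst s g mg) (g := fun u : measurableTypeR R => (u, t))).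
  exact: pair2_measurable.
have s1 (u : R) (t : tup n) : tshift (fun=> 1 * u) t = tshift (fun=> u) t by rewrite mul1r.
have sN (u : R) (t : tup n) : tshift (fun=> - 1 * u) t = tshift (fun=> - u) t by rewrite mulN1r.
pose G1 (z : measurableTypeR R * tup n) := (F z.2 * th1 z.2 * th2 (tshift (fun=> z.1) z.2))%:E.
pose G2 (z : measurableTypeR R * tup n) := (F z.2 * th2 z.2 * th1 (tshift (fun=> - z.1) z.2))%:E.
have mG1 : measurable_fun setT G1.
  apply/measurable_EFinP; apply: measurable_funM.
    by apply: measurable_funM; exact: snd.
  apply: (eq_measurable_fun _ _ (shift_fst 1 th2 m2)).
  by move=> z _; rewrite s1.
have mG2 : measurable_fun setT G2.
  apply/measurable_EFinP; apply: measurable_funM.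
    by apply: measurable_funM; exact: snd.
  apply: (eq_measurable_fun _ _ (shift_fst (-1) th1 m1)).
  by move=> z _; rewrite sN.
have pG1 z : (0 <= G1 z)%E by rewrite lee_fin !mulr_ge0.
have pG2 z : (0 <= G2 z)%E by rewrite lee_fin !mulr_ge0.
transitivity (\int[lebT n]_t \int[mu]_u G1 (u, t))%E.
  rewrite -ge0_integralZl//; last 2 first.
  - by apply/measurable_EFinP; exact: measurable_funM.
  - by move=> t _; rewrite lee_fin mulr_ge0.
  apply: eq_integral => t _; rewrite /G1 /=.
  under [RHS]eq_integral do rewrite EFinM.
  rewrite ge0_integralZl//; last 3 first.
  - by under eq_fun do rewrite -s1; exact: slice.
  - by move=> u _; rewrite lee_fin.
  - by rewrite lee_fin mulr_ge0.
  by rewrite I2 muleC.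
rewrite -(@fubini_tonelli _ _ _ _ _ mu (lebT n) G1)//.
transitivity (\int[mu]_u \int[lebT n]_t G2 (u, t))%E.
  apply: eq_integral => u _.
  rewrite -(integral_tshift (fun=> u) (f := fun t => G2 (u, t)))//; last first.
    by apply: (measurableT_comp mG2); exact: pair1_measurable.
  apply: eq_integral => t _; rewrite /G1 /G2 /= Fs; congr EFin.
  rewrite (_ : tshift (fun=> - u) _ = t); first by ring.
  by apply: eq_from_tnth => i; rewrite !tnth_tshift addrK.
rewrite (@fubini_tonelli _ _ _ _ _ mu (lebT n) G2)//.
rewrite -ge0_integralZl//; last 2 first.
- by apply/measurable_EFinP; exact: measurable_funM.
- by move=> t _; rewrite lee_fin mulr_ge0.
apply: eq_integral => t _; rewrite /G2 /=.
under eq_integral do rewrite EFinM.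
have mt1 : measurable_fun setT (fun u : R => (th1 (tshift (fun=> u) t))%:E).
  by under eq_fun do rewrite -s1; exact: slice.
rewrite ge0_integralZl//; last 3 first.
- by under eq_fun do rewrite -sN; exact: slice.
- by move=> u _; rewrite lee_fin.
- by rewrite lee_fin mulr_ge0.
rewrite (ge0_integral_opp (f := fun u => (th1 (tshift (fun=> u) t))%:E))//; last first.
  by move=> u; rewrite lee_fin.
by rewrite I1 muleC.
Qed.

End localization.

(** * Exponential decay without pinning *)

Section decay.
Context {R : realType}.
Local Notation mu := (@lebesgue_measure R).
Local Notation tup n := (n.-tuple (measurableTypeR R)).
Local Notation lebT n := (@lebesgue_tuple R n).
Local Notation Z := (Num.sqrt (2 * pi) : R).

Lemma coshD_coshB (a b : R) : cosh (a + b) + cosh (a - b) = 2 * cosh a * cosh b.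
Proof. by rewrite /cosh opprD opprB [- a + _]addrC addrC !expRD; field. Qed.

Section pointwise.
Variables (n : nat) (w : 'I_n -> 'I_n -> R) (act : rel 'I_n) (h : 'I_n -> R) (k : R).
Hypotheses (w_sym : forall i j, w i j = w j i) (w0 : forall i j, 0 <= w i j).
Hypotheses (act_sym : symmetric act).
Hypotheses (k0 : 0 <= k) (k1 : k <= 2^-1).
Hypothesis h_slope : forall i j,
  w i j * (cosh (h i - h j) - 1) <= k * (w i j * (act i j)%:R).

(** The cosh energy of the pairs marked by act, across which the shift h varies. *)
Definition active_energy (t : tup n) : R :=
  (\sum_i \sum_j w i j * (act i j)%:R * cosh (tnth t i - tnth t j)) / 2.

Definition active_weight : R := (\sum_i \sum_j w i j * (act i j)%:R) / 2.

Definition active_count : nat := #|[set p : 'I_n * 'I_n | act p.1 p.2]%SET|.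

Definition reduced_w (i j : 'I_n) : R := if act i j then (1 - k) * w i j else w i j.

Lemma reduced_w_ge0 i j : 0 <= reduced_w i j.
Proof. by rewrite /reduced_w; case: ifP => // _; rewrite mulr_ge0//; move: k1; lra. Qed.

Lemma reduced_w_sym i j : reduced_w i j = reduced_w j i.
Proof. by rewrite /reduced_w act_sym w_sym. Qed.

(** From cosh (a + b) + cosh (a - b) = 2 cosh a cosh b, with a the difference of
    t and b that of h. *)
Lemma edge_action_midpoint (t : tup n) :
  edge_action w (tshift h t) + edge_action w (tshift (fun i => - h i) t) <=
  2 * (edge_action w t + k * active_energy t).
Proof.
rewrite /edge_action /active_energy -mulrDl -big_split /=.
rewrite (_ : 2 * _ = (\sum_i (2 * (\sum_j w i j * (cosh (tnth t i - tnth t j) - 1)) +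
    2 * (k * (\sum_j w i j * (act i j)%:R * cosh (tnth t i - tnth t j))))) / 2); last first.
  by rewrite big_split /= -!mulr_sumr; lra.
rewrite ler_pM2r ?invr_gt0//; apply: ler_sum => i _.
rewrite -big_split !mulr_sumr -big_split /=; apply: ler_sum => j _.
rewrite !tnth_tshift -mulrDr.
have := coshD_coshB (tnth t i - tnth t j) (h i - h j).
rewrite (_ : _ + (h i - h j) = tnth t i + h i - (tnth t j + h j)); last by ring.
rewrite (_ : _ - (h i - h j) = tnth t i - h i - (tnth t j - h j)); last by ring.
have := ler_wpM2r (le_trans ler01 (cosh_ge1 (tnth t i - tnth t j))) (h_slope i j).
set c := cosh (tnth t i - tnth t j); set d := cosh (h i - h j).
set c1 := cosh _; set c2 := cosh _ => H1 H2.
have -> : c1 - 1 + (c2 - 1) = 2 * c * d - 2 by rewrite -H2; ring.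
by move: H1; nra.
Qed.

(** The conductances at t are the geometric means of those at t + h and t - h. *)
Lemma kappa_midpoint (t : tup n) z :
  kappa (edge_cond w t) z ^+ 2 <=
  kappa (edge_cond w (tshift h t)) z * kappa (edge_cond w (tshift (fun i => - h i) t)) z.
Proof.
apply: det_lap_log_convex; try exact: edge_cond_ge0; try exact: point_ge0.
  move=> i j; rewrite /edge_cond !tnth_tshift mulrACA -expRD expr2 mulrACA -expRD.
  by congr (_ * expR _); ring.
by move=> i; rewrite expr2.
Qed.

Lemma free_midpoint (t : tup n) z :
  expR (- k * active_energy t) * free w z t <=
  Num.sqrt (free w z (tshift (fun i => - h i) t) * free w z (tshift h t)).
Proof.
have z0 := @sqrt2pi_gt0 R.
have f0 : 0 <= expR (- k * active_energy t) * free w z t.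
  by rewrite mulr_ge0 ?expR_ge0 ?free_ge0.
rewrite -(ger0_norm f0) -sqrtr_sqr; apply: ler_wsqrtr; rewrite exprMn /free.
have kp t' : 0 <= kappa (edge_cond w t') z by exact: kappa_ge0.
set K := kappa (edge_cond w t) z; set E := edge_action w t.
set A := \sum_i tnth t i.
have sA (g : 'I_n -> R) : \sum_i tnth (tshift g t) i = A + \sum_i g i.
  by rewrite -big_split; apply: eq_bigr => i _; rewrite tnth_tshift.
rewrite !sA sumrN; set H := \sum_i h i.
rewrite [leLHS](_ : _ = expR (- k * active_energy t) ^+ 2 * expR (- A - E) ^+ 2 * K / (Z ^+ n) ^+ 2); last first.
  rewrite -[X in _ = _ * X / _](sqr_sqrtr (kp t)) -/K; field.
  by rewrite expf_neq0// gt_eqF.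
rewrite [leRHS](_ : _ = expR (- (A - H) - edge_action w (tshift (fun i => - h i) t)) *
    expR (- (A + H) - edge_action w (tshift h t)) *
    Num.sqrt (kappa (edge_cond w (tshift h t)) z * kappa (edge_cond w (tshift (fun i => - h i) t)) z)
    / (Z ^+ n) ^+ 2); last first.
  move: (kp (tshift h t)).
  move: (kappa _ z) (kappa _ z) (expR _) (expR _) => K1 K2 e1 e2 K10.
  by rewrite (sqrtrM _ K10); field; rewrite expf_neq0// gt_eqF.
rewrite ler_pM2r ?invr_gt0 ?exprn_gt0//.
apply: ler_pM; [by rewrite mulr_ge0 ?exprn_ge0 ?expR_ge0|exact: kp| |].
- rewrite -!expRM_natl -!expRD ler_expR.
  by have := edge_action_midpoint t; rewrite -/E; lra.
- rewrite -(ger0_norm (kp t : 0 <= K)) -sqrtr_sqr; apply: ler_wsqrtr; exact: kappa_midpoint.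
Qed.

(** With weights lowered by the factor 1 - k the action falls by k times the
    active energy minus its weight, and kappa falls at most by one factor 1 - k
    per active pair. *)
Lemma free_reduced (t : tup n) z :
  expR (k * active_energy t) * free w z t <=
  expR (k * (active_weight + active_count%:R)) * free reduced_w z t.
Proof.
have z0 := @sqrt2pi_gt0 R.
rewrite /free [leLHS]mulrA [leRHS]mulrA ler_pM2r ?invr_gt0 ?exprn_gt0//.
rewrite [leLHS]mulrA [leRHS]mulrA.
have EE : edge_action w t - k * active_energy t =
    edge_action reduced_w t - k * active_weight.
  rewrite /edge_action /active_energy /active_weight !mulrA -!mulrBl; congr (_ / 2).
  rewrite !mulr_sumr -!sumrB; apply: eq_bigr => i _.
  rewrite !mulr_sumr -!sumrB; apply: eq_bigr => j _.
  by rewrite /reduced_w; case: (act i j) => /=; ring.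
have kk : expR (- (2 * k)) ^+ active_count * kappa (edge_cond w t) z <=
    kappa (edge_cond reduced_w t) z.
  have -> : edge_cond reduced_w t =
      fun i j => if act i j then (1 - k) * edge_cond w t i j else edge_cond w t i j.
    apply/funext => i; apply/funext => j; rewrite /edge_cond /reduced_w.
    by case: ifP => // _; rewrite mulrA.
  have r0 : 0 < 1 - k by move: k1; lra.
  have r1 : 1 - k <= 1 by move: k0; lra.
  apply: le_trans (@det_lap_scale R n _ _ act (1 - k) (edge_cond_ge0 t w0) (point_ge0 z) r0 r1).
  apply: ler_wpM2r; first exact: kappa_ge0.
  apply: lerXn2r; rewrite ?nnegrE ?expR_ge0//; first by move: k1; lra.
  rewrite expRN -[leRHS]invrK lef_pV2 ?posrE ?expR_gt0 ?invr_gt0//.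
  apply: le_trans (expR_ge1Dx _).
  by rewrite -[leLHS]mul1r ler_pdivrMr//; move: k0 k1; nra.
have sk : expR (- k) ^+ active_count * Num.sqrt (kappa (edge_cond w t) z) <=
    Num.sqrt (kappa (edge_cond reduced_w t) z).
  rewrite -(ger0_norm (_ : 0 <= expR (- k) ^+ active_count)); last first.
    by rewrite exprn_ge0 ?expR_ge0.
  rewrite -sqrtr_sqr -sqrtrM ?sqr_ge0// ler_wsqrtr// (le_trans _ kk)//.
  rewrite le_eqVlt; apply/orP; left; apply/eqP; congr (_ * _).
  rewrite -exprM mulnC exprM; congr (_ ^+ _).
  by rewrite -expRM_natl; congr expR; ring.
rewrite -!expRD; set A := \sum_i tnth t i.
rewrite [X in expR X * _ <= _](_ : _ = - A - (edge_action w t - k * active_energy t)); last by ring.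
rewrite EE.
have := ler_wpM2l (expR_ge0 (- A - edge_action reduced_w t +
  k * (active_weight + active_count%:R))) sk.
rewrite mulrA -expRM_natl -expRD => H.
rewrite (_ : - A - (_ - k * active_weight) = - A - edge_action reduced_w t +
 k * (active_weight + active_count%:R) + active_count%:R * - k); last by ring.
by rewrite [k * _ + _]addrC.
Qed.

End pointwise.

Lemma sqrt_sqr_mul (c q m : R) : 0 <= c -> 0 <= q ->
  Num.sqrt (c ^+ 2 * q ^+ 2 * m) = c * q * Num.sqrt m.
Proof.
move=> c0 q0; rewrite -exprMn sqrtrM ?sqr_ge0// sqrtr_sqr ger0_norm//.
by rewrite mulr_ge0.
Qed.

Lemma EFin_mule_inj (z : R) (a b : \bar R) : 0 < z -> (z%:E * a = z%:E * b)%E -> a = b.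
Proof.
move=> z0 ab; have e : ((z^-1)%:E * z%:E = 1 :> \bar R)%E.
  by rewrite -EFinM mulVf// gt_eqF.
by rewrite -[a]mul1e -[b]mul1e -e -!muleA ab.
Qed.

Section integrated.
Variables (n : nat) (x y : 'I_n).

(** The exchange moves the cutoff from t_y to t_v, after which the integrand is
    the density of a measure pinned at v. *)
Lemma integral_pinned_le1 (w : 'I_n -> 'I_n -> R) (v : 'I_n) :
  (forall i j, w i j = w j i) -> (forall i j, 0 <= w i j) ->
  (\int[lebT n]_t (expR (tnth t v) * free w y t * cutoff (tnth t y))%:E <= 1)%E.
Proof.
move=> ws w0.
have mt i : measurable_fun setT (fun t : tup n => tnth t i : R) by exact: measurable_tnth.
have mfree z : measurable_fun setT (fun t : tup n => free w z t).
  by apply: measurable_free => i; exact: mt.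
have mcut z : measurable_fun setT (fun t : tup n => cutoff (tnth t z)).
  exact: (measurableT_comp measurable_cutoff (mt z)).
have cut0 u : 0 <= cutoff u by exact: expR_ge0.
have z0 := @sqrt2pi_gt0 R.
have Icut z (t : tup n) : (\int[mu]_u (cutoff (tnth (tshift (fun=> u) t) z))%:E = Z%:E)%E.
  under eq_integral do rewrite tnth_tshift addrC.
  rewrite (ge0_integral_shift (tnth t z) (f := fun u => (cutoff u)%:E)).
  - exact: integral_cutoff.
  - by apply/measurable_EFinP; exact: measurable_cutoff.
  - by move=> u; rewrite lee_fin cut0.
have := @integral_exchange R n (fun t => expR (tnth t v) * free w v t)
  (fun t => cutoff (tnth t y)) (fun t => cutoff (tnth t v)) Z Z.
move=> E; have {}E := E _ _ _ (mcut y) _ (mcut v) _ (Icut y) (Icut v) (ltW z0) (ltW z0).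
under eq_integral do rewrite (free_root y v _ ws).
have -> : (\int[lebT n]_t (expR (tnth t v) * free w v t * cutoff (tnth t y))%:E =
           \int[lebT n]_t (marginal w (point R v) t)%:E)%E.
  have {}E := E _ _ _ _ _.
  under [RHS]eq_integral do rewrite marginal_point.
  apply: (EFin_mule_inj z0); apply: E.
  - by apply: measurable_funM; [meas; exact: mt|exact: mfree].
  - by move=> t; rewrite mulr_ge0 ?expR_ge0 ?free_ge0.
  - by move=> t u; rewrite tnth_tshift free_shift// mulrA -expRD addrK.
  - by [].
  - by [].
by apply: integral_marginal_le1 => //; exact: point_ge0.
Qed.

Variables (w : 'I_n -> 'I_n -> R) (act : rel 'I_n) (h : 'I_n -> R) (k d : R).
Hypotheses (w_sym : forall i j, w i j = w j i) (w0 : forall i j, 0 <= w i j).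
Hypotheses (act_sym : symmetric act).
Hypotheses (k0 : 0 <= k) (k1 : k <= 2^-1) (h_y : h y = 0).
Hypothesis h_slope : forall i j,
  w i j * (cosh (h i - h j) - 1) <= k * (w i j * (act i j)%:R).
Hypothesis d_bound : k * (active_weight w act + (active_count act)%:R) <= d.

(** The geometric mean of the densities for x and y, shifted by h and - h, gains
    exp (h x / 2) and loses exp (- k C) with C the active energy. The densities
    with the reduced weights gain exp (k C) and lose exp (- d). All four have
    mass at most 1, and the arithmetic-geometric mean inequality combines the
    two bounds so that the random C cancels. *)
Lemma free_decay :
  (\int[lebT n]_t (expR ((tnth t x + tnth t y) / 2) * free w y t * cutoff (tnth t y))%:E
   <= (expR ((d - h x / 2) / 2))%:E)%E.
Proof.
have mt i : measurable_fun setT (fun t : tup n => tnth t i : R) by exact: measurable_tnth.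
have mcut : measurable_fun setT (fun t : tup n => cutoff (tnth t y)).
  exact: (measurableT_comp measurable_cutoff (mt y)).
have cut0 u : 0 <= cutoff u by exact: expR_ge0.
pose P (w : 'I_n -> 'I_n -> R) v (t : tup n) :=
  expR (tnth t v) * free w y t * cutoff (tnth t y).
have mP w' v : measurable_fun setT (P w' v).
  rewrite /P; apply: measurable_funM => //; apply: measurable_funM; first by meas; exact: mt.
  by apply: measurable_free => i; exact: mt.
have P0 w' v t : 0 <= P w' v t by rewrite !mulr_ge0 ?expR_ge0 ?free_ge0.
pose r := reduced_w w act k.
(* With this a the two bounds below read a * gain = exp s and exp (- s) for the
   same number s, and exp s + exp (- s) >= 2. *)
pose a := expR ((d - h x / 2) / 2).
pose S := tshift h : tup n -> tup n; pose S' := tshift (fun i => - h i) : tup n -> tup n.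
have mS g : measurable_fun setT (fun t : tup n => P g x (S t)).
  by apply: (measurableT_comp (mP g x)); exact: measurable_tshift.
have mS' g : measurable_fun setT (fun t : tup n => P g y (S' t)).
  by apply: (measurableT_comp (mP g y)); exact: measurable_tshift.
have pointwise t : expR ((tnth t x + tnth t y) / 2) * free w y t * cutoff (tnth t y) <=
    a / 4 * ((P w y (S' t) + P w x (S t)) + (P r x t + P r y t)).
  set c := cutoff (tnth t y).
  have c0 : 0 <= c by exact: cut0.
  set f := free w y t; have f0 : 0 <= f by exact: free_ge0.
  set C := active_energy w act t; set b := expR ((tnth t x + tnth t y) / 2).
  have b0 : 0 < b by exact: expR_gt0.
  have ab (u v : R) : 0 <= u -> 0 <= v -> Num.sqrt (u * v) <= (u + v) / 2.
    move=> u0 v0; rewrite -[leRHS]ger0_norm ?divr_ge0 ?addr_ge0// -sqrtr_sqr ler_wsqrtr//.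
    by have := sqr_ge0 (u - v); nra.
  have H1 : expR (h x / 2) * expR (- k * C) * (b * f * c) <= (P w y (S' t) + P w x (S t)) / 2.
    apply: le_trans (ab _ _ (P0 _ _ _) (P0 _ _ _)).
    rewrite /P !tnth_tshift h_y oppr0 !addr0 -/c.
    rewrite (_ : _ * c * (_ * c) = c ^+ 2 * (expR (tnth t y) * expR (tnth t x + h x)) *
      (free w y (S' t) * free w y (S t))); last by ring.
    have -> : expR (tnth t y) * expR (tnth t x + h x) = (expR (h x / 2) * b) ^+ 2.
      rewrite /b -!expRD expr2 -expRD; congr expR; lra.
    rewrite sqrt_sqr_mul//; last by rewrite mulr_ge0 ?expR_ge0.
    rewrite [leLHS](_ : _ = c * (expR (h x / 2) * b) * (expR (- k * C) * f)); last by ring.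
    apply: ler_wpM2l; first by rewrite !mulr_ge0 ?expR_ge0.
    exact: free_midpoint.
  have H2 : expR (- d) * expR (k * C) * (b * f * c) <= (P r x t + P r y t) / 2.
    have : b <= (expR (tnth t x) + expR (tnth t y)) / 2.
      have bb : expR (tnth t x) * expR (tnth t y) = b ^+ 2.
        by rewrite /b expr2 -!expRD; congr expR; lra.
      have := ab _ _ (expR_ge0 (tnth t x)) (expR_ge0 (tnth t y)).
      by rewrite bb sqrtr_sqr (ger0_norm (ltW b0)).
    rewrite /P -/c; set q := (expR (tnth t x) + _) / 2 => bq.
    rewrite [leRHS](_ : _ = q * (free r y t * c)); last by rewrite /q; ring.
    rewrite [leLHS](_ : _ = b * (expR (- d) * (expR (k * C) * f) * c)); last by ring.
    apply: ler_pM => //; first exact: ltW.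
      by rewrite !mulr_ge0 ?expR_ge0.
    apply: ler_wpM2r => //; rewrite expRN mulrC ler_pdivrMr ?expR_gt0//.
    apply: le_trans (free_reduced act w0 k0 k1 t y) _.
    rewrite mulrC; apply: ler_wpM2l; first exact: free_ge0.
    by rewrite ler_expR.
  set G := b * f * c in H1 H2 *; have G0 : 0 <= G by rewrite !mulr_ge0 ?expR_ge0.
  set Q1 := (P w y _ + _) in H1 *; set Q2 := (P r x t + _) in H2 *.
  have e1 : a * (expR (h x / 2) * expR (- k * C)) = expR (d / 2 + h x / 4 - k * C).
    by rewrite /a -!expRD; congr expR; lra.
  have e2 : a * (expR (- d) * expR (k * C)) = expR (- (d / 2 + h x / 4 - k * C)).
    by rewrite /a -!expRD; congr expR; lra.
  have a0 : 0 < a by exact: expR_gt0.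
  have := ler_wpM2l (ltW a0) H1; rewrite mulrA e1 => {}H1.
  have := ler_wpM2l (ltW a0) H2; rewrite mulrA e2 => {}H2.
  set s := d / 2 + h x / 4 - k * C in H1 H2.
  have := cosh_ge1 s; rewrite /cosh => cs.
  have : G * 2 <= G * (expR s + expR (- s)) by apply: ler_wpM2l => //; lra.
  by lra.
have mE (f : tup n -> R) : measurable_fun setT f -> measurable_fun setT (EFin \o f).
  by move=> mf; exact/measurable_EFinP.
have a0 : 0 < a by exact: expR_gt0.
apply: (@le_trans _ _ (\int[lebT n]_t (a / 4 * ((P w y (S' t) + P w x (S t)) + (P r x t + P r y t)))%:E)%E).
  apply: ge0_le_integral => //.
  - by move=> t _; rewrite lee_fin !mulr_ge0 ?expR_ge0 ?free_ge0.
  - apply: mE; apply: measurable_funM => //; apply: measurable_funM; first by meas; exact: mt.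
    by apply: measurable_free => i; exact: mt.
  - apply: mE; apply: measurable_funM; first exact: measurable_cst.
    by do 2 (apply: measurable_funD => //).
  - by move=> t _; rewrite lee_fin.
under eq_integral do rewrite EFinM !EFinD.
rewrite ge0_integralZl//; last 3 first.
- by apply: emeasurable_funD; apply: emeasurable_funD; exact: mE.
- by move=> t _; rewrite -!EFinD lee_fin !addr_ge0.
- by rewrite lee_fin divr_ge0// ltW.
rewrite ge0_integralD//; last 4 first.
- by move=> t _; rewrite -!EFinD lee_fin !addr_ge0.
- by apply: emeasurable_funD; exact: mE.
- by move=> t _; rewrite -!EFinD lee_fin !addr_ge0.
- by apply: emeasurable_funD; exact: mE.
rewrite ge0_integralD//; [|by move=> t _; rewrite lee_fin|exact: mE|by move=> t _; rewrite lee_fin|exact: mE].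
rewrite ge0_integralD//; [|by move=> t _; rewrite lee_fin|exact: mE|by move=> t _; rewrite lee_fin|exact: mE].
rewrite (integral_tshift h (f := fun t => (P w x t)%:E)); [|exact: mE|by move=> t; rewrite lee_fin].
rewrite (integral_tshift (fun i => - h i) (f := fun t => (P w y t)%:E)); [|exact: mE|by move=> t; rewrite lee_fin].
have rs := @reduced_w_sym n w act k w_sym act_sym.
have r0 := @reduced_w_ge0 n w act k w0 k1.
apply: (@le_trans _ _ ((a / 4)%:E * ((1 + 1) + (1 + 1)))%E).
  rewrite lee_pmul2l ?lte_fin ?divr_gt0//.
  by apply: leeD; apply: leeD; exact: integral_pinned_le1.
by rewrite -!EFinD -EFinM lee_fin -/a; lra.
Qed.

End integrated.
End decay.

(** * The Green function after rescaling *)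

Section rescaled_density.
Context {R : realType}.
Local Notation tup n := (n.-tuple (measurableTypeR R)).
Local Notation Z := (Num.sqrt (2 * pi) : R).
Variables (n : nat) (w : 'I_n -> 'I_n -> R) (p : 'I_n -> R) (x y : 'I_n).
Hypotheses (w_sym : forall i j, w i j = w j i) (w0 : forall i j, 0 <= w i j).
Hypothesis w_conn : forall i j, connect (fun i j => 0 < w i j) i j.
Hypotheses (p0 : forall i, 0 <= p i) (px : 0 < p x) (py : 0 < p y).
Implicit Types (t : tup n) (s : R).

Definition green_of (eta : 'I_n -> R) t :=
  expR (tnth t x + tnth t y) * invmx (lap (edge_cond w t) (pin_cond eta t)) x y.

(** Up to the factor s ^- 2 the grounded Laplacian with pinning s p at t - ln s. *)
Definition pinned_lap s t := lap (edge_cond w t) (fun i => s ^+ 2 * pin_cond p t i).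

(** The determinant of pinned_lap divided by s ^ 2, in a form that is defined,
    and positive, at s = 0. *)
Definition root_sum s t := \sum_i pin_cond p t i * cofactor (pinned_lap s t) i x.

(** The integrand of s E[G_xy] after the translation t - ln s, in a form that
    makes sense at s = 0. *)
Definition rescaled s t :=
  expR (tnth t x + tnth t y) * (cofactor (pinned_lap s t) y x / Num.sqrt (root_sum s t)) *
  expR (- (\sum_i tnth t i) - edge_action w t -
    (\sum_i p i * (expR (tnth t i) + s ^+ 2 * expR (- tnth t i)) / 2 - s * \sum_i p i)) /
  Z ^+ n.

Lemma edge_cond_sym t i j : edge_cond w t i j = edge_cond w t j i.
Proof. by rewrite /edge_cond w_sym addrC. Qed.

Lemma edge_cond_connect t i j : connect (fun i j => 0 < edge_cond w t i j) i j.
Proof.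
rewrite (eq_connect (e' := fun i j => 0 < w i j))// => k l.
by rewrite /edge_cond pmulr_lgt0 ?expR_gt0.
Qed.

Lemma pin_ge0 s t i : 0 <= s ^+ 2 * pin_cond p t i.
Proof. by rewrite mulr_ge0 ?sqr_ge0// mulr_ge0 ?expR_ge0. Qed.

Lemma pin_gt0 s t v : 0 < p v -> 0 < s -> 0 < s ^+ 2 * pin_cond p t v.
Proof. by move=> pv s0; rewrite mulr_gt0 ?exprn_gt0// mulr_gt0 ?expR_gt0. Qed.

Lemma det_pinned_lap s t : \det (pinned_lap s t) = s ^+ 2 * root_sum s t.
Proof.
rewrite (det_lap_cofactor _ _ x) mulr_sumr; apply: eq_bigr => i _.
by rewrite mulrA.
Qed.

Lemma det_pinned_lap_gt0 s t : 0 < s -> 0 < \det (pinned_lap s t).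
Proof.
move=> s0; apply: (@det_lap_gt0 _ _ _ _ _ _ _ _ x).
- exact: edge_cond_sym.
- exact: edge_cond_ge0.
- exact: pin_ge0.
- exact: edge_cond_connect.
- exact: pin_gt0.
Qed.

Lemma root_sum_gt0 s t : 0 < s -> 0 < root_sum s t.
Proof.
move=> s0; have := det_pinned_lap_gt0 t s0; rewrite det_pinned_lap.
by rewrite pmulr_rgt0// exprn_gt0.
Qed.

Lemma invmx_pinned s t : 0 < s ->
  invmx (pinned_lap s t) x y = cofactor (pinned_lap s t) y x / (s ^+ 2 * root_sum s t).
Proof.
move=> s0; have d0 := det_pinned_lap_gt0 t s0.
rewrite /invmx unitmxE unitfE gt_eqF//= !mxE det_pinned_lap.
by rewrite mulrC.
Qed.

Lemma rescaled_E s t : 0 < s ->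
  s * (green_of (fun i => s * p i) (tshift (fun=> - ln s) t) *
       marginal w (fun i => s * p i) (tshift (fun=> - ln s) t)) = rescaled s t.
Proof.
move=> s0; have els : expR (- ln s) = s^-1 by rewrite expRN lnK.
have s00 : s != 0 by rewrite gt_eqF.
have z0 : Z != 0 by rewrite gt_eqF// sqrt2pi_gt0.
set t' := tshift _ t.
have et i : expR (tnth t' i) = s^-1 * expR (tnth t i).
  by rewrite tnth_tshift addrC expRD els.
have lapE : lap (edge_cond w t') (pin_cond (fun i => s * p i) t') =
    (s ^- 2) *: pinned_lap s t.
  apply/matrixP => i j; rewrite !mxE /lap_entry mulrBr mulrCA; congr (_ * _ - _).
    rewrite mulrDr mulr_sumr; congr (_ + _).
      by apply: eq_bigr => k _; rewrite /edge_cond !expRD !et -exprVn; ring.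
    by rewrite /pin_cond et; field.
  by rewrite /edge_cond !expRD !et -exprVn; ring.
rewrite /green_of expRD !et /marginal /lap_det lapE detZ.
have -> : invmx (s ^- 2 *: pinned_lap s t) = s ^+ 2 *: invmx (pinned_lap s t).
  rewrite invmxZ; first by rewrite invrK.
  rewrite unitmxE unitfE detZ mulf_neq0//.
    by rewrite expf_neq0// invr_neq0// expf_neq0.
  by rewrite gt_eqF// det_pinned_lap_gt0.
rewrite mxE invmx_pinned// det_pinned_lap edge_action_shift.
have -> : \sum_i tnth t' i = \sum_i tnth t i - ln s *+ n.
  under eq_bigr do rewrite tnth_tshift.
  by rewrite big_split /= sumr_const card_ord mulNrn.
have -> : pin_action (fun i => s * p i) t' =
   \sum_i p i * (expR (tnth t i) + s ^+ 2 * expR (- tnth t i)) / 2 - s * \sum_i p i.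
  rewrite /pin_action mulr_sumr -sumrB; apply: eq_bigr => i _.
  by rewrite /cosh (expRN (tnth t' i)) et invfM invrK -expRN; field.
rewrite /rescaled; set X := _ - s * _; set E := edge_action w t; set A := \sum_i _.
have -> : expR (- (A - ln s *+ n) - E - X) = s ^+ n * expR (- A - E - X).
  rewrite (_ : s ^+ n = expR (ln s *+ n)); last first.
    by rewrite -mulr_natl expRM_natl lnK.
  by rewrite -expRD; congr expR; lra.
have r0 := root_sum_gt0 t s0.
have -> : Num.sqrt ((s ^- 2) ^+ n * (s ^+ 2 * root_sum s t)) =
   (s / s ^+ n) * Num.sqrt (root_sum s t).
  rewrite mulrA (_ : _ * s ^+ 2 = (s / s ^+ n) ^+ 2); last first.
    by rewrite [(s / _) ^+ 2]exprMn exprVn mulrC exprAC exprVn.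
  rewrite sqrtrM ?sqr_ge0// sqrtr_sqr ger0_norm//.
  by rewrite divr_ge0 ?exprn_ge0// ltW.
rewrite -(sqr_sqrtr (ltW r0)) (_ : Num.sqrt (Num.sqrt _ ^+ 2) = Num.sqrt (root_sum s t)); last first.
  by rewrite sqr_sqrtr// ltW.
have q0 : Num.sqrt (root_sum s t) != 0 by rewrite gt_eqF// sqrtr_gt0.
rewrite expRD; move: (Num.sqrt _) (Num.sqrt _) q0 z0 => q z q0 z0.
by field; rewrite q0 s00 !expf_neq0.
Qed.

Lemma rescaled_ge0 s t : 0 < s -> 0 <= rescaled s t.
Proof.
move=> s0; rewrite -rescaled_E//; apply: mulr_ge0; first exact: ltW.
apply: mulr_ge0; last exact: marginal_ge0.
apply: mulr_ge0; first exact: expR_ge0.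
apply: (@invmx_lap_ge0 _ _ _ _ _ _ _ _ x).
- exact: edge_cond_sym.
- exact: edge_cond_ge0.
- by move=> i; rewrite !mulr_ge0 ?expR_ge0 ?(ltW s0).
- exact: edge_cond_connect.
- by rewrite !mulr_gt0 ?expR_gt0.
Qed.

Lemma measurable_pinned_lap_minor s (i j : 'I_n) :
  measurable_fun setT (fun t => cofactor (pinned_lap s t) i j).
Proof.
have mt k : measurable_fun setT (fun t : tup n => tnth t k : R) by exact: measurable_tnth.
rewrite /cofactor; apply: measurable_funM; first exact: measurable_cst.
apply: measurable_det => k l.
apply: (eq_measurable_fun (fun t => lap_entry (edge_cond w t)
   (fun i => s ^+ 2 * pin_cond p t i) (lift i k) (lift j l))).
  by move=> t _; rewrite !mxE.
by rewrite /lap_entry /edge_cond /pin_cond; meas.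
Qed.

Lemma measurable_rescaled s : measurable_fun setT (rescaled s).
Proof.
have mt k : measurable_fun setT (fun t : tup n => tnth t k : R) by exact: measurable_tnth.
rewrite /rescaled /edge_action.
apply: measurable_funM; last exact: measurable_cst.
apply: measurable_funM; last by meas.
apply: measurable_funM; first by meas.
apply: measurable_funM; first exact: measurable_pinned_lap_minor.
apply: measurable_inv_comp; apply: measurable_sqrt_comp.
rewrite /root_sum /pin_cond; apply: measurable_sum => i.
by apply: measurable_funM; [meas|exact: measurable_pinned_lap_minor].
Qed.

End rescaled_density.

(** * The pointwise limit *)

Section sequential_limits.
Context {R : realType}.

Lemma cvg_sum_seq (I : Type) (r : seq I) (f : I -> nat -> R) (l : I -> R) :
  (forall i, f i k @[k --> \oo] --> l i) ->
  \sum_(i <- r) f i k @[k --> \oo] --> \sum_(i <- r) l i.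
Proof.
move=> fl; elim: r => [|i r IH].
  by rewrite big_nil; under eq_cvg do rewrite big_nil; exact: cvg_cst.
rewrite big_cons; under eq_cvg do rewrite big_cons.
exact: (@cvgD _ R^o).
Qed.

Lemma cvg_prod_seq (I : Type) (r : seq I) (f : I -> nat -> R) (l : I -> R) :
  (forall i, f i k @[k --> \oo] --> l i) ->
  \prod_(i <- r) f i k @[k --> \oo] --> \prod_(i <- r) l i.
Proof.
move=> fl; elim: r => [|i r IH].
  by rewrite big_nil; under eq_cvg do rewrite big_nil; exact: cvg_cst.
by rewrite big_cons; under eq_cvg do rewrite big_cons; exact: cvgM.
Qed.

Lemma cvg_det_seq n (M : nat -> 'M[R]_n) (N : 'M[R]_n) :
  (forall i j, M k i j @[k --> \oo] --> N i j) ->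
  \det (M k) @[k --> \oo] --> \det N.
Proof.
move=> MN; rewrite /determinant; apply: cvg_sum_seq => s.
by apply: cvgM; [exact: cvg_cst|apply: cvg_prod_seq => i; exact: MN].
Qed.

Lemma cvg_expR_seq (f : nat -> R) l : f k @[k --> \oo] --> l ->
  expR (f k) @[k --> \oo] --> expR l.
Proof. by move=> fl; apply: (continuous_cvg _ (@continuous_expR R l)). Qed.

End sequential_limits.

Section rescaled_limit.
Context {R : realType}.
Local Notation tup n := (n.-tuple (measurableTypeR R)).
Variables (n : nat) (w : 'I_n -> 'I_n -> R) (p : 'I_n -> R) (x y : 'I_n).
Hypotheses (w_sym : forall i j, w i j = w j i) (w0 : forall i j, 0 <= w i j).
Hypothesis w_conn : forall i j, connect (fun i j => 0 < w i j) i j.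
Hypotheses (p0 : forall i, 0 <= p i) (px : 0 < p x).

Lemma kappa_gt0 (t : tup n) z : 0 < kappa (edge_cond w t) z.
Proof.
apply: (@det_lap_gt0 _ _ _ _ _ _ _ _ z).
- exact: edge_cond_sym.
- exact: edge_cond_ge0.
- exact: point_ge0.
- exact: edge_cond_connect.
- by rewrite /point eqxx.
Qed.

Definition total_pin (t : tup n) := \sum_i pin_cond p t i.

Lemma total_pin_gt0 t : 0 < total_pin t.
Proof.
rewrite /total_pin (bigD1 x)//= ltr_wpDr ?mulr_gt0 ?expR_gt0//.
by apply: sumr_ge0 => i _; rewrite mulr_ge0 ?expR_ge0.
Qed.

Lemma pinned_lap0 t : pinned_lap w p 0 t = lap (edge_cond w t) (fun=> 0).
Proof. by congr lap; apply/funext => i; rewrite expr2 mul0r mul0r. Qed.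

Lemma root_sum0 t : root_sum w p x 0 t = total_pin t * kappa (edge_cond w t) y.
Proof.
rewrite /root_sum /total_pin mulr_suml; apply: eq_bigr => i _; congr (_ * _).
by rewrite pinned_lap0; apply: cofactor_kappa; exact: edge_cond_sym.
Qed.

Lemma rescaled_cvg (u : nat -> R) t : u k @[k --> \oo] --> 0 ->
  rescaled w p x y (u k) t @[k --> \oo] --> rescaled w p x y 0 t.
Proof.
move=> u0.
have u2 : u k ^+ 2 @[k --> \oo] --> (0 : R) ^+ 2.
  exact: (continuous_cvg _ (@exprn_continuous R 2 0)).
have cof i j : cofactor (pinned_lap w p (u k) t) i j @[k --> \oo] -->
    cofactor (pinned_lap w p 0 t) i j.
  rewrite /cofactor; apply: cvgM; first exact: cvg_cst.
  apply: cvg_det_seq => a b.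
  under eq_cvg do rewrite !mxE.
  rewrite !mxE /lap_entry; apply: (@cvgB _ R^o); last exact: cvg_cst.
  apply: cvgM; first exact: cvg_cst.
  apply: (@cvgD _ R^o); first exact: cvg_cst.
  by apply: cvgM => //; exact: cvg_cst.
have rs : root_sum w p x (u k) t @[k --> \oo] --> root_sum w p x 0 t.
  by apply: cvg_sum_seq => i; apply: cvgM; [exact: cvg_cst|exact: cof].
rewrite /rescaled; apply: cvgM; last exact: cvg_cst.
apply: cvgM; first apply: cvgM; first exact: cvg_cst.
- apply: cvgM; first exact: cof.
  apply: cvgV.
    by rewrite gt_eqF// sqrtr_gt0 root_sum0 mulr_gt0 ?total_pin_gt0 ?kappa_gt0.
  exact: (continuous_cvg _ (@sqrt_continuous R _)).
- apply: cvg_expR_seq; apply: (@cvgB _ R^o); first exact: cvg_cst.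
  apply: (@cvgB _ R^o); last by apply: cvgM => //; exact: cvg_cst.
  apply: cvg_sum_seq => i; apply: cvgM; last exact: cvg_cst.
  apply: cvgM; first exact: cvg_cst.
  apply: (@cvgD _ R^o); first exact: cvg_cst.
  by apply: cvgM => //; exact: cvg_cst.
Qed.

(** At s = 0 all cofactors equal kappa: only the constant mode of the inverse
    Laplacian survives. *)
Lemma rescaled0_E t : rescaled w p x y 0 t =
  expR (tnth t x + tnth t y) / total_pin t *
  (Num.sqrt (total_pin t) * expR (- (total_pin t / 2))) * free w y t.
Proof.
have S0 := total_pin_gt0 t; have K0 := kappa_gt0 t y.
rewrite /rescaled root_sum0 pinned_lap0 (cofactor_kappa (edge_cond_sym w_sym t) y).
rewrite sqrtrM ?ltW// /free mul0r subr0.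
have -> : \sum_i p i * (expR (tnth t i) + 0 ^+ 2 * expR (- tnth t i)) / 2 = total_pin t / 2.
  rewrite /total_pin mulr_suml; apply: eq_bigr => i _.
  by rewrite expr2 !mul0r addr0 /pin_cond.
rewrite [expR (_ - total_pin t / 2)]expRD.
set e := expR (tnth t x + _).
have sS := sqr_sqrtr (ltW S0); have sK := sqr_sqrtr (ltW K0).
have sS0 : 0 < Num.sqrt (total_pin t) by rewrite sqrtr_gt0.
have sK0 : 0 < Num.sqrt (kappa (edge_cond w t) y) by rewrite sqrtr_gt0.
rewrite -{1}sK -[in RHS]sS; set a := Num.sqrt (total_pin t) in sS0 *.
have -> : Num.sqrt (a ^+ 2) = a by rewrite sqrtr_sqr ger0_norm// ltW.
set b := Num.sqrt (kappa _ _) in sK0 *.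
have z0 := @sqrt2pi_gt0 R.
rewrite (_ : - (total_pin t / 2) = - (a ^+ 2 / 2)); last by rewrite sS.
by field; rewrite expf_neq0 ?gt_eqF.
Qed.

End rescaled_limit.

(** * A dominating function *)

Section domination.
Context {R : realType}.
Local Notation tup n := (n.-tuple (measurableTypeR R)).
Local Notation Z := (Num.sqrt (2 * pi) : R).

Lemma half_exp_bound (q : R) : 0 < q ->
  exists2 C, 0 < C & forall u, expR (u / 2 - q * expR u / 2) <= C * expR (- (2^-1 * `|u|)).
Proof.
move=> q0; pose c : R := - 1 - ln (q / 2); exists (1 + expR c).
  by rewrite addr_gt0 ?expR_gt0.
move=> u; have [u0|u0] := leP 0 u.
  rewrite ger0_norm// mulrDl -expRD; apply: le_trans (_ : expR (c + - (2^-1 * u)) <= _).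
    rewrite ler_expR /c.
    have := expR_ge1Dx (u + ln (q / 2)); rewrite expRD lnK ?posrE ?divr_gt0//; lra.
  by rewrite lerDr mul1r expR_ge0.
rewrite ltr0_norm// mulrDl mul1r; apply: le_trans (_ : expR (- (2^-1 * - u)) <= _).
  rewrite ler_expR; have := mulr_ge0 (ltW q0) (expR_ge0 u); lra.
by rewrite lerDl mulr_ge0 ?expR_ge0.
Qed.

Lemma cosh_ge_linear (a K : R) : 0 < a -> 0 < K ->
  exists C, forall s, K * `|s| - C <= a * (cosh s - 1).
Proof.
move=> a0 K0; have q0 : 0 < 2 * K / a by rewrite divr_gt0 ?mulr_gt0.
exists (a - K * (1 - ln (2 * K / a))) => s.
wlog s0 : s / 0 <= s => [H|].
  have [/H//|/ltW s0] := leP 0 s.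
  by rewrite -coshN -normrN H// oppr_ge0.
rewrite ger0_norm// /cosh.
have := expR_ge1Dx (s - ln (2 * K / a)).
rewrite expRD [expR (- ln _)]expRN lnK// invf_div => /(ler_wpM2l (ltW K0)).
have -> : K * (expR s * (a / (2 * K))) = a * expR s / 2 by field; rewrite gt_eqF.
have := mulr_ge0 (ltW a0) (expR_ge0 (- s)); lra.
Qed.

Section bounds.
Variables (n : nat) (w : 'I_n -> 'I_n -> R) (p : 'I_n -> R) (x y : 'I_n).
Hypotheses (w_sym : forall i j, w i j = w j i) (w0 : forall i j, 0 <= w i j).
Hypothesis w_conn : forall i j, connect (fun i j => 0 < w i j) i j.
Hypotheses (p0 : forall i, 0 <= p i) (px : 0 < p x) (py : 0 < p y).
Implicit Types (t : tup n) (s : R).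

(** Bounds the oscillation of t, because two vertices are joined by a path with
    fewer than n edges. *)
Definition roughness t : R :=
  n%:R * \sum_i \sum_(j | 0 < w i j) `|tnth t i - tnth t j|.

Lemma roughness_ge0 t : 0 <= roughness t.
Proof. by rewrite mulr_ge0//; do 2 (apply: sumr_ge0 => ? _). Qed.

Lemma le_roughness t i j : `|tnth t i - tnth t j| <= roughness t.
Proof.
pose r := \sum_i \sum_(j | 0 < w i j) `|tnth t i - tnth t j|.
have edge a b : 0 < w a b -> `|tnth t a - tnth t b| <= r.
  move=> ab; rewrite /r (bigD1 a)//= (bigD1 b)//= -addrA lerDl addr_ge0//.
    by apply: sumr_ge0.
  by do 2 (apply: sumr_ge0 => ? _).
have /connectP[q0 + ->] := w_conn i j.
case/shortenP => q pq uq _.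
apply: (@le_trans _ _ ((size q)%:R * r)); last first.
  apply: ler_wpM2r; first by do 2 (apply: sumr_ge0 => ? _).
  rewrite ler_nat -[leqRHS](card_ord n).
  by apply: leq_trans (max_card (mem (i :: q))); rewrite (card_uniqP uq).
elim: q i pq {uq} => [|k q IH] i /=; first by rewrite subrr normr0 mul0r.
move=> /andP[ik kq].
rewrite -natr1 mulrDl mul1r; apply: le_trans (lerD (IH _ kq) (edge _ _ ik)).
by rewrite [leRHS]addrC; apply: le_trans (ler_normD _ _); rewrite addrA subrK.
Qed.

(** The hyperbolic cosine grows faster than any linear function. *)
Lemma edge_action_ge (K : R) : 0 < K ->
  exists C, forall t, K * roughness t - C <= edge_action w t.
Proof.
(* The factor 2 makes up for the halving in edge_action, and n + 1 exceeds the
   factor n of the roughness. *)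
move=> K0; pose K' := 2 * K * n.+1%:R.
have K'0 : 0 < K' by rewrite !mulr_gt0.
have H i j : exists C, forall s, 0 < w i j -> K' * `|s| - C <= w i j * (cosh s - 1).
  have [wij|wij] := ltP 0 (w i j); last by exists 0.
  by have [C CP] := cosh_ge_linear wij K'0; exists C => s _.
pose C i j := sval (cid (H i j)).
have CP i j s : 0 < w i j -> K' * `|s| - C i j <= w i j * (cosh s - 1).
  exact: (svalP (cid (H i j))).
exists ((\sum_i \sum_(j | 0 < w i j) C i j) / 2) => t.
rewrite /edge_action.
apply: (@le_trans _ _ ((\sum_i \sum_(j | 0 < w i j) (K' * `|tnth t i - tnth t j| - C i j)) / 2)).
  under [in leRHS]eq_bigr do rewrite sumrB -mulr_sumr.
  rewrite sumrB -mulr_sumr mulrBl lerB// /roughness.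
  set r := \sum_i _; have r0 : 0 <= r by do 2 (apply: sumr_ge0 => ? _).
  have -> : K' * r / 2 = K * (n%:R * r) + K * r by rewrite /K' -[n.+1%:R]natr1; field.
  by rewrite lerDl mulr_ge0// ltW.
rewrite ler_pM2r ?invr_gt0//; apply: ler_sum => i _.
rewrite [leRHS](bigID (fun j => 0 < w i j))/= ler_wpDr//.
  by apply: sumr_ge0 => j _; rewrite mulr_ge0// subr_ge0 cosh_ge1.
by apply: ler_sum => j wij; exact: CP.
Qed.

(** One plus a bound, relative to exp (2 t_k), for the absolute sum of row k of the
    Laplacian without pinning; the summand 1 makes room for the pinning. *)
Definition growth t k : R := 1 + 2 * \sum_l w k l * expR (tnth t l - tnth t k).

Lemma growth_ge1 t k : 1 <= growth t k.
Proof.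
by rewrite lerDl mulr_ge0//; apply: sumr_ge0 => l _; rewrite mulr_ge0 ?expR_ge0.
Qed.

Lemma pinned_lap_row s t k :
  \sum_l `|pinned_lap w p s t k l| <=
  expR (tnth t k) ^+ 2 * (growth t k * expR (s ^+ 2 * p k * expR (- tnth t k))).
Proof.
set v := s ^+ 2 * p k * expR (- tnth t k).
have v0 : 0 <= v by rewrite mulr_ge0 ?expR_ge0// mulr_ge0 ?sqr_ge0.
pose e i := s ^+ 2 * pin_cond p t i.
have e0 : 0 <= e k by rewrite mulr_ge0 ?sqr_ge0// mulr_ge0 ?expR_ge0.
have a0 := edge_cond_ge0 t w0.
apply: (@le_trans _ _ (2 * \sum_l edge_cond w t k l + e k)).
  apply: (@le_trans _ _ (\sum_l ((k == l)%:R * (\sum_j edge_cond w t k j + e k) + edge_cond w t k l))).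
    apply: ler_sum => l _; rewrite mxE /lap_entry.
    apply: le_trans (ler_normB _ _) _.
    by rewrite normrM normr_nat !ger0_norm// addr_ge0// sumr_ge0.
  rewrite big_split /= (bigD1 k)//= eqxx mul1r [X in _ + X + _]big1 ?addr0; last first.
    by move=> l lk; rewrite eq_sym (negPf lk) mul0r.
  lra.
have ek : expR (tnth t k) ^+ 2 * expR (- tnth t k) = expR (tnth t k).
  by rewrite expr2 -!expRD; congr expR; ring.
have -> : e k = expR (tnth t k) ^+ 2 * v.
  by rewrite /e /v /pin_cond -{1}ek; ring.
have -> : 2 * \sum_l edge_cond w t k l = expR (tnth t k) ^+ 2 * (growth t k - 1).
  rewrite /growth [1 + _]addrC addrK mulrCA; congr (_ * _).
  rewrite mulr_sumr; apply: eq_bigr => l _; rewrite /edge_cond mulrCA; congr (_ * _).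
  by rewrite expr2 -!expRD; congr expR; ring.
rewrite -mulrDr ler_wpM2l ?sqr_ge0//.
have := expR_ge1Dx v; have := growth_ge1 t k.
have := expR_ge0 v; nra.
Qed.

Definition spread t : R := (\sum_i p i * expR (- tnth t i)) * \prod_k growth t k.

(** Cofactors are bounded by products of row sums. The pinning enters the rows
    only through exp (s ^ 2 p_k exp (- t_k)), whose product is absorbed by the
    pin action. *)
Lemma root_sum_le s t :
  root_sum w p x s t <= expR (\sum_i tnth t i + (\sum_i s ^+ 2 * p i * expR (- tnth t i)) / 2) ^+ 2 * spread t.
Proof.
pose v k := s ^+ 2 * p k * expR (- tnth t k).
have v0 k : 0 <= v k by rewrite mulr_ge0 ?expR_ge0// mulr_ge0 ?sqr_ge0.
pose rho k := expR (tnth t k) ^+ 2 * (growth t k * expR (v k)).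
have g1 := growth_ge1 t.
have rho0 k : 0 <= rho k.
  by rewrite /rho mulr_ge0 ?sqr_ge0// mulr_ge0 ?expR_ge0// (le_trans ler01).
have -> : expR (\sum_i tnth t i + (\sum_i v i) / 2) ^+ 2 * spread t =
   \sum_i p i * expR (- tnth t i) * \prod_k rho k.
  rewrite -mulr_suml /spread mulrCA; congr (_ * _).
  rewrite /rho big_split [X in _ = _ * X]big_split /= prodrXl -!expR_sum [RHS]mulrCA mulrC.
  by congr (_ * _); rewrite !expr2 -!expRD; congr expR; lra.
apply: ler_sum => i _.
apply: (@le_trans _ _ (pin_cond p t i * \prod_(k | k != i) rho k)).
  apply: ler_wpM2l; first by rewrite mulr_ge0 ?expR_ge0.
  apply: le_trans (ler_norm _) _; apply: le_trans (cofactor_le_row_sums _ _ _) _.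
  apply: ler_prod => k _; rewrite sumr_ge0//=; exact: pinned_lap_row.
rewrite [in leRHS](bigD1 i)//= mulrA; apply: ler_wpM2r.
  by apply: prodr_ge0 => k _.
rewrite /pin_cond -mulrA; apply: ler_wpM2l => //.
rewrite /rho mulrA (_ : expR (- tnth t i) * _ = expR (tnth t i)); last first.
  by rewrite expr2 -!expRD; congr expR; ring.
rewrite -[leLHS]mulr1; apply: ler_wpM2l; first exact: expR_ge0.
have := expR_ge1Dx (v i); have := v0 i; have := g1 i; nra.
Qed.

(** By invmx_lap_le the entry of the inverse is at most 1 / (s ^ 2 p_y exp t_y),
    which leaves the square root of root_sum in the numerator. The terms in
    s ^ 2 exp (- t_i) and the factors exp t_i of root_sum_le cancel against the
    exponential. *)
Lemma rescaled_le s t : 0 < s -> s <= 1 ->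
  rescaled w p x y s t <=
  expR (\sum_i p i) / (p y * Z ^+ n) *
  (expR (tnth t x) * expR (- edge_action w t) * expR (- (total_pin p t / 2)) *
   Num.sqrt (spread t)).
Proof.
move=> s0 s1.
have r0 := root_sum_gt0 w_sym w0 w_conn p0 px t s0.
set A := \sum_i tnth t i; set V := \sum_i s ^+ 2 * p i * expR (- tnth t i).
have sq : Num.sqrt (root_sum w p x s t) <= expR (A + V / 2) * Num.sqrt (spread t).
  rewrite -[X in X * _](ger0_norm (expR_ge0 _)) -sqrtr_sqr -sqrtrM ?sqr_ge0//.
  by apply: ler_wsqrtr; exact: root_sum_le.
have inv_le : invmx (pinned_lap w p s t) x y * (s ^+ 2 * pin_cond p t y) <= 1.
  apply: (@invmx_lap_le _ _ _ (fun i => s ^+ 2 * pin_cond p t i) _ _ _ _ x).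
  - exact: edge_cond_sym.
  - exact: edge_cond_ge0.
  - exact: pin_ge0.
  - exact: edge_cond_connect.
  - exact: pin_gt0.
have z0 : 0 < Z ^+ n by rewrite exprn_gt0// sqrt2pi_gt0.
rewrite invmx_pinned// in inv_le.
set c := cofactor _ y x in inv_le; set r := root_sum w p x s t in r0 sq inv_le.
have sr0 : 0 < Num.sqrt r by rewrite sqrtr_gt0.
have cr : expR (tnth t y) * (c / Num.sqrt r) <= Num.sqrt r / p y.
  rewrite ler_pdivlMr//.
  have -> : expR (tnth t y) * (c / Num.sqrt r) * p y =
      Num.sqrt r * (c / (s ^+ 2 * r) * (s ^+ 2 * pin_cond p t y)).
    rewrite /pin_cond -[X in s ^+ 2 * X](sqr_sqrtr (ltW r0)); field.
    by rewrite !gt_eqF.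
  by rewrite -[leRHS]mulr1 ler_wpM2l// ltW.
rewrite /rescaled -/c -/r expRD.
have VE : \sum_i p i * (expR (tnth t i) + s ^+ 2 * expR (- tnth t i)) / 2 =
    total_pin p t / 2 + V / 2.
  rewrite -mulrDl /total_pin /V -big_split mulr_suml; apply: eq_bigr => i _ /=.
  by rewrite /pin_cond; ring.
rewrite VE; set P := \sum_i p i.
have P0 : 0 <= P by apply: sumr_ge0.
rewrite [leLHS](_ : _ = expR (tnth t x) * (expR (tnth t y) * (c / Num.sqrt r)) *
  expR (- A - edge_action w t - (total_pin p t / 2 + V / 2 - s * P)) / Z ^+ n); last by ring.
rewrite [leRHS](_ : _ = expR (tnth t x) * (expR (A + V / 2) * Num.sqrt (spread t) / p y) *
  expR (- A - edge_action w t - (total_pin p t / 2 + V / 2 - P)) / Z ^+ n); last first.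
  have e1 : expR (- A - edge_action w t - (total_pin p t / 2 + V / 2 - P)) =
    expR (- (A + V / 2)) * (expR (- edge_action w t) * expR (- (total_pin p t / 2)) * expR P).
    by rewrite -!expRD; congr expR; ring.
  rewrite e1 (expRN (A + V / 2)); field.
  by rewrite !gt_eqF// expR_gt0.
rewrite ler_pM2r ?invr_gt0//.
apply: (@le_trans _ _ (expR (tnth t x) * (expR (A + V / 2) * Num.sqrt (spread t) / p y) *
  expR (- A - edge_action w t - (total_pin p t / 2 + V / 2 - s * P)))).
  apply: ler_wpM2r; first exact: expR_ge0.
  apply: ler_wpM2l; first exact: expR_ge0.
  by apply: le_trans cr _; rewrite ler_pM2r ?invr_gt0.
apply: ler_wpM2l; last by rewrite ler_expR lerB// lerB// ler_piMl.
by rewrite mulr_ge0 ?expR_ge0// divr_ge0 ?mulr_ge0 ?expR_ge0 ?sqrtr_ge0// ltW.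
Qed.

End bounds.
End domination.

(** * The limit of the Green function *)

Section green_limit.
Context {R : realType}.
Local Notation mu := (@lebesgue_measure R).
Local Notation tup n := (n.-tuple (measurableTypeR R)).
Local Notation lebT n := (@lebesgue_tuple R n).
Local Notation Z := (Num.sqrt (2 * pi) : R).

(** The function sqrt S exp (- S / 2) of u = ln S. *)
Definition scale_profile (u : R) : R := expR (u / 2 - 1 * expR u / 2).

Lemma measurable_scale_profile : measurable_fun setT scale_profile.
Proof. by rewrite /scale_profile; meas. Qed.

Lemma scale_profile_finite : exists c : R, 0 <= c /\
  (\int[mu]_u (scale_profile u)%:E = c%:E)%E.
Proof.
have [C C0 CP] := @half_exp_bound R 1 ltr01.
have I0 : (0 <= \int[mu]_u (scale_profile u)%:E)%E.
  by apply: integral_ge0 => u _; rewrite lee_fin expR_ge0.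
have me : measurable_fun setT (fun u : R => (expR (- (2^-1 * `|u|)))%:E).
  by apply/measurable_EFinP; meas.
have I1 : (\int[mu]_u (scale_profile u)%:E <= (C * (2 / 2^-1))%:E)%E.
  apply: (@le_trans _ _ (\int[mu]_u (C%:E * (expR (- (2^-1 * `|u|)))%:E))%E).
    apply: ge0_le_integral => //.
    - by move=> u _; rewrite lee_fin expR_ge0.
    - by apply/measurable_EFinP; exact: measurable_scale_profile.
    - by apply: emeasurable_funM => //; exact: measurable_cst.
    - by move=> u _; rewrite -EFinM lee_fin; exact: CP.
  rewrite ge0_integralZl//; last by rewrite lee_fin ltW.
  rewrite [leRHS]EFinM; apply: lee_wpmul2l; first by rewrite lee_fin ltW.
  by apply: (@integral_expR_abs R (2^-1)); rewrite invr_gt0.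
move: (\int[mu]_u _)%E I0 I1 => [r| |] //; rewrite ?lee_fin => r0 _.
by exists r.
Qed.

Variables (n : nat) (w : 'I_n -> 'I_n -> R) (p : 'I_n -> R) (x y : 'I_n).
Hypotheses (w_sym : forall i j, w i j = w j i) (w0 : forall i j, 0 <= w i j).
Hypothesis w_conn : forall i j, connect (fun i j => 0 < w i j) i j.
Hypotheses (p0 : forall i, 0 <= p i) (px : 0 < p x) (py : 0 < p y).
Implicit Types (t : tup n) (s : R).

Definition envelope t : R := \prod_(i < n) expR (- ((2 * n%:R)^-1 * `|tnth t i|)).

Let n0 : 0 < n%:R :> R.
Proof. by rewrite ltr0n; case: x => m; exact: leq_trans. Qed.

(** Up to the factor exp (- t_x) all exponents in spread are differences of the
    t_i. *)
Lemma spread_le : exists2 C, 0 <= C & forall t,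
  Num.sqrt (spread w p t) <= C * expR ((- tnth t x + n.+1%:R * roughness w t) / 2).
Proof.
pose P := \sum_i p i; pose B := 1 + 2 * \sum_k \sum_l w k l.
have P0 : 0 <= P by apply: sumr_ge0.
have W0 : 0 <= \sum_k \sum_l w k l by do 2 (apply: sumr_ge0 => ? _).
have B0 : 0 <= B by rewrite addr_ge0// mulr_ge0.
exists (Num.sqrt (P * B ^+ n)); first exact: sqrtr_ge0.
move=> t; set T := roughness w t; have T0 : 0 <= T by exact: roughness_ge0.
have rT i j : tnth t i - tnth t j <= T.
  by apply: le_trans (ler_norm _) _; exact: le_roughness.
rewrite -(ger0_norm (expR_ge0 (_ / 2))) -sqrtr_sqr -sqrtrM; last first.
  by rewrite mulr_ge0// exprn_ge0.
apply: ler_wsqrtr.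
have -> : P * B ^+ n * expR ((- tnth t x + n.+1%:R * T) / 2) ^+ 2 =
    P * (expR (- tnth t x) * expR T) * \prod_(k < n) (B * expR T).
  rewrite prodr_const card_ord exprMn -!expRM_natl.
  rewrite (_ : P * B ^+ n * _ = P * B ^+ n * (expR (- tnth t x) * expR T * expR (n%:R * T))).
    by ring.
  by congr (_ * _); rewrite -!expRD; congr expR; rewrite -[n.+1%:R]natr1; lra.
apply: ler_pM.
- by apply: sumr_ge0 => i _; rewrite mulr_ge0 ?expR_ge0.
- by apply: prodr_ge0 => k _; apply: le_trans (growth_ge1 w0 t k); exact: ler01.
- rewrite mulr_suml; apply: ler_sum => i _; apply: ler_wpM2l => //.
  by rewrite -expRD ler_expR; have := rT x i; lra.
- apply: ler_prod => k _; apply/andP; split.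
    by apply: le_trans (growth_ge1 w0 t k); exact: ler01.
  have eT : 1 <= expR T by rewrite -[leLHS]expR0 ler_expR.
  rewrite /B mulrDl mul1r; apply: lerD => //.
  rewrite -mulrA; apply: ler_wpM2l => //.
  apply: (@le_trans _ _ ((\sum_l w k l) * expR T)).
    rewrite mulr_suml; apply: ler_sum => l _; apply: ler_wpM2l => //.
    by rewrite ler_expR.
  apply: ler_wpM2r; first exact: expR_ge0.
  rewrite [leRHS](bigD1 k)//= lerDl; apply: sumr_ge0 => m _; exact: sumr_ge0.
Qed.

(** The edge action controls the differences of the t_i through the roughness,
    and the pinning at x controls t_x. *)
Lemma rescaled_dominated : exists2 C, 0 <= C & forall s t, 0 < s -> s <= 1 ->
  rescaled w p x y s t <= C * envelope t.
Proof.
have [C1 C10 H1] := spread_le.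
have [C2 C20 H2] := half_exp_bound px.
have [C3 H3] := edge_action_ge w0 (ltr0Sn R n).
pose C0 := expR (\sum_i p i) / (p y * Z ^+ n).
have C00 : 0 <= C0.
  by rewrite divr_ge0 ?expR_ge0// mulr_ge0 ?exprn_ge0 ?sqrtr_ge0// ltW.
exists (C0 * (expR C3 * C1 * C2)).
  apply: mulr_ge0 => //; apply: mulr_ge0; last exact: ltW.
  by apply: mulr_ge0 => //; exact: expR_ge0.
move=> s t s0 s1; apply: le_trans (rescaled_le w_sym w0 w_conn p0 px py t s0 s1) _.
rewrite -/C0 -[leRHS]mulrA; apply: ler_wpM2l => //.
set T := roughness w t; have T0 : 0 <= T by exact: roughness_ge0.
have hact : expR (- edge_action w t) <= expR C3 * expR (- (n.+1%:R * T)).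
  by rewrite -expRD ler_expR; have := H3 t; rewrite -/T; lra.
have hpin : expR (- (total_pin p t / 2)) <= expR (- (p x * expR (tnth t x) / 2)).
  rewrite ler_expR lerN2 ler_pM2r ?invr_gt0// /total_pin (bigD1 x)//= lerDl.
  by apply: sumr_ge0 => i _; rewrite mulr_ge0 ?expR_ge0.
apply: (@le_trans _ _ (expR (tnth t x) * (expR C3 * expR (- (n.+1%:R * T))) *
   expR (- (p x * expR (tnth t x) / 2)) *
   (C1 * expR ((- tnth t x + n.+1%:R * T) / 2)))).
  apply: ler_pM => //; rewrite ?mulr_ge0 ?expR_ge0 ?sqrtr_ge0//.
  apply: ler_pM => //; rewrite ?mulr_ge0 ?expR_ge0//.
  by apply: ler_wpM2l => //; exact: expR_ge0.
have -> : expR (tnth t x) * (expR C3 * expR (- (n.+1%:R * T))) *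
   expR (- (p x * expR (tnth t x) / 2)) *
   (C1 * expR ((- tnth t x + n.+1%:R * T) / 2)) =
   expR C3 * C1 * (expR (tnth t x / 2 - p x * expR (tnth t x) / 2) *
     expR (- (n.+1%:R * T / 2))).
  rewrite -[RHS]mulrA [LHS](_ : _ = expR C3 * (C1 * (expR (tnth t x) * expR (- (n.+1%:R * T)) *
    expR (- (p x * expR (tnth t x) / 2)) * expR ((- tnth t x + n.+1%:R * T) / 2)))).
    by congr (_ * (_ * _)); rewrite -!expRD; congr expR; lra.
  by ring.
rewrite -[leRHS]mulrA; apply: ler_wpM2l; first by rewrite mulr_ge0 ?expR_ge0.
apply: (@le_trans _ _ (C2 * expR (- (2^-1 * `|tnth t x|)) * expR (- (n.+1%:R * T / 2)))).
  by apply: ler_wpM2r; [exact: expR_ge0|exact: H2].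
rewrite -mulrA; apply: ler_wpM2l; first exact: ltW.
rewrite -expRD /envelope -expR_sum ler_expR sumrN -mulr_sumr.
have : \sum_i `|tnth t i| <= n%:R * (`|tnth t x| + T).
  apply: (@le_trans _ _ (\sum_(i < n) (`|tnth t x| + T))); last first.
    by rewrite sumr_const card_ord mulr_natl.
  apply: ler_sum => i _; rewrite -{1}(subrK (tnth t x) (tnth t i)) addrC.
  by apply: le_trans (ler_normD _ _) _; apply: lerD => //; exact: le_roughness.
have g0 : 0 < (2 * n%:R : R)^-1 by rewrite invr_gt0 mulr_gt0.
move=> /(ler_wpM2l (ltW g0)).
have -> : (2 * n%:R)^-1 * (n%:R * (`|tnth t x| + T)) = (`|tnth t x| + T) / 2.
  by field; rewrite gt_eqF.
have : T <= n.+1%:R * T by rewrite ler_peMl// ler1n.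
by lra.
Qed.

Lemma measurable_envelope : measurable_fun setT envelope.
Proof.
have mt k : measurable_fun setT (fun t : tup n => tnth t k : R) by exact: measurable_tnth.
rewrite /envelope; apply: measurable_prod => i _; meas.
Qed.

Lemma envelope_ge0 t : 0 <= envelope t.
Proof. by apply: prodr_ge0 => i _; exact: expR_ge0. Qed.

Lemma integrable_envelope C : 0 <= C -> (lebT n).-integrable setT (fun t => (C * envelope t)%:E).
Proof.
move=> C0.
have mE : measurable_fun setT (fun t => (envelope t)%:E).
  by apply/measurable_EFinP; exact: measurable_envelope.
apply/integrableP; split.
  by apply/measurable_EFinP; apply: measurable_funM; [exact: measurable_cst|exact: measurable_envelope].
under eq_integral do rewrite abse_EFin ger0_norm ?mulr_ge0 ?envelope_ge0// EFinM.
rewrite ge0_integralZl//; last by move=> t _; rewrite lee_fin envelope_ge0.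
rewrite (integral_lebesgue_tuple_prodr n (g := fun u => expR (- ((2 * n%:R)^-1 * `|u|)))); last 2 first.
- by meas.
- by move=> u; exact: expR_ge0.
rewrite lte_mul_pinfty ?lee_fin//.
suff : (\prod_(i < n) \int[mu]_u (expR (- ((2 * n%:R)^-1 * `|u|)))%:E)%E \is a fin_num.
  by rewrite fin_numElt => /andP[].
apply: (big_ind (fun z : \bar R => z \is a fin_num)) => // [a b|i _]; first exact: fin_numM.
rewrite ge0_fin_numE; last by apply: integral_ge0 => u _; rewrite lee_fin expR_ge0.
apply: le_lt_trans (integral_expR_abs _) (ltry _).
by rewrite invr_gt0 mulr_gt0.
Qed.

Lemma rescaled0_gt0 t : 0 < rescaled w p x y 0 t.
Proof.
have S0 := total_pin_gt0 p0 px t.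
rewrite (rescaled0_E y w_sym w0 w_conn p0 px) /free.
have K0 := kappa_gt0 w_sym w0 w_conn t y.
apply: mulr_gt0; first apply: mulr_gt0.
- by rewrite divr_gt0 ?expR_gt0.
- by rewrite mulr_gt0 ?expR_gt0 ?sqrtr_gt0.
- by rewrite divr_gt0 ?exprn_gt0 ?sqrt2pi_gt0// mulr_gt0 ?expR_gt0 ?sqrtr_gt0.
Qed.

Definition green_integral s : \bar R :=
  (\int[lebT n]_t (green_of w x y (fun i => s * p i)%R t *
    marginal w (fun i => s * p i)%R t)%:E)%E.

Lemma green_integral_rescaled s : 0 < s ->
  (s%:E * green_integral s = \int[lebT n]_t (rescaled w p x y s t)%:E)%E.
Proof.
move=> s0.
have ms := measurable_rescaled w p x y s.
have E t : green_of w x y (fun i => s * p i) t * marginal w (fun i => s * p i) t =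
    s^-1 * rescaled w p x y s (tshift (fun=> ln s) t).
  have <- := rescaled_E y w_sym w0 w_conn p0 px (tshift (fun=> ln s) t) s0.
  rewrite mulKf; last by rewrite gt_eqF.
  rewrite (_ : tshift _ (tshift _ t) = t)//.
  by apply: eq_from_tnth => i; rewrite !tnth_tshift addrK.
rewrite /green_integral; under eq_integral do rewrite E EFinM.
have mE : measurable_fun setT (fun t => (rescaled w p x y s t)%:E) by exact/measurable_EFinP.
have rp t : (0 <= (rescaled w p x y s t)%:E)%E.
  by rewrite lee_fin (rescaled_ge0 y w_sym w0 w_conn p0 px).
have si : 0 <= s^-1 by rewrite invr_ge0 ltW.
rewrite (integral_tshiftZ (fun=> ln s) mE rp si).
by rewrite muleA -EFinM divff ?gt_eqF// mul1e.
Qed.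

(** Dominated convergence along sequences that decrease to 0. The limit is
    positive because its integrand is positive at every point. *)
Lemma green_integral_cvg : exists l : R, [/\
  (s%:E * green_integral s)%E @[s --> 0^'+] --> l%:E,
  (\int[lebT n]_t (rescaled w p x y 0 t)%:E = l%:E)%E & 0 < l].
Proof.
have [C C0 CP] := rescaled_dominated.
have dct (u : nat -> R) : (forall k, 0 < u k) -> (forall k, u k <= 1) ->
    u k @[k --> \oo] --> 0 ->
    (lebT n).-integrable setT (fun t => (rescaled w p x y 0 t)%:E) /\
    (\int[lebT n]_t (rescaled w p x y (u k) t)%:E)%E @[k --> \oo] -->
    (\int[lebT n]_t (rescaled w p x y 0 t)%:E)%E.
  move=> u0 u1 ul.
  have [] := @dominated_convergence _ _ R (lebT n) setT measurableT
    (fun k t => (rescaled w p x y (u k) t)%:E) (fun t => (rescaled w p x y 0 t)%:E)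
    (fun t => (C * envelope t)%:E).
  - by move=> k; apply/measurable_EFinP; exact: measurable_rescaled.
  - by apply/measurable_EFinP; exact: measurable_rescaled.
  - apply: aeW => t _; apply: cvg_EFin; first by near=> k.
    exact: (rescaled_cvg w_sym w0 w_conn p0 px ul).
  - exact: integrable_envelope.
  - apply: aeW => t k _ /=.
    rewrite lee_fin ger0_norm; first exact: CP.
    exact: (rescaled_ge0 y w_sym w0 w_conn p0 px).
  by move=> ? _ ?.
have inv0 : (k.+1%:R^-1 : R) @[k --> \oo] --> 0.
  exact: (@cvg_harmonic R).
have i0 k : 0 < k.+1%:R^-1 :> R by rewrite invr_gt0.
have i1 k : k.+1%:R^-1 <= 1 :> R by rewrite invf_le1// ler1n.
have [intg0 _] := dct _ i0 i1 inv0.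
have fin0 := integrable_fin_num measurableT intg0.
exists (fine (\int[lebT n]_t (rescaled w p x y 0 t)%:E)%E); split.
- apply/cvge_at_rightP => u [u0 ul].
  have [N _ NP] : \forall k \near \oo, u k <= 1.
    by apply: (cvgr_le 0 ul); exact: ltr01.
  have E : (fun k => (u (k + N)%N)%:E * green_integral (u (k + N)%N))%E =
     (fun k => \int[lebT n]_t (rescaled w p x y (u (k + N)%N) t)%:E)%E.
    by apply/funext => k; exact: green_integral_rescaled.
  rewrite fineK// -(cvg_shiftn N) E.
  apply: (dct (fun k => u (k + N)%N) _ _ _).2 => //.
  + by move=> k; apply: NP; rewrite /= leq_addl.
  + by rewrite (cvg_shiftn N).
- by rewrite fineK.
have I0 : (0 <= \int[lebT n]_t (rescaled w p x y 0 t)%:E)%E.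
  by apply: integral_ge0 => t _; rewrite lee_fin ltW// rescaled0_gt0.
apply: fine_gt0; apply/andP; split; last by move: fin0; rewrite fin_numElt => /andP[].
rewrite lt_neqAle I0 andbT eq_sym; apply/negP => /eqP int0.
have m0 : measurable_fun setT (fun t => (rescaled w p x y 0 t)%:E).
  by apply/measurable_EFinP; exact: measurable_rescaled.
have [+ _] := ae_eq_integral_abs (lebT n) measurableT m0.
have -> : (\int[lebT n]_t `|(rescaled w p x y 0 t)%:E| = 0)%E.
  rewrite -int0; apply: eq_integral => t _.
  by rewrite gee0_abs// lee_fin ltW// rescaled0_gt0.
move=> /(_ erefl)[N [mN N0 NP]].
have NT : N = setT.
  apply/seteqP; split => // t _; apply: NP => /= /(_ I) [].
  by move/eqP; rewrite gt_eqF// rescaled0_gt0.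
pose box := [set t : tup n | forall i, [set` `[0%R, 1%R]] (tnth t i)].
have boxE : (lebT n box = 1)%E.
  rewrite (@lebesgue_tuple_box R n (fun=> [set` `[0%R, 1%R]]))//.
  by rewrite big1// => i _; rewrite lebesgue_measure_itv/= lte_fin ltr01 -EFinB subr0.
have mbox : measurable box.
  rewrite [X in measurable X](_ : _ = \bigcap_(i in [set: 'I_n])
     ((fun t : tup n => tnth t i) @^-1` [set` `[0%R, 1%R]])).
    apply: fin_bigcap_measurable => // i _.
    by rewrite -[X in measurable X]setTI; exact: measurable_tnth.
  by apply/seteqP; split => [t At i _|t At i]; exact: At.
have : (lebT n box <= lebT n N)%E by apply: le_measure; rewrite ?inE// NT.
by rewrite boxE N0 lee_fin ler10.
Unshelve. all: by end_near. Qed.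

End green_limit.

(** * The limit in terms of the unpinned weight *)

Section limit_bound.
Context {R : realType}.
Local Notation mu := (@lebesgue_measure R).
Local Notation tup n := (n.-tuple (measurableTypeR R)).
Local Notation lebT n := (@lebesgue_tuple R n).
Local Notation Z := (Num.sqrt (2 * pi) : R).
Variables (n : nat) (w : 'I_n -> 'I_n -> R) (p : 'I_n -> R) (x y : 'I_n).
Hypotheses (w_sym : forall i j, w i j = w j i) (w0 : forall i j, 0 <= w i j).
Hypothesis w_conn : forall i j, connect (fun i j => 0 < w i j) i j.
Hypotheses (p0 : forall i, 0 <= p i) (px : 0 < p x) (py : 0 < p y) (xy : x != y).

(** The only factor of rescaled0_le in which the pinning enters. *)
Definition pin_profile (t : tup n) : R :=
  Num.sqrt (total_pin p t) * expR (- (total_pin p t / 2)).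

Lemma total_pin_shift (t : tup n) u :
  total_pin p (tshift (fun=> u) t) = expR u * total_pin p t.
Proof.
rewrite /total_pin mulr_sumr; apply: eq_bigr => i _.
by rewrite /pin_cond tnth_tshift expRD; ring.
Qed.

Lemma pin_profile_shift (t : tup n) u :
  pin_profile (tshift (fun=> u) t) = scale_profile (u + ln (total_pin p t)).
Proof.
have S0 := total_pin_gt0 p0 px t.
rewrite /pin_profile /scale_profile total_pin_shift.
have -> : expR u * total_pin p t = expR (u + ln (total_pin p t)) by rewrite expRD lnK.
move: (u + ln _) => v.
have -> : Num.sqrt (expR v) = expR (v / 2).
  rewrite (_ : expR v = expR (v / 2) ^+ 2); last by rewrite expr2 -expRD; congr expR; lra.
  by rewrite sqrtr_sqr ger0_norm// expR_ge0.
by rewrite -expRD mul1r.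
Qed.

Lemma measurable_pin_profile : measurable_fun setT pin_profile.
Proof.
have mt k : measurable_fun setT (fun t : tup n => tnth t k : R) by exact: measurable_tnth.
by rewrite /pin_profile /total_pin /pin_cond; meas.
Qed.

(** By the inequality of arithmetic and geometric means the terms x and y of
    total_pin add up to at least 2 min (p_x, p_y) exp ((t_x + t_y) / 2). *)
Lemma rescaled0_le (t : tup n) : rescaled w p x y 0 t <=
  (Num.min (p x) (p y))^-1 / 2 *
  (expR ((tnth t x + tnth t y) / 2) * free w y t * pin_profile t).
Proof.
have S0 := total_pin_gt0 p0 px t.
set m := Num.min (p x) (p y); have m0 : 0 < m by rewrite lt_min px py.
rewrite (rescaled0_E y w_sym w0 w_conn p0 px) -/(pin_profile t).
set b := expR ((tnth t x + tnth t y) / 2).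
have b0 : 0 < b by exact: expR_gt0.
have -> : expR (tnth t x + tnth t y) = b ^+ 2.
  by rewrite /b expr2 -expRD; congr expR; lra.
have SB : 2 * m * b <= total_pin p t.
  apply: (@le_trans _ _ (m * expR (tnth t x) + m * expR (tnth t y))); last first.
    rewrite /total_pin (bigD1 x)//= (bigD1 y) 1?eq_sym//= addrA.
    rewrite ler_wpDr//; first by apply: sumr_ge0 => i _; rewrite mulr_ge0 ?expR_ge0.
    by rewrite lerD// ler_wpM2r ?expR_ge0// ge_min lexx ?orbT.
  rewrite -mulrDr mulrAC mulrC ler_wpM2l ?(ltW m0)//.
  have ex : expR (tnth t x) = expR (tnth t x / 2) ^+ 2 by rewrite expr2 -expRD; congr expR; lra.
  have ey : expR (tnth t y) = expR (tnth t y / 2) ^+ 2 by rewrite expr2 -expRD; congr expR; lra.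
  have -> : b = expR (tnth t x / 2) * expR (tnth t y / 2).
    by rewrite /b -expRD; congr expR; lra.
  rewrite ex ey; have := sqr_ge0 (expR (tnth t x / 2) - expR (tnth t y / 2)).
  by rewrite sqrrB; lra.
have q0 : 0 <= pin_profile t by rewrite mulr_ge0 ?sqrtr_ge0 ?expR_ge0.
have f0 : 0 <= free w y t by exact: free_ge0.
rewrite [leLHS](_ : _ = (b ^+ 2 / total_pin p t) * (free w y t * pin_profile t)); last by ring.
rewrite [leRHS](_ : _ = (m^-1 / 2 * b) * (free w y t * pin_profile t)); last by ring.
apply: ler_wpM2r; first by rewrite mulr_ge0.
rewrite ler_pdivrMr// expr2.
have -> : m^-1 / 2 * b * total_pin p t = b * ((2 * m)^-1 * total_pin p t).
  by field; rewrite gt_eqF.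
by rewrite ler_pM2l// mulrC ler_pdivlMr ?mulr_gt0// mulrC.
Qed.

(** Both pin_profile and cutoff have a constant integral along the diagonal
    translations, under which the other factors are invariant. *)
Lemma limit_le (c D l : R) : 0 <= c ->
  (\int[mu]_u (scale_profile u)%:E = c%:E)%E ->
  (\int[lebT n]_t (expR ((tnth t x + tnth t y) / 2) * free w y t *
     cutoff (tnth t y))%:E <= D%:E)%E ->
  (\int[lebT n]_t (rescaled w p x y 0 t)%:E = l%:E)%E ->
  l <= c / (2 * Z) * (Num.min (p x) (p y))^-1 * D.
Proof.
move=> c0 cE DE lE.
set m := Num.min (p x) (p y); have m0 : 0 < m by rewrite lt_min px py.
have z0 := @sqrt2pi_gt0 R.
have mt i : measurable_fun setT (fun t : tup n => tnth t i : R) by exact: measurable_tnth.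
pose F (t : tup n) := expR ((tnth t x + tnth t y) / 2) * free w y t.
have mF : measurable_fun setT F.
  apply: measurable_funM; first by meas.
  by apply: measurable_free => i; exact: mt.
have F0 t : 0 <= F t by rewrite mulr_ge0 ?expR_ge0 ?free_ge0.
have pp0 t : 0 <= pin_profile t by rewrite mulr_ge0 ?sqrtr_ge0 ?expR_ge0.
have mcut : measurable_fun setT (fun t : tup n => cutoff (tnth t y)).
  exact: (measurableT_comp measurable_cutoff (mt y)).
have Fs t u : F (tshift (fun=> u) t) = F t.
  rewrite /F !tnth_tshift free_shift// mulrA -expRD; congr (expR _ * _); lra.
have I1 (t : tup n) : (\int[mu]_u (pin_profile (tshift (fun=> u) t))%:E = c%:E)%E.
  under eq_integral do rewrite pin_profile_shift.
  rewrite (ge0_integral_shift (ln (total_pin p t)) (f := fun u => (scale_profile u)%:E))//.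
    by apply/measurable_EFinP; exact: measurable_scale_profile.
  by move=> u; rewrite lee_fin expR_ge0.
have I2 (t : tup n) : (\int[mu]_u (cutoff (tnth (tshift (fun=> u) t) y))%:E = Z%:E)%E.
  under eq_integral do rewrite tnth_tshift addrC.
  rewrite (ge0_integral_shift (tnth t y) (f := fun u => (cutoff u)%:E)).
  - exact: integral_cutoff.
  - by apply/measurable_EFinP; exact: measurable_cutoff.
  - by move=> u; rewrite lee_fin expR_ge0.
have EX := @integral_exchange R n F pin_profile (fun t => cutoff (tnth t y)) c Z
  mF F0 Fs measurable_pin_profile pp0 mcut (fun t => expR_ge0 _) I1 I2 c0 (ltW z0).
have JE : (Z%:E * \int[lebT n]_t (F t * pin_profile t)%:E <= (c * D)%:E)%E.
  by rewrite EX EFinM lee_wpmul2l// lee_fin.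
have mFp : measurable_fun setT (fun t => (F t * pin_profile t)%:E).
  by apply/measurable_EFinP; apply: measurable_funM => //; exact: measurable_pin_profile.
have lI : (l%:E <= (m^-1 / 2)%:E * \int[lebT n]_t (F t * pin_profile t)%:E)%E.
  rewrite -lE -ge0_integralZl//; last 2 first.
  - by move=> t _; rewrite lee_fin mulr_ge0.
  - by rewrite lee_fin divr_ge0// invr_ge0 ltW.
  apply: ge0_le_integral => //.
  - by move=> t _; rewrite lee_fin ltW// rescaled0_gt0.
  - by apply/measurable_EFinP; exact: measurable_rescaled.
  - by apply: emeasurable_funM => //; exact: measurable_cst.
  - by move=> t _; rewrite -EFinM lee_fin; exact: rescaled0_le.
have J0 : (0 <= \int[lebT n]_t (F t * pin_profile t)%:E)%E.
  by apply: integral_ge0 => t _; rewrite lee_fin mulr_ge0.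
move: (\int[lebT n]_t (F t * pin_profile t)%:E)%E J0 JE lI => [r| |] //=.
- rewrite -!EFinM !lee_fin => _ h1 h2; apply: le_trans h2 _.
  rewrite [leRHS](_ : _ = m^-1 / 2 * (c * D / Z)); last by field; rewrite !gt_eqF.
  apply: ler_wpM2l; first by rewrite divr_ge0// invr_ge0 ltW.
  by rewrite ler_pdivlMr// mulrC.
- by rewrite gt0_muley ?lte_fin// leye_eq.
Qed.

End limit_bound.

(** * Integrating out s and the spanning tree *)

Lemma sum_enum_val (R : nmodType) (V : finType) (F : V -> R) :
  \sum_v F v = \sum_(i < #|V|) F (enum_val i).
Proof. by rewrite (reindex (@enum_val V V))//; exact/onW_bij/enum_val_bij. Qed.

Lemma sum_unordered (R : numFieldType) (W : finType) (r : rel W) (g : W -> W -> R) :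
    symmetric r -> irreflexive r -> (forall i j, g i j = g j i) ->
  \sum_(p : W * W | (enum_rank p.1 < enum_rank p.2)%N && r p.1 p.2) g p.1 p.2 =
  (\sum_i \sum_j if r i j then g i j else 0) / 2.
Proof.
move=> rC r0 gC; pose G i j := if r i j then g i j else 0.
have GC i j : G i j = G j i by rewrite /G rC gC.
rewrite [X in _ = X / _](_ : _ = \sum_i \sum_j G i j)// pair_big/=.
rewrite [X in _ = X / _](bigID (fun p : W * W => enum_rank p.1 < enum_rank p.2)%N)/=.
have -> : \sum_(p : W * W | (enum_rank p.1 < enum_rank p.2)%N && r p.1 p.2) g p.1 p.2 =
    \sum_(p : W * W | (enum_rank p.1 < enum_rank p.2)%N) G p.1 p.2.
  by rewrite big_mkcondr.
have -> : \sum_(p : W * W | ~~ (enum_rank p.1 < enum_rank p.2)%N) G p.1 p.2 =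
    \sum_(p : W * W | (enum_rank p.1 < enum_rank p.2)%N) G p.1 p.2.
  rewrite [RHS](reindex_inj (h := fun p => (p.2, p.1)))/=; last by move=> [a b] [c d] [-> ->].
  rewrite (bigID (fun p : W * W => p.1 == p.2))/= big1 ?add0r; last first.
    by move=> [i j] /= /andP[_ /eqP ->]; rewrite /G r0.
  apply: eq_big => [[i j]|[i j] _] /=; last exact: GC.
  rewrite -leqNgt leq_eqVlt andb_orl.
  case: (eqVneq i j) => [->|ij]; first by rewrite ltnn !andbF.
  by rewrite !andbT; case: eqP => [/val_inj/enum_rank_inj/esym/eqP|//]; rewrite (negbTE ij).
by rewrite -mulr2n -[X in _ = X / _]mulr_natr mulfK// pnatr_eq0.
Qed.

Section h22_marginal.
Context {R : realType} (V : finType).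
Local Notation tup n := (n.-tuple (measurableTypeR R)).
Local Notation lebT n := (@lebesgue_tuple R n).
Variables (adj : rel V) (beta : V -> V -> R) (eps : V -> R).
Hypotheses (adj_sym : symmetric adj) (adj_irr : irreflexive adj).
Hypothesis adj_conn : forall u v, connect adj u v.
Hypothesis beta_sym : forall u v, beta u v = beta v u.
Hypothesis beta_gt0 : forall u v, adj u v -> 0 < beta u v.
Hypothesis eps0 : forall v, 0 <= eps v.
Variable o : V.
Hypothesis eps_o : 0 < eps o.
Local Notation n := #|V|.
Implicit Types t s : tup n.

Definition wt (i j : 'I_n) : R :=
  if adj (enum_val i) (enum_val j) then beta (enum_val i) (enum_val j) else 0.

Definition pin (i : 'I_n) : R := eps (enum_val i).

Lemma wt_sym i j : wt i j = wt j i.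
Proof. by rewrite /wt adj_sym beta_sym. Qed.

Lemma wt_ge0 i j : 0 <= wt i j.
Proof. by rewrite /wt; case: ifP => // /beta_gt0/ltW. Qed.

Lemma wt_conn i j : connect (fun i j => 0 < wt i j) i j.
Proof.
rewrite -(enum_valK i) -(enum_valK j).
have /connectP[q qp ->] := adj_conn (enum_val i) (enum_val j).
elim: q (enum_val i) qp => [|a q IH] v //= /andP[va qp].
apply: connect_trans (IH _ qp); apply: connect1.
by rewrite /wt !enum_rankK va beta_gt0.
Qed.

Definition lap_at t : 'M[R]_n := lap (edge_cond wt t) (pin_cond pin t).

Lemma laplacian_eps_hat t : laplacian adj beta t + eps_hat eps t = lap_at t.
Proof.
apply/matrixP => a b; rewrite !mxE /lap_entry /edge_cond /pin_cond /pin /wt /Defs.coord.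
rewrite (inj_eq enum_val_inj).
case: (eqVneq a b) => [<-|ab]; last first.
  rewrite mulr0n addr0 mul0r sub0r; case: ifP => _; last by rewrite mul0r oppr0.
  by rewrite !enum_valK.
rewrite adj_irr mul0r subr0 mul1r mulr1n; rewrite enum_valK; congr (_ + _).
rewrite big_mkcond sum_enum_val; apply: eq_bigr => k _.
rewrite adj_sym beta_sym enum_valK addrC; case: ifP => // _; exact/esym/mul0r.
Qed.

Lemma lap_at_edge_sym t i j : edge_cond wt t i j = edge_cond wt t j i.
Proof. by rewrite edge_cond_sym// => *; exact: wt_sym. Qed.

Lemma lap_at_pin_ge0 t i : 0 <= pin_cond pin t i.
Proof. by rewrite mulr_ge0 ?expR_ge0// eps0. Qed.

Lemma lap_at_pin_gt0 t : 0 < pin_cond pin t (enum_rank o).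
Proof. by rewrite mulr_gt0 ?expR_gt0// /pin enum_rankK. Qed.

Let ec0 t i j : 0 <= edge_cond wt t i j.
Proof. by apply: edge_cond_ge0; exact: wt_ge0. Qed.

Let ecc t i j : connect (fun i j => 0 < edge_cond wt t i j) i j.
Proof. by apply: edge_cond_connect; exact: wt_conn. Qed.

Lemma lap_at_qform t s : qform (lap_at t) (tnth s) =
  (\sum_i \sum_j edge_cond wt t i j * (tnth s i - tnth s j) ^+ 2) / 2 +
  \sum_i pin_cond pin t i * tnth s i ^+ 2.
Proof.
pose u : 'cV[R]_n := \col_i tnth s i; have uE i : u i 0 = tnth s i by rewrite mxE.
transitivity (\sum_i u i 0 * (lap_at t *m u) i 0).
  apply: eq_bigr => i _; rewrite uE [(_ *m _) i 0]mxE; congr (_ * _).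
  by apply: eq_bigr => j _; rewrite uE.
rewrite (lap_form (pin_cond pin t) (lap_at_edge_sym t)); congr (_ / _ + _).
  by apply: eq_bigr => i _; apply: eq_bigr => j _; rewrite !uE expr2.
by apply: eq_bigr => i _; rewrite uE expr2.
Qed.

Lemma lap_at_sym t : (lap_at t)^T = lap_at t.
Proof. exact: (lap_tr (lap_at_edge_sym t)). Qed.

Lemma integral_s_gaussian t :
  (\int[lebT n]_s (expR (- (qform (lap_at t) (tnth s) / 2)))%:E =
   (Num.sqrt (2 * pi) ^+ n / Num.sqrt (\det (lap_at t)))%:E)%E.
Proof.
apply: integral_gaussian; first exact: lap_at_sym.
move=> v [i vi].
pose u : 'cV[R]_n := \col_i v i; have uE k : u k 0 = v k by rewrite mxE.
have u0 : u != 0 by apply: contra_neq vi => /matrixP/(_ i 0); rewrite uE mxE.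
have := lap_posdef (lap_at_edge_sym t) (ec0 t) (lap_at_pin_ge0 t) (ecc t)
  (lap_at_pin_gt0 t) u0.
rewrite (_ : \sum_(i < _) _ = qform (lap_at t) v)//.
apply: eq_bigr => k _; rewrite uE [(_ *m _) k 0]mxE; congr (_ * _).
by apply: eq_bigr => j _; rewrite uE.
Qed.

(** The cosh part of B yields the two actions; the s part is the quadratic form
    of the grounded Laplacian, by summation by parts. *)
Lemma edge_factor t s :
  edge_prod (edges (rho_adj adj))
    (fun i j => expR (- rho_weight beta eps i j * (Bfun t s i j - 1))) =
  expR (- edge_action wt t - pin_action pin t) * expR (- (qform (lap_at t) (tnth s) / 2)).
Proof.
pose g i j := rho_weight beta eps i j * (Bfun t s i j - 1).
have gC i j : g i j = g j i.
  have BC : Bfun t s i j = Bfun t s j i.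
    rewrite /Bfun -coshN opprB (addrC (rho_coord t i) (rho_coord t j)); congr (_ + _ * _ / _).
    by rewrite -sqrrN opprB.
  rewrite /g BC; congr (_ * _).
  by case: i j BC => [i|] [j|] //= _; exact: beta_sym.
have rC := rho_adj_sym adj_sym; have rI := rho_adj_irr adj_irr.
transitivity (expR (- ((\sum_i \sum_j if rho_adj adj i j then g i j else 0) / 2))).
  rewrite -(sum_unordered rC rI gC) -sumrN expR_sum /edge_prod.
  apply: eq_big => [p|p _]; first by rewrite (edge_rel_edges rC).
  by rewrite mulNr.
rewrite -expRD lap_at_qform; congr expR.
rewrite sum_option/= sum_option/= add0r.
under [X in _ + X]eq_bigr do rewrite sum_option/=.
rewrite big_split/=.
have -> : \sum_v g None (Some v) = \sum_v g (Some v) None by apply: eq_bigr.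
have -> : \sum_v g (Some v) None = pin_action pin t +
    (\sum_i pin_cond pin t i * tnth s i ^+ 2) / 2.
  rewrite sum_enum_val /pin_action mulr_suml -big_split/=; apply: eq_bigr => i _.
  rewrite /g /Bfun /= /Defs.coord !enum_valK !subr0 addr0 /pin_cond /pin; ring.
have -> : \sum_u \sum_v (if adj u v then g (Some u) (Some v) else 0) =
    2 * edge_action wt t +
    (\sum_i \sum_j edge_cond wt t i j * (tnth s i - tnth s j) ^+ 2) / 2.
  rewrite /edge_action mulrCA divff ?mulr1 ?pnatr_eq0// mulr_suml.
  rewrite sum_enum_val -big_split/=; apply: eq_bigr => i _.
  rewrite mulr_suml sum_enum_val -big_split/=; apply: eq_bigr => j _.
  rewrite /g /Bfun /= /Defs.coord !enum_valK /edge_cond /wt.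
  by case: ifP => _; [ring|rewrite !mul0r addr0].
by field.
Qed.

Lemma tree_factor t :
  \sum_(T : edge_set (option V) | `[< spanning_tree (rho_adj adj) T >])
    edge_prod T (fun i j => rho_weight beta eps i j * expR (rho_coord t i + rho_coord t j)) =
  \det (lap_at t).
Proof.
rewrite (sum_spanning_trees adj_sym adj_irr); last first.
  move=> i j; rewrite (addrC (rho_coord t i)); congr (_ * _).
  by case: i j => [i|] [j|] //=; exact: beta_sym.
rewrite -(@det_lap_entry_forest R V n (@enum_val V V)); last exact: enum_val_bij.
congr (\det _); apply/matrixP => i j; rewrite !mxE /lap_entry (inj_eq enum_val_inj).
rewrite /edge_cond /pin_cond /pin /wt /= /Defs.coord addr0.
congr (_ * _ - _).
  rewrite sum_enum_val enum_valK; congr (_ + _); apply: eq_bigr => k _.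
  by rewrite !enum_valK; case: ifP => // _; rewrite mul0r.
by rewrite !enum_valK; case: ifP => // _; rewrite mul0r.
Qed.

Let det_gt0 t : 0 < \det (lap_at t).
Proof.
exact: (det_lap_gt0 (lap_at_edge_sym t) (ec0 t) (lap_at_pin_ge0 t) (ecc t)
  (lap_at_pin_gt0 t)).
Qed.

Lemma site_factor t :
  \prod_(j : V) (expR (- Defs.coord t j) / (2 * pi)) =
  expR (- \sum_i tnth t i) / (2 * pi) ^+ n.
Proof.
rewrite (reindex (@enum_val V V))/=; last exact/onW_bij/enum_val_bij.
rewrite big_split/= -expR_sum sumrN prodr_const card_ord exprVn.
by congr (expR (- _) * _); apply: eq_bigr => i _; rewrite /Defs.coord enum_valK.
Qed.

Lemma sum_h22_density t s :
  \sum_(T : edge_set (option V) | `[< spanning_tree (rho_adj adj) T >])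
    Num.max (h22_density adj beta eps (t, s, T)) 0 =
  expR (- (\sum_i tnth t i) - edge_action wt t - pin_action pin t) *
  \det (lap_at t) / (2 * pi) ^+ n * expR (- (qform (lap_at t) (tnth s) / 2)).
Proof.
under eq_bigr => T /asboolP sT.
  rewrite max_l; last first.
    by apply: h22_density_ge0 => // i j /beta_gt0/ltW.
  rewrite /h22_density site_factor edge_factor.
  over.
rewrite -mulr_sumr tree_factor -[in RHS]addrA [in RHS]expRD; ring.
Qed.

(** By Tonelli's theorem: the sum over the trees is a determinant and the
    s-integral is the inverse square root of the same determinant. *)
Lemma integral_h22 (F : tup n -> R) : measurable_fun setT F -> (forall t, 0 <= F t) ->
  (\int[h22_measure adj beta eps]_z (F z.1.1)%:E =
   \int[lebT n]_t (F t * marginal wt pin t)%:E)%E.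
Proof.
move=> mF F0.
pose D (z : config (R := R) V * config (R := R) V * edge_set (option V)) : R :=
  Num.max (h22_density adj beta eps z) 0.
have D0 z : 0 <= D z by rewrite le_max lexx orbT.
have mD : measurable_fun setT D.
  by apply: measurable_maxr; [exact: measurable_h22_density|exact: measurable_cst].
have mF1 : measurable_fun setT
    (fun z : config (R := R) V * config (R := R) V * edge_set (option V) => (F z.1.1)%:E).
  apply/measurable_EFinP; apply: (measurableT_comp mF).
  exact: measurableT_comp.
rewrite (@ge0_integral_density _ _ _ (h22_reference adj) _ D) => //; last first.
  by move=> z; rewrite lee_fin.
pose G (z : config (R := R) V * config (R := R) V * edge_set (option V)) : \bar R :=
  ((F z.1.1)%:E * (D z)%:E)%E.
have mG : measurable_fun setT G.
  by apply: emeasurable_funM => //; exact/measurable_EFinP.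
have G0 z : (0 <= G z)%E by rewrite mule_ge0 ?lee_fin.
transitivity (\int[(lebT n \x lebT n) \x spanning_tree_counting (rho_adj adj)]_z G z)%E.
  by apply: eq_measure_integral => A _ _.
rewrite integral_product3//.
apply: eq_integral => t _; rewrite /=.
pose K := F t * (expR (- (\sum_i tnth t i) - edge_action wt t - pin_action pin t) *
  \det (lap_at t) / (2 * pi) ^+ n).
have K0 : 0 <= K.
  by rewrite mulr_ge0// divr_ge0 ?exprn_ge0 ?mulr_ge0 ?pi_ge0 ?expR_ge0// ltW// det_gt0.
transitivity (\int[lebT n]_s (K%:E * (expR (- (qform (lap_at t) (tnth s) / 2)))%:E))%E.
  apply: eq_integral => s _.
  have E := @integral_spanning_trees R (option V) (rho_adj adj)
    (fun T => F t * D (t, s, T)) (fun T => mulr_ge0 (F0 t) (D0 _)).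
  rewrite /G /=; under eq_integral do rewrite -EFinM.
  by rewrite E -mulr_sumr sum_h22_density mulrA EFinM.
rewrite ge0_integralZl//; last first.
  apply/measurable_EFinP; rewrite /qform; meas.
rewrite integral_s_gaussian -EFinM; congr EFin.
rewrite /K /marginal /lap_det -/(lap_at t).
have Z0 : 0 < Num.sqrt (2 * pi) :> R by exact: sqrt2pi_gt0.
have ZE : Num.sqrt (2 * pi) ^+ 2 = 2 * pi :> R by rewrite sqr_sqrtr// mulr_ge0// pi_ge0.
have S0 : 0 < Num.sqrt (\det (lap_at t)) by rewrite sqrtr_gt0.
have Zn0 : 0 < Num.sqrt (2 * pi) ^+ n :> R by rewrite exprn_gt0.
have -> : (2 * pi) ^+ n = (Num.sqrt (2 * pi) ^+ n) ^+ 2 :> R by rewrite -exprM mulnC exprM ZE.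
rewrite -{1}(sqr_sqrtr (ltW (det_gt0 t))).
by field; rewrite !gt_eqF.
Qed.

Lemma measurable_green_of x y : measurable_fun setT (green_of wt x y pin).
Proof.
have mM i j : measurable_fun setT
    (fun t => lap_entry (edge_cond wt t) (pin_cond pin t) i j).
  by rewrite /lap_entry /edge_cond /pin_cond; meas.
apply: (eq_measurable_fun (fun t => expR (tnth t x + tnth t y) *
    (cofactor (lap_at t) y x / \det (lap_at t)))).
  move=> t _; have uM : lap_at t \in unitmx by rewrite unitmxE unitfE gt_eqF.
  rewrite /green_of -/(lap_at t) /invmx uM; congr (_ * _).
  by rewrite [in RHS]mxE [X in _ = _ * X]mxE mulrC.
apply: measurable_funM; first by meas.
apply: measurable_funM.
  rewrite /cofactor; apply: measurable_funM; first exact: measurable_cst.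
  apply: measurable_det => i j; apply: eq_measurable_fun (mM (lift y i) (lift x j)).
  by move=> t _; rewrite !mxE.
apply: measurable_inv_comp; apply: measurable_det => i j.
by apply: eq_measurable_fun (mM i j) => t _; rewrite mxE.
Qed.

Lemma integral_green x y :
  (\int[h22_measure adj beta eps]_z (green adj beta eps z.1.1 x y)%:E =
   \int[lebT n]_t (green_of wt (enum_rank x) (enum_rank y) pin t *
     marginal wt pin t)%:E)%E.
Proof.
have E t : green adj beta eps t x y = green_of wt (enum_rank x) (enum_rank y) pin t.
  by rewrite /green laplacian_eps_hat.
under eq_integral do rewrite E.
apply: integral_h22; first exact: measurable_green_of.
move=> t; rewrite mulr_ge0 ?expR_ge0//.
exact: (invmx_lap_ge0 (lap_at_edge_sym t) (ec0 t) (lap_at_pin_ge0 t) (ecc t)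
  (lap_at_pin_gt0 t)).
Qed.

End h22_marginal.

(** * Geometry of the finite ladder *)

Section box_geometry.
Context {R : realType} (V0 : finType) (e0 : rel V0).
Hypotheses (e0_sym : symmetric e0) (e0_irr : irreflexive e0).
Hypothesis e0_conn : forall v w, connect e0 v w.
Variable beta : int * V0 -> int * V0 -> R.
Hypothesis beta_weights : ladder_weights e0 beta.
Variables Ll Lr : nat.
Local Notation box := (box V0 Ll Lr).
Local Notation adj := (box_adj e0 (Ll := Ll) (Lr := Lr)).
Local Notation b := (box_weight beta (Ll := Ll) (Lr := Lr)).
Implicit Types u v : box.

Lemma box_adjE u v : adj u v =
  [|| (u.1 == v.1) && e0 u.2 v.2, (v.1 == u.1.+1 :> nat) && (u.2 == v.2) |
      (u.1 == v.1.+1 :> nat) && (u.2 == v.2)].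
Proof.
have shift (i j : nat) : (j%:Z - Ll%:Z == i%:Z - Ll%:Z + 1) = (j == i.+1).
  by rewrite -addrA (addrC (- _)) addrA (inj_eq (addIr _)) -PoszD addn1.
by rewrite /box_adj /ladder_adj /box_vertex /= !shift (inj_eq (addIr _)).
Qed.

Lemma box_adj_sym : symmetric adj.
Proof.
move=> u v; rewrite !box_adjE (eq_sym v.1) e0_sym (eq_sym v.2).
by congr (_ || _); rewrite orbC.
Qed.

Lemma box_adj_irr : irreflexive adj.
Proof. by move=> u; rewrite box_adjE e0_irr andbF !ltn_eqF. Qed.

Lemma box_adj_conn u v : connect adj u v.
Proof.
have cC : connect_sym adj by apply: sym_connect_sym; exact: box_adj_sym.
have vert i a c : connect adj (i, a) (i, c).
  have /connectP[q qp ->] := e0_conn a c.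
  elim: q a qp => [|a' q IH] a //= /andP[aa' qp].
  by apply: connect_trans (IH _ qp); apply: connect1; rewrite box_adjE eqxx aa'.
have horiz (k : nat) (i : 'I_(Ll + Lr).+1) a : i = k :> nat -> connect adj (i, a) (ord0, a).
  elim: k i => [|k IH] i ik; first by rewrite (_ : i = ord0)//; exact: val_inj.
  have kL : (k < (Ll + Lr).+1)%N by rewrite ltnW// -ik.
  apply: connect_trans (IH (Ordinal kL) erefl); apply: connect1.
  by rewrite box_adjE /= ik !eqxx !orbT.
case: u v => [i a] [j c]; apply: connect_trans (horiz _ _ _ erefl) _.
apply: connect_trans (vert _ a c) _; rewrite cC; exact: horiz.
Qed.

Lemma box_weight_sym u v : b u v = b v u.
Proof. exact: ladder_weight_sym beta_weights _ _. Qed.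

Lemma box_weight_gt0 u v : adj u v -> 0 < b u v.
Proof. exact: (ladder_weight_gt0 beta_weights). Qed.

Definition rung_weight : R := \sum_v beta (0, v) (1, v).

Lemma rung_gt0 (a : V0) : 0 < beta (0, a) (1, a).
Proof. by apply: (ladder_weight_gt0 beta_weights); rewrite /ladder_adj /= eqxx. Qed.

Lemma rung_weight_ge0 : 0 <= rung_weight.
Proof. by apply: sumr_ge0 => v _; exact/ltW/rung_gt0. Qed.

Lemma horizontal_weight_le u v : adj u v -> u.1 != v.1 -> b u v <= rung_weight.
Proof.
have le1 a : beta (0, a) (1, a) <= rung_weight.
  rewrite /rung_weight (bigD1 a)//= lerDl; apply: sumr_ge0 => c _.
  exact/ltW/rung_gt0.
have h u' v' : v'.1 = u'.1.+1 :> nat -> u'.2 = v'.2 -> b u' v' <= rung_weight.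
  case: u' v' => [i a] [j c] /= ij <-.
  rewrite /box_weight /box_vertex /= ij -(addn1 i) PoszD addrAC.
  by rewrite (ladder_weight_horizontal beta_weights).
rewrite box_adjE => /or3P[/andP[/eqP ->]|/andP[/eqP ? /eqP ?] _|/andP[/eqP ? /eqP ?] _].
- by rewrite eqxx.
- exact: h.
- by rewrite box_weight_sym; exact: h.
Qed.

Variables x y : box.

Local Notation N := (hdist (box_vertex x) (box_vertex y)).

(** The horizontal distance from the slice of y, measured towards the slice of x
    and capped there. *)
Definition ramp v : nat :=
  if (y.1 <= x.1)%N then minn (v.1 - y.1) (x.1 - y.1) else minn (y.1 - v.1) (y.1 - x.1).

Lemma hdist_box : N = if (y.1 <= x.1)%N then (x.1 - y.1)%N else (y.1 - x.1)%N.
Proof. rewrite /hdist /box_vertex /=; case: leqP; lia. Qed.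

Lemma ramp_y : ramp y = 0%N.
Proof. by rewrite /ramp subnn !min0n; case: ifP. Qed.

Lemma ramp_x : ramp x = N.
Proof. by rewrite /ramp hdist_box; case: ifP => _; rewrite minnn. Qed.

Lemma ramp_le v : (ramp v <= N)%N.
Proof. by rewrite /ramp hdist_box; case: ifP => _; exact: geq_minr. Qed.

Definition active u v := adj u v && (ramp u != ramp v).

Lemma active_sym : symmetric active.
Proof. by move=> u v; rewrite /active box_adj_sym eq_sym. Qed.

Lemma active_horizontal u v : active u v -> u.2 = v.2 /\
  ((v.1 = u.1.+1 :> nat) \/ (u.1 = v.1.+1 :> nat)).
Proof.
case/andP; rewrite box_adjE => /or3P[/andP[/eqP e _]|/andP[/eqP ? /eqP ?] _|/andP[/eqP ? /eqP ?] _].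
- by rewrite /ramp e eqxx.
- by split=> //; left.
- by split=> //; right.
Qed.

Lemma active_ramp u v : active u v -> ramp v = (ramp u).+1 \/ ramp u = (ramp v).+1.
Proof.
move=> uv; have [_ c] := active_horizontal uv; case/andP: uv => _.
rewrite /ramp; case: leqP => _; lia.
Qed.

(** Across an active pair the ramp is not capped, so it determines the slice. *)
Lemma active_col u v : active u v ->
  if (y.1 <= x.1)%N then u.1 = (y.1 + ramp u)%N :> nat else (u.1 + ramp u)%N = y.1.
Proof.
move=> uv; have [_ c] := active_horizontal uv; case/andP: uv => _.
rewrite /ramp; move: (nat_of_ord u.1) (nat_of_ord v.1) (nat_of_ord x.1) (nat_of_ord y.1) c.
by move=> i j k l c; case: leqP => _; lia.
Qed.

(** The value of the ramp at the first vertex, the direction and the component in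
    V_0 determine an active pair. *)
Lemma card_active : (#|[pred q : box * box | active q.1 q.2]| <= N.+1 * 2 * #|V0|)%N.
Proof.
(* The bool tells in which direction the ramp increases. *)
pose g (q : box * box) : 'I_N.+1 * bool * V0 :=
  (inord (ramp q.1), (ramp q.1 < ramp q.2)%N, q.1.2).
rewrite -(card_in_image (f := g)); last first.
  move=> [u v] [u' v']; rewrite !inE /= => uv uv' [].
  move=> /(congr1 val); rewrite /= !inordK ?ltnS ?ramp_le// => e1 e2 e3.
  have [s c] := active_horizontal uv; have [s' c'] := active_horizontal uv'.
  have r := active_ramp uv; have r' := active_ramp uv'.
  have [eu ev] : u.1 = u'.1 :> nat /\ v.1 = v'.1 :> nat.
    have vu : active v u by rewrite active_sym.
    have vu' : active v' u' by rewrite active_sym.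
    move: (active_col uv) (active_col uv') (active_col vu) (active_col vu').
    by case: ifP => _; clear -r r' e1 e2; lia.
  case: u v u' v' eu ev e3 s s' {uv uv' c c' r r' e1 e2} => [i a] [j c] [i' a'] [j' c'] /=.
  by move=> /val_inj -> /val_inj -> -> -> ->.
by apply: leq_trans (max_card _) _; rewrite !card_prod card_ord card_bool.
Qed.

End box_geometry.

(** * Exponential decay along the ladder *)

Lemma cosh_sub1_le (R : realType) (x : R) : 0 <= x -> x <= 2^-1 -> cosh x - 1 <= x ^+ 2.
Proof.
move=> x0 x1; rewrite /cosh expRN.
have E1 := expR_ge1Dx x; have := expR_ge1Dx (- x); rewrite expRN.
have E0 := expR_gt0 x; move: (expR x) E0 E1 => E E0 E1 E2.
have EV : E * E^-1 = 1 by rewrite divff// gt_eqF.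
have := ler_wpM2l (ltW E0) E2; rewrite EV => E3.
have E4 : E <= 2.
  have : E * 2^-1 <= E * (1 - x) by apply: ler_wpM2l; [exact: ltW|lra].
  by move: E3; lra.
have E5 : E - 1 <= E * x by lra.
have -> : (E + E^-1) / 2 - 1 = (E - 1) ^+ 2 / E / 2 by field; rewrite gt_eqF.
rewrite ler_pdivrMr// ler_pdivrMr//.
apply: (@le_trans _ _ ((E * x) ^+ 2)); first by rewrite lerXn2r ?nnegrE//; nra.
rewrite exprMn [_ * 2 * E](_ : _ = E * 2 * x ^+ 2); last by ring.
by apply: ler_wpM2r; [exact: sqr_ge0|rewrite expr2; apply: ler_wpM2l; [exact: ltW|]].
Qed.

Section box_decay.
Context {R : realType} (V0 : finType) (e0 : rel V0).
Hypothesis e0_sym : symmetric e0.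
Variable beta : int * V0 -> int * V0 -> R.
Hypothesis beta_weights : ladder_weights e0 beta.

(** Per slice, an upper bound for the weight and the number of active pairs. *)
Definition slice_budget : R := (rung_weight beta + 2) * #|V0|%:R.

(** The slope of the ramp. The gain is linear and the cost quadratic in the
    slope; for this value the cost is at most half of the gain, up to a
    constant. *)
Definition decay_rate : R := (4 * slice_budget + 2)^-1.

Lemma slice_budget_ge0 : 0 <= slice_budget.
Proof. by rewrite mulr_ge0// addr_ge0// (rung_weight_ge0 beta_weights). Qed.

Lemma decay_rate_gt0 : 0 < decay_rate.
Proof. by rewrite invr_gt0; have := slice_budget_ge0; lra. Qed.

Lemma decay_rate_le_half : decay_rate <= 2^-1.
Proof. by rewrite lef_pV2 ?posrE//; have := slice_budget_ge0; lra. Qed.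

Lemma decay_rate_budget : decay_rate * slice_budget <= 4^-1.
Proof.
rewrite /decay_rate mulrC ler_pdivrMr; have := slice_budget_ge0; lra.
Qed.

Variables (Ll Lr : nat) (x y : box V0 Ll Lr).
Local Notation box := (box V0 Ll Lr).
Local Notation adj := (box_adj e0 (Ll := Ll) (Lr := Lr)).
Local Notation b := (box_weight beta (Ll := Ll) (Lr := Lr)).
Local Notation n := #|box|.
Local Notation N := (hdist (box_vertex x) (box_vertex y)).
Local Notation w := (wt adj b).

Let act : rel 'I_n := fun i j => active e0 x y (enum_val i) (enum_val j).
Let h (i : 'I_n) : R := decay_rate * (ramp x y (enum_val i))%:R.

Lemma active_count_le : (active_count act <= N.+1 * 2 * #|V0|)%N.
Proof.
apply: leq_trans (card_active e0_sym x y); rewrite /active_count.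
pose f (q : 'I_n * 'I_n) := (enum_val q.1, enum_val q.2).
have fI : injective f by move=> [i j] [i' j'] [/enum_val_inj -> /enum_val_inj ->].
rewrite -(card_imset _ fI); apply/subset_leq_card/fintype.subsetP => q.
by move=> /finset.imsetP[p]; rewrite finset.inE => pa ->.
Qed.

Let adjC := box_adj_sym e0_sym (Ll := Ll) (Lr := Lr).
Let bC := box_weight_sym beta_weights (Ll := Ll) (Lr := Lr).
Let bP := box_weight_gt0 beta_weights (Ll := Ll) (Lr := Lr).

Lemma active_weight_le :
  active_weight w act <= rung_weight beta * (active_count act)%:R / 2.
Proof.
rewrite /active_weight ler_pM2r//.
have -> : (active_count act)%:R = \sum_i \sum_j (act i j)%:R :> R.
  rewrite /active_count -sum1_card big_mkcond natr_sum pair_big/=.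
  by apply: eq_bigr => q _; rewrite finset.inE; case: act.
rewrite mulr_sumr; apply: ler_sum => i _; rewrite mulr_sumr; apply: ler_sum => j _.
case E : (act i j); last by rewrite !mulr0.
rewrite !mulr1 /wt; case/andP: (E) => -> r.
apply: (horizontal_weight_le beta_weights); first by case/andP: E.
by apply: contraNneq r => e; rewrite /ramp e.
Qed.

Lemma box_decay :
  (\int[@lebesgue_tuple R n]_t
     (expR ((tnth t (enum_rank x) + tnth t (enum_rank y)) / 2) *
      free w (enum_rank y) t * cutoff (tnth t (enum_rank y)))%:E <=
   (expR (decay_rate / 8) * expR (- (decay_rate / 8) * N%:R))%:E)%E.
Proof.
have d0 := decay_rate_gt0; have d1 := decay_rate_le_half; have dM := decay_rate_budget.
pose k := cosh decay_rate - 1.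
have k0 : 0 <= k by rewrite subr_ge0 cosh_ge1.
have k1 : k <= decay_rate ^+ 2 by apply: cosh_sub1_le => //; exact: ltW.
have B0 := rung_weight_ge0 beta_weights.
have w0 i j : 0 <= w i j by exact: wt_ge0 bP i j.
apply: le_trans (@free_decay R n (enum_rank x) (enum_rank y) w act h k
  (k * (active_weight w act + (active_count act)%:R)) _ _ _ k0 _ _ _ _) _ => //.
- exact: wt_sym adjC bC.
- by move=> i j; rewrite /act active_sym.
- by apply: (le_trans k1); nra.
- by rewrite /h enum_rankK ramp_y mulr0.
- move=> i j; rewrite mulrCA /wt; case: ifP => A; last by rewrite !mul0r.
  apply: ler_wpM2l; first by apply/ltW/bP.
  case E : (act i j).
    rewrite mulr1 (_ : cosh (h i - h j) = cosh decay_rate)//.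
    have /active_ramp[|] := E; rewrite /h => ->; rewrite -mulrBr -natr1.
      by rewrite opprD addNKr mulrN1 coshN.
    by rewrite addrAC subrr add0r mulr1.
  rewrite mulr0 /h; move/negbT: E; rewrite /act /active A /= negbK => /eqP ->.
  by rewrite subrr cosh0 subrr.
rewrite lee_fin -expRD ler_expR /h enum_rankK ramp_x -/k.
have N0 : 0 <= N%:R :> R by [].
have cN : (active_count act)%:R <= (N%:R + 1) * 2 * #|V0|%:R :> R.
  by rewrite natr1 -!natrM ler_nat active_count_le.
have aw := active_weight_le.
have m0 : 0 <= (active_count act)%:R :> R by [].
have bound : k * (active_weight w act + (active_count act)%:R) <=
    decay_rate * (N%:R + 1) / 4.
  have S1 : active_weight w act + (active_count act)%:R <= slice_budget * (N%:R + 1).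
    rewrite /slice_budget; nra.
  have S0 := slice_budget_ge0.
  have T0 : 0 <= slice_budget * (N%:R + 1) by rewrite mulr_ge0// addr_ge0.
  apply: (@le_trans _ _ (decay_rate ^+ 2 * (slice_budget * (N%:R + 1)))).
    apply: ler_pM => //.
    rewrite addr_ge0// divr_ge0//; apply: sumr_ge0 => i _; apply: sumr_ge0 => j _.
    by rewrite mulr_ge0.
  rewrite (_ : _ * _ = decay_rate * (N%:R + 1) * (decay_rate * slice_budget)); last by ring.
  by apply: ler_wpM2l => //; rewrite mulr_ge0 ?addr_ge0// ltW.
move: bound; move: (k * _) => d bound.
have : 0 <= decay_rate * N%:R by rewrite mulr_ge0// ltW.
by move: bound; lra.
Qed.

End box_decay.

(** * Exponential decay of the Green function *)

Theorem corollary2p3 (R : realType) (V0 : finType) (e0 : rel V0)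
    (e0_sym : symmetric e0) (e0_irr : irreflexive e0)
    (e0_conn : forall v w, connect e0 v w)
    (beta : int * V0 -> int * V0 -> R) (beta_weights : ladder_weights e0 beta) :
  exists c1 c2 : R, [/\ 0 < c1, 0 < c2 &
    forall (Ll Lr : nat) (p : box V0 Ll Lr -> R) (x y : box V0 Ll Lr),
      (forall i, 0 <= p i) -> x != y -> 0 < p x -> 0 < p y ->
    let adj := box_adj e0 (Ll := Ll) (Lr := Lr) in
    let b := box_weight beta in
    let c3 := (Num.min (p x) (p y))^-1 in
    exists l : R,
      [/\ (epsilon%:E * \int[h22_measure adj b (fun i => (epsilon * p i)%R)]_z
             (green adj b (fun i => (epsilon * p i)%R) z.1.1 x y)%:E)%E
            @[epsilon --> 0^'+] --> l%:E,
          0 < l &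
          l <= c1 * c3 *
            expR (- c2 * (hdist (box_vertex x) (box_vertex y))%:R)]].
Proof.
have [c [c0 cE]] := @scale_profile_finite R.
pose Z : R := Num.sqrt (2 * pi).
have Z0 : 0 < Z by exact: sqrt2pi_gt0.
pose rate := decay_rate beta / 8.
have rate0 : 0 < rate by rewrite divr_gt0//; exact: decay_rate_gt0 beta_weights.
have a0 : 0 <= c / (2 * Z) by rewrite divr_ge0// mulr_ge0// ltW.
(* The summand 1 makes the first constant positive. *)
exists ((c / (2 * Z) + 1) * expR rate), rate; split => //.
  by rewrite mulr_gt0 ?expR_gt0//; move: a0; lra.
move=> Ll Lr p x y p0 xy px py adj b c3.
have adjC : symmetric adj by exact: box_adj_sym.
have adjI : irreflexive adj by exact: box_adj_irr.
have adjN u v : connect adj u v by exact: box_adj_conn.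
have bC u v : b u v = b v u by exact: (box_weight_sym beta_weights).
have bP u v : adj u v -> 0 < b u v by exact: (box_weight_gt0 beta_weights).
pose w := wt adj b; pose q (i : 'I_#|box V0 Ll Lr|) := p (enum_val i).
have qx : 0 < q (enum_rank x) by rewrite /q enum_rankK.
have qy : 0 < q (enum_rank y) by rewrite /q enum_rankK.
have q0 i : 0 <= q i by exact: p0.
have wC i j : w i j = w j i by exact: wt_sym.
have w0 i j : 0 <= w i j by exact: wt_ge0.
have wN i j : connect (fun i j => 0 < w i j) i j by exact: wt_conn.
have [l [lim lE l0]] := green_integral_cvg wC w0 wN q0 qx qy.
exists l; split => //.
  apply: cvg_trans lim; apply: near_eq_cvg; near=> s.
  have s0 : 0 < s by near: s; exact: nbhs_right_gt.
  have eps0 v : 0 <= s * p v by rewrite mulr_ge0// ltW.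
  have ex : 0 < s * p x by rewrite mulr_gt0.
  by rewrite (integral_green adjC adjI adjN bC bP eps0 ex).
have XY : enum_rank x != enum_rank y by rewrite (inj_eq enum_rank_inj).
have := limit_le wC w0 wN q0 qx qy XY c0 cE
  (box_decay e0_sym beta_weights x y) lE.
rewrite /q !enum_rankK => /le_trans; apply.
rewrite -/Z -/rate -/c3.
have c30 : 0 <= c3 by rewrite invr_ge0 le_min !ltW.
rewrite [leRHS](_ : _ = (c / (2 * Z) + 1) * c3 *
  (expR rate * expR (- rate * (hdist (box_vertex x) (box_vertex y))%:R))); last by ring.
apply: ler_wpM2r; first by rewrite mulr_ge0 ?expR_ge0.
by apply: ler_wpM2r => //; rewrite lerDl.
Unshelve. all: by end_near.
Qed.
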